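(* Let $\mathfrak{F}:H^2(\mathbb{D})\to L^2(\mathbb{R},e^{-2(e^y-1)}\,dy)$ be the unitary isomorphism $\mathfrak{F}=W T^{-1}\mathcal{L}^{-1}\mathcal{U}$ defined in the context. A closed subspace $M$ of $H^2(\mathbb{D})$ is invariant under the Cesàro operator $\mathcal{C}$ if and only if the subspace $\mathfrak{F}M^\perp$ of $L^2(\mathbb{R},e^{-2(e^y-1)}\,dy)$ is invariant under the right-shift semigroup $\{S_t:\ t\ge0\}$, i.e. $S_t\mathfrak{F}M^\perp\subseteq\mathfrak{F}M^\perp$ for all $t\ge0$.
   Context: $\mathbb{D}$ is the open unit disc, $\mathbb{C}_+$ the open right half-plane, $\mathbb{R}_+=(0,\infty)$. $H^2(\mathbb{D})$ is the Hardy space with orthonormal basis $(z^n)_{n\ge0}$; $M^\perp$ is the orthogonal complement of $M$ in $H^2(\mathbb{D})$. The Cesàro operator is the bounded operator on $H^2(\mathbb{D})$ given, for $f(z)=\sum_{k\ge0} a_k z^k$, by $\mathcal{C}f(z)=\sum_{n=0}^\infty\big(\frac{1}{n+1}\sum_{k=0}^n a_k\big)z^n$. $H^2(\mathbb{C}_+)$ is the Hardy space of analytic $F$ on $\mathbb{C}_+$ with $\|F\|^2=\sup_{x>0}\int_{-\infty}^\infty|F(x+iy)|^2\,dy<\infty$. The maps composing $\mathfrak{F}$ are: (i) $\mathcal{U}:H^2(\mathbb{D})\to H^2(\mathbb{C}_+)$, $\mathcal{U}f(s)=\frac{\sqrt2}{1+s}\,f\big(\frac{s-1}{s+1}\big)$,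 an isomorphism (unitary up to a constant) that satisfies $\mathcal{U}C_{\varphi_t}\mathcal{U}^{-1}=e^tC_{\phi_t}$ for $t\ge0$, where $\varphi_t(z)=e^{-t}z+1-e^{-t}$ on $\mathbb{D}$, $\phi_t(s)=e^ts+(e^t-1)$ on $\mathbb{C}_+$, and $C_\psi g=g\circ\psi$; (ii) $\mathcal{L}:L^2(\mathbb{R}_+)\to H^2(\mathbb{C}_+)$, the Laplace transform $\mathcal{L}f(s)=\int_0^\infty f(x)e^{-sx}\,dx$, an isomorphism by the Paley–Wiener theorem, with $\|\mathcal{L}f\|^2=2\pi\|f\|^2$; (iii) $T:L^2(\mathbb{R})\to L^2(\mathbb{R}_+)$, $Th(x)=x^{-1/2}h(\log x)$, unitary with inverse $T^{-1}g(y)=e^{y/2}g(e^y)$; (iv) $W:L^2(\mathbb{R})\to L^2(\mathbb{R},e^{-2(e^y-1)}\,dy)$, $Wh(y)=e^{e^y-1}h(y)$, unitary. The right-shift semigroup is $S_tf(y)=f(y-t)$, $y\in\mathbb{R}$, $t\ge0$. *)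

(* Defs.v *)
From HB Require Import structures.
From mathcomp Require Import all_boot all_order all_algebra.
From mathcomp Require Import all_classical all_reals all_analysis.
From mathcomp Require Import measurable_realfun complex.

Set Implicit Arguments.
Unset Strict Implicit.
Unset Printing Implicit Defensive.

Import Order.TTheory GRing.Theory Num.Theory.
Import numFieldNormedType.Exports.

Local Open Scope classical_set_scope.
Local Open Scope ring_scope.
Local Open Scope complex_scope.

Notation normc := ComplexField.Normc.normc.
Local Notation Re := complex.Re.
Local Notation Im := complex.Im.

Section hardy_disc.
Context {R : realType}.
Local Notation C := R[i].

(* Partial sums of the power series with coefficients [a]; the regular module
   [C^o] carries the topology of the modulus. *)
Definition power_series (a : nat -> C) (z : C) : nat -> C^o :=
  series (fun n => a n * z ^+ n : C^o).

Definition square_summable (a : nat -> C) : Prop :=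
  cvgn (series (fun n => normc (a n) ^+ 2 : R)).

Definition taylor_coefs (f : C -> C) (a : nat -> C) : Prop :=
  forall z : C, `|z| < 1 -> power_series a z @ \oo --> (f z : C^o).

(* Functions on the open unit disc are represented by functions on [C] that
   vanish off the disc, so that equality in H^2(D) is equality of functions. *)
Definition H2D : set (C -> C) :=
  [set f | (exists2 a, square_summable a & taylor_coefs f a) /\
           (forall z : C, ~~ (`|z| < 1) -> f z = 0)].

Definition coef (f : C -> C) : nat -> C := xget (fun=> 0) (taylor_coefs f).

(* Inner product and norm for which the monomials are orthonormal. *)
Definition H2D_dot (f g : C -> C) : C :=
  limn (series (fun n => coef f n * (coef g n)^* : C^o)).

Definition H2D_norm (f : C -> C) : R :=
  Num.sqrt (limn (series (fun n => normc (coef f n) ^+ 2 : R))).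

Record closed_subspace (M : set (C -> C)) : Prop := ClosedSubspace {
  closed_subspace_sub : M `<=` H2D ;
  closed_subspace0 : M (fun=> 0) ;
  closed_subspaceP : forall (c : C) f g, M f -> M g ->
    M (fun z => c * f z + g z) ;
  closed_subspace_closed : forall f, H2D f ->
    (forall e : R, 0 < e ->
      exists2 g, M g & H2D_norm (fun z => f z - g z) < e) -> M f }.

Definition orthogonal_complement (M : set (C -> C)) : set (C -> C) :=
  [set g | H2D g /\ forall f, M f -> H2D_dot f g = 0].

Definition cesaro_op (f : C -> C) (z : C) : C :=
  if `|z| < 1 then
    limn (power_series
      (fun n => n.+1%:R^-1 * \sum_(0 <= k < n.+1) coef f k) z)
  else 0.

(* Only the values for [0 < Re s] are meaningful. *)
Definition U_map (f : C -> C) (s : C) : C :=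
  (Num.sqrt 2)%:C / (1 + s) * f ((s - 1) / (s + 1)).

End hardy_disc.

Section L2.
Context {d : measure_display} {T : measurableType d} {R : realType}.

(* Square-integrable complex functions on [D], as functions rather than
   classes modulo almost everywhere equality. *)
Definition L2 (mu : {measure set T -> \bar R}) (D : set T) : set (T -> R[i]) :=
  [set f : T -> R[i] | [/\ measurable_fun D (fun x => Re (f x)),
               measurable_fun D (fun x => Im (f x)) &
               (\int[mu]_(x in D) (normc (f x) ^+ 2)%:E < +oo)%E]].

End L2.

Section weighted_measure.
Context {R : realType}.

Definition weight (y : R) : R := expR (- 2 * (expR y - 1)).

Definition weighted_lebesgue : set (measurableTypeR R) -> \bar R :=
  fun A => (\int[lebesgue_measure]_(y in A) (weight y)%:E)%E.

Let weighted0 : weighted_lebesgue set0 = 0%E.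
Proof. by rewrite /weighted_lebesgue integral_set0. Qed.

Let weighted_ge0 A : (0 <= weighted_lebesgue A)%E.
Proof. by apply: integral_ge0 => y _; rewrite lee_fin expR_ge0. Qed.

Lemma measurable_weight : measurable_fun setT weight.
Proof.
apply: measurableT_comp => //; apply: measurable_funM => //.
exact: measurable_funB.
Qed.

Let weighted_sigma_additive : semi_sigma_additive weighted_lebesgue.
Proof.
move=> A mA tA mUA; rewrite /weighted_lebesgue ge0_integral_bigcup//=.
- apply: is_cvg_ereal_nneg_natsum_cond => n _ _.
  by apply: integral_ge0 => y _; rewrite lee_fin expR_ge0.
- apply/measurable_EFinP; exact: measurable_funTS measurable_weight.
- by move=> y _; rewrite lee_fin expR_ge0.
Qed.

HB.instance Definition _ := isMeasure.Build _ _ _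
  weighted_lebesgue weighted0 weighted_ge0 weighted_sigma_additive.

End weighted_measure.

Section transforms.
Context {R : realType}.
Local Notation C := R[i].
Local Notation mu := (@lebesgue_measure R).

Definition cexp (z : C) : C := (expR (Re z))%:C * (cos (Im z) +i* sin (Im z)).

Definition cintegral (D : set R) (f : R -> C) : C :=
  (\int[mu]_(x in D) Re (f x)) +i* (\int[mu]_(x in D) Im (f x)).

Definition laplace (g : R -> C) (s : C) : C :=
  cintegral `]0, +oo[ (fun x => g x * cexp (- (s * x%:C))).

(* A representative of the class of [L^-1 F] in L^2(0, +oo). *)
Definition laplace_inv (F : C -> C) : R -> C :=
  xget (fun=> 0) [set g | L2 mu `]0, +oo[ g /\
                          forall s : C, 0 < Re s -> laplace g s = F s].

(* Inverse of the unitary map [h |-> fun x => x `^ (- 2^-1) * h (ln x)] from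
   L^2(R) onto L^2(0, +oo). *)
Definition T_inv (g : R -> C) (y : R) : C := (expR (y / 2))%:C * g (expR y).

Definition W_map (h : R -> C) (y : R) : C := (expR (expR y - 1))%:C * h y.

Definition F_map (f : C -> C) : R -> C :=
  W_map (T_inv (laplace_inv (U_map f))).

(* The image of [N] in the weighted L^2 space, as the set of all
   representatives of the classes of [F_map f], [f] in [N]. *)
Definition F_image (N : set (C -> C)) : set (R -> C) :=
  [set h | L2 weighted_lebesgue setT h /\
    exists2 f, N f & {ae weighted_lebesgue, forall y, h y = F_map f y}].

Definition right_shift (t : R) (h : R -> C) (y : R) : C := h (y - t).

End transforms.

(* Main.v *)
(* Put [u = e^{-t}].  On Taylor coefficients the adjoint of the composition
   operator [C_{phi_t}] is the Euler mean [E_u a n = sum_k 'C(n, k) u^k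
   (1 - u)^(n - k) a k], and the integral over [t > 0] of [e^{-(j+1)t} E_u] is
   the Hausdorff mean [C (1 + j C)^{-1}], where [C] is the Cesaro operator.  As
   [C] is accretive, a closed subspace that is invariant under [C] is invariant
   under all these means, and the Lerch uniqueness theorem, applied to
   [t |-> <E_u a, b>], brings invariance back to each [E_u]; [j = 0] gives the
   converse.  Hence [M] is invariant under [C] iff [M^perp] is invariant under
   all the [C_{phi_t}].  On the other side, [C_{phi_t}] corresponds under
   [L^{-1} U] to [g |-> g (e^{-t} x) exp (- (1 - e^{-t}) x)], and under the
   whole transform to [e^{t/2} S_t].  That [L^{-1} U f] exists in [L^2] is seen
   by expanding along the Laguerre functions, whose Laplace transforms are the
   [U z^n]. *)
From HB Require Import structures.
Require Import Defs.
From mathcomp Require Import all_boot all_order all_algebra.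
From mathcomp Require Import all_classical all_reals all_analysis.
From mathcomp Require Import complex ring lra measurable_realfun.
Set Implicit Arguments.
Unset Strict Implicit.
Unset Printing Implicit Defensive.
Import Order.TTheory GRing.Theory Num.Theory.
Import numFieldNormedType.Exports.
Local Open Scope classical_set_scope.
Local Open Scope ring_scope.
Local Open Scope complex_scope.
Local Notation Re := complex.Re.
Local Notation Im := complex.Im.

(** The obstacle is that invariance under a bounded operator need not pass to its resolvents: [C]
    has norm 2, so (1 + j C)^{-1} is out of reach of a Neumann series in [C] for j >= 1. Accretivity
    removes it: if y = (1 + j C)^{-1} C a, with a in V, has component n orthogonal to V, then (1 + j
    C) n lies in V, so |n|^2 + j Re <n, C n> = 0 and n = 0. Integers j are enough because the Lerch
    theorem asks for integer nodes only, and for those the resolvent identity is a recurrence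
    between Beta integrals. The pairing <E_u a, b> is at most a multiple of u^{-1/2} = e^{t/2},
    which e^{-(j+1)t} beats already at j = 0. On the other side the inverse Laplace transform is
    known only through its defining property, so the link with the shift comes from comparing
    Laplace transforms and applying Lerch again, at positive integers s. It therefore holds almost
    everywhere, which is why [F_image] collects all representatives. *)

Lemma ler_cvgn {R : realType} (u v : nat -> R) (l m : R) :
  u @ \oo --> l -> v @ \oo --> m -> (forall n, u n <= v n) -> l <= m.
Proof.
by move=> ul vm uv; apply: (ler_cvg_to ul vm); exact: nearW.
Qed.

(** * Real Hilbert space geometry of square-summable complex sequences *)

Section square_summable_sequences.
Context {R : realType}.
Local Notation C := R[i].
Implicit Types (a b c : nat -> C) (z w : C).

(* For complex subspaces, orthogonality for the real inner product
   [Re (z * conj w)] is the same as complex orthogonality. *)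
Definition rdot z w : R := Re z * Re w + Im z * Im w.

Lemma rdotC z w : rdot z w = rdot w z.
Proof. by rewrite /rdot mulrC [X in _ + X]mulrC. Qed.

Lemma rdotDl z1 z2 w : rdot (z1 + z2) w = rdot z1 w + rdot z2 w.
Proof. by case: z1 z2 => ? ? [? ?]; rewrite /rdot /=; ring. Qed.

Lemma rdotZl (t : R) z w : rdot (t%:C * z) w = t * rdot z w.
Proof. by case: z => ? ?; rewrite /rdot /=; ring. Qed.

Lemma rdotNl z w : rdot (- z) w = - rdot z w.
Proof. by case: z => ? ?; rewrite /rdot /=; ring. Qed.

Lemma rdot_ge0 z : 0 <= rdot z z.
Proof. by rewrite /rdot -!expr2 addr_ge0 ?sqr_ge0. Qed.

Lemma rdot_normc z : rdot z z = normc z ^+ 2.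
Proof.
by case: z => x y; rewrite /rdot /= sqr_sqrtr ?addr_ge0 ?sqr_ge0// !expr2.
Qed.

Lemma rdotM z w : rdot (z * w) (z * w) = rdot z z * rdot w w.
Proof. by case: z w => ? ? [? ?]; rewrite /rdot /=; ring. Qed.

Lemma rdot0 w : rdot 0 w = 0.
Proof. by rewrite /rdot /= !mul0r addr0. Qed.

Definition psum a b : nat -> R := series (fun n => rdot (a n) (b n)).

Lemma psumS a b n : psum a b n.+1 = psum a b n + rdot (a n) (b n).
Proof. by rewrite /psum /series /= big_nat_recr. Qed.

Lemma psumC a b : psum a b = psum b a.
Proof. by congr series; apply/funext => n; rewrite rdotC. Qed.

Lemma psumDl a b c n : psum (a + b) c n = psum a c n + psum b c n.
Proof.
by rewrite /psum /series /= -big_split/=; apply: eq_bigr => k _; rewrite -rdotDl.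
Qed.

Definition scl (w : C) a : nat -> C := fun n => w * a n.

Lemma psumZl (t : R) a b n : psum (scl t%:C a) b n = t * psum a b n.
Proof.
by rewrite /psum /series /= mulr_sumr; apply: eq_bigr => k _; rewrite -rdotZl.
Qed.

Lemma psum_ge0 a n : 0 <= psum a a n.
Proof. by rewrite sumr_ge0// => k _; exact: rdot_ge0. Qed.

Lemma psum_nd a : nondecreasing_seq (psum a a).
Proof. by apply/nondecreasing_seqP => n; rewrite psumS lerDl rdot_ge0. Qed.

(** One discriminant argument behind all the Cauchy-Schwarz inequalities below: for partial sums,
    for [sdot], for near-minimisers of a distance and for weighted sums of moduli. *)
Lemma discr_le0 (x y z : R) : (forall t, 0 <= x + 2 * t * y + t ^+ 2 * z) ->
  y ^+ 2 <= x * z.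
Proof.
move=> h.
have z0 : 0 <= z.
  rewrite leNgt; apply/negP => z0.
  have y2 := sqr_ge0 y.
  (* For negative [z] this value of [t] is large enough for the quadratic term to outweigh the other
     two. *)
  have := h ((`|x| + 2 * `|y| + 1) / (- z)  + 1).
  set s := _ / _ + 1.
  have s1 : 1 <= s.
    by rewrite /s lerDr divr_ge0 ?addr_ge0 ?mulr_ge0 ?oppr_ge0 ?(ltW z0).
  have sz : s * (- z) = `|x| + 2 * `|y| + 1 - z.
    have zn : - z != 0 by rewrite oppr_eq0 lt_eqF.
    by rewrite /s mulrDl divfK// mul1r.
  have hx := ler_norm x; have hy := ler_norm y.
  have s0 : 0 <= s by lra.
  have h1 : s * y <= s * `|y| by rewrite ler_wpM2l.
  have h2 : 1 * `|x| <= s * `|x| by rewrite ler_wpM2r.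
  have -> : s ^+ 2 * z = - (s * (s * - z)) by ring.
  rewrite sz.
  have h3 : 0 < s * (1 - z) by apply: mulr_gt0; lra.
  have -> : s * (`|x| + 2 * `|y| + 1 - z) = s * `|x| + 2 * (s * `|y|) + s * (1 - z) by ring.
  have -> : 2 * s * y = 2 * (s * y) by ring.
  lra.
case: (eqVneq z 0) => [z_eq0|zn0].
  rewrite z_eq0 mulr0.
  case: (eqVneq y 0) => [->|yn0]; first by rewrite expr0n.
  (* With [z = 0] the form is affine in [t], and here it takes the value -1. *)
  have := h (- (x + 1) / (2 * y)).
  have -> : x + 2 * (- (x + 1) / (2 * y)) * y +
      (- (x + 1) / (2 * y)) ^+ 2 * z = -1 by rewrite z_eq0; field.
  lra.
have zp : 0 < z by rewrite lt_def zn0.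
have := h (- y / z).
have -> : x + 2 * (- y / z) * y + (- y / z) ^+ 2 * z = (x * z - y ^+ 2) / z.
  by field.
by rewrite pmulr_lge0 ?invr_gt0// subr_ge0.
Qed.

Lemma psum_quad a b (t : R) n :
  psum (a + scl t%:C b) (a + scl t%:C b) n =
  psum a a n + 2 * t * psum a b n + t ^+ 2 * psum b b n.
Proof.
rewrite psumDl !(psumC _ (a + _)) !psumDl psumZl !(psumC _ (scl _ _)) !psumZl.
by rewrite (psumC b a) (psumC b (scl _ _)) psumZl; ring.
Qed.

Lemma psum_CS a b n : (psum a b n) ^+ 2 <= psum a a n * psum b b n.
Proof. by apply: discr_le0 => t; rewrite -psum_quad psum_ge0. Qed.

Definition ell2 a := exists K : R, forall n, psum a a n <= K.

Lemma ell2D a b : ell2 a -> ell2 b -> ell2 (a + b).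
Proof.
move=> [K hK] [L hL]; exists (2 * K + 2 * L) => n.
have := psum_ge0 (a + scl (-1)%:C b) n.
have -> : a + b = a + scl 1%:C b by congr (_ + _); apply/funext=> k; rewrite /scl mul1r.
by rewrite !psum_quad; have := hK n; have := hL n; lra.
Qed.

Lemma ell2Z w a : ell2 a -> ell2 (scl w a).
Proof.
move=> [K hK]; exists (rdot w w * K) => n.
apply: (@le_trans _ _ (rdot w w * psum a a n)); last first.
  by rewrite ler_wpM2l ?rdot_ge0.
by rewrite /psum /series /= mulr_sumr ler_sum// => k _; rewrite rdotM.
Qed.

Lemma scl0 a : scl 0 a = 0.
Proof. by apply/funext => n; rewrite /scl mul0r. Qed.

Lemma sclN1 a : scl (-1)%:C a = - a.
Proof. by apply/funext => n; rewrite /scl rmorphN mulN1r. Qed.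

Lemma ell2N a : ell2 a -> ell2 (- a).
Proof. by rewrite -sclN1; exact: ell2Z. Qed.

Lemma ell2B a b : ell2 a -> ell2 b -> ell2 (a - b).
Proof. by move=> ? ?; apply: ell2D => //; exact: ell2N. Qed.

Lemma ell2_0 : ell2 0.
Proof. by exists 0 => n; rewrite /psum /series /= big1// => k _; rewrite rdot0. Qed.

Definition sdot a b : R := limn (psum a b).

Lemma cvg_psum_sq a : ell2 a -> cvgn (psum a a).
Proof.
by move=> [K hK]; apply: nondecreasing_is_cvgn; [exact: psum_nd|exists K => _ [n _ <-]].
Qed.

Lemma cvg_psum a b : ell2 a -> ell2 b -> psum a b @ \oo --> sdot a b.
Proof.
move=> ha hb; suff: cvgn (psum a b) by [].
(* Polarisation reduces the claim to bounded monotone sums. *)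
have -> : psum a b = (fun n => 4^-1 * (psum (a + b) (a + b) n - psum (a - b) (a - b) n)).
  apply/funext => n /=.
  rewrite -sclN1 psum_quad.
  have -> : a + b = a + scl 1%:C b by congr (_ + _); apply/funext=> k; rewrite /scl mul1r.
  by rewrite psum_quad; field.
apply: is_cvgMl_tmp; apply: is_cvgB; apply: cvg_psum_sq; [exact: ell2D|exact: ell2B].
Qed.

Lemma sdotC a b : sdot a b = sdot b a.
Proof. by rewrite /sdot psumC. Qed.

Lemma sdotDl a b c : ell2 a -> ell2 b -> ell2 c ->
  sdot (a + b) c = sdot a c + sdot b c.
Proof.
move=> ha hb hc; apply/cvg_lim => //.
have -> : psum (a + b) c = psum a c \+ psum b c by apply/funext => n; exact: psumDl.
by apply: cvgD; exact: cvg_psum.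
Qed.

Lemma sdotZl (t : R) a b : ell2 a -> ell2 b ->
  sdot (scl t%:C a) b = t * sdot a b.
Proof.
move=> ha hb; apply/cvg_lim => //.
have -> : psum (scl t%:C a) b = (fun n => t * psum a b n) by apply/funext => n; exact: psumZl.
by apply: cvgMl_tmp; exact: cvg_psum.
Qed.

Lemma sdotNl a b : ell2 a -> ell2 b -> sdot (- a) b = - sdot a b.
Proof. by move=> ? ?; rewrite -sclN1 sdotZl// mulN1r. Qed.

Lemma sdotBl a b c : ell2 a -> ell2 b -> ell2 c ->
  sdot (a - b) c = sdot a c - sdot b c.
Proof. by move=> ? ? ?; rewrite sdotDl ?sdotNl//; exact: ell2N. Qed.

Lemma sdotDr a b c : ell2 a -> ell2 b -> ell2 c ->
  sdot c (a + b) = sdot c a + sdot c b.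
Proof. by move=> ? ? ?; rewrite sdotC sdotDl// !(sdotC c). Qed.

Lemma sdotBr a b c : ell2 a -> ell2 b -> ell2 c ->
  sdot c (a - b) = sdot c a - sdot c b.
Proof. by move=> ? ? ?; rewrite sdotC sdotBl// !(sdotC c). Qed.

Lemma sdotZr (t : R) a b : ell2 a -> ell2 b ->
  sdot b (scl t%:C a) = t * sdot b a.
Proof. by move=> ? ?; rewrite sdotC sdotZl// sdotC. Qed.

Lemma sdot_quad a b (t : R) : ell2 a -> ell2 b ->
  sdot (a + scl t%:C b) (a + scl t%:C b) =
  sdot a a + 2 * t * sdot a b + t ^+ 2 * sdot b b.
Proof.
move=> ha hb; have hb' := ell2Z t%:C hb.
rewrite sdotDl ?sdotDr ?sdotZl ?sdotZr//; [|exact: ell2D..].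
by rewrite (sdotC b a) ; ring.
Qed.

Lemma psum_le_sdot a n : ell2 a -> psum a a n <= sdot a a.
Proof.
by move=> ha; apply: nondecreasing_cvgn_le; [exact: psum_nd|exact: cvg_psum_sq].
Qed.

Lemma sdot_ge0 a : ell2 a -> 0 <= sdot a a.
Proof. by move=> ha; rewrite (le_trans (psum_ge0 a 0))// psum_le_sdot. Qed.

Lemma sdot_CS a b : ell2 a -> ell2 b -> sdot a b ^+ 2 <= sdot a a * sdot b b.
Proof. by move=> ha hb; apply: discr_le0 => t; rewrite -sdot_quad// sdot_ge0//; apply: ell2D=> //; exact: ell2Z. Qed.

Lemma sdot_le a K : (forall n, psum a a n <= K) -> ell2 a /\ sdot a a <= K.
Proof.
move=> h; have ha : ell2 a by exists K.
by split=> //; apply: limr_le; [exact: cvg_psum_sq|exact: nearW].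
Qed.

Lemma sdot0_eq0 a : ell2 a -> sdot a a = 0 -> a = 0.
Proof.
move=> ha a0; apply/funext => n.
have := psum_le_sdot n.+1 ha; rewrite a0 psumS => h.
have := psum_ge0 a n; have := rdot_ge0 (a n) => h1 h2.
have : rdot (a n) (a n) = 0 by lra.
case: (a n) => x y; rewrite /rdot /= => h3.
have hx := sqr_ge0 x; have hy := sqr_ge0 y.
have /eqP : x ^+ 2 = 0 by nra.
have /eqP : y ^+ 2 = 0 by nra.
by rewrite !sqrf_eq0 => /eqP -> /eqP ->.
Qed.

(** A Cauchy criterion in the shape that the parallelogram law produces: squared distances bounded
    by a sum of two vanishing defects. *)
Lemma cvg_of_dist (u : nat -> R) (e : nat -> R) : e @ \oo --> (0 : R) ->
  (forall i j, (u i - u j) ^+ 2 <= e i + e j) -> cvgn u.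
Proof.
move=> e0 h; apply/cauchy_cvgP; apply: cauchy_exP => eps eps0.
have eps2 : 0 < eps ^+ 2 / 2 by rewrite divr_gt0 ?exprn_gt0.
have [N _ hN] : \forall n \near \oo, e n < eps ^+ 2 / 2.
  by move/cvgr_lt : e0; exact.
exists (u N); exists N => // n /= Nn.
rewrite /ball /=.
have := h N n; have := hN _ Nn; have := hN N (leqnn N) => h1 h2 h3.
have : (u N - u n) ^+ 2 < eps ^+ 2 by lra.
by rewrite -[X in X < _]real_normK ?num_real// ltr_pXn2r ?nnegrE// ltW.
Qed.

Lemma rdot_sqB z w : rdot (z - w) (z - w) =
  (Re z - Re w) * (Re z - Re w) + (Im z - Im w) * (Im z - Im w).
Proof. by case: z w => ? ? [? ?]. Qed.

Lemma rdot_re_sq z : Re z ^+ 2 <= rdot z z.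
Proof. by rewrite /rdot expr2 lerDl -expr2 sqr_ge0. Qed.

Lemma rdot_im_sq z : Im z ^+ 2 <= rdot z z.
Proof. by rewrite /rdot -expr2 [leLHS]expr2 lerDr sqr_ge0. Qed.

Lemma rdot_le_psum a n : rdot (a n) (a n) <= psum a a n.+1.
Proof. by rewrite psumS lerDr psum_ge0. Qed.

(** The limit is taken coordinate by coordinate. For a fixed number of terms the bound passes to the
    limit in one index, where its defect vanishes; this leaves the explicit distance [e j] to the
    limit, which the projection theorem uses. *)
Lemma ell2_complete (a : nat -> nat -> C) (e : nat -> R) :
  (forall i, ell2 (a i)) -> e @ \oo --> (0 : R) ->
  (forall i j, sdot (a i - a j) (a i - a j) <= e i + e j) ->
  exists2 l, ell2 l & forall j, sdot (a j - l) (a j - l) <= e j.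
Proof.
move=> ha e0 h.
have hr n : cvgn (fun i => Re (a i n)).
  apply: (cvg_of_dist e0) => i j; apply: le_trans (h i j).
  apply: le_trans (psum_le_sdot n.+1 (ell2B (ha i) (ha j))).
  apply: le_trans (rdot_le_psum (a i - a j) n).
  by have := rdot_re_sq ((a i - a j) n); rewrite raddfB.
have hi n : cvgn (fun i => Im (a i n)).
  apply: (cvg_of_dist e0) => i j; apply: le_trans (h i j).
  apply: le_trans (psum_le_sdot n.+1 (ell2B (ha i) (ha j))).
  apply: le_trans (rdot_le_psum (a i - a j) n).
  by have := rdot_im_sq ((a i - a j) n); rewrite raddfB.
pose l n := limn (fun i => Re (a i n)) +i* limn (fun i => Im (a i n)).
have bnd j n : psum (a j - l) (a j - l) n <= e j.
  have : (fun i => psum (a j - a i) (a j - a i) n) @ \oo --> psum (a j - l) (a j - l) n.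
    elim: n => [|n IHn]; first by rewrite /psum /series /= big_geq//; under eq_fun do rewrite big_geq//; exact: cvg_cst.
    under eq_fun do rewrite psumS; rewrite psumS; apply: cvgD => //.
    under eq_fun do rewrite rdot_sqB; rewrite rdot_sqB.
    have hre : (fun i => Re (a j n) - Re (a i n)) @ \oo --> Re (a j n) - Re (l n).
      by apply: cvgB; [exact: cvg_cst|exact: hr].
    have him : (fun i => Im (a j n) - Im (a i n)) @ \oo --> Im (a j n) - Im (l n).
      by apply: cvgB; [exact: cvg_cst|exact: hi].
    by apply: cvgD; apply: cvgM.
  move=> cl; apply: (ler_cvgn (v := fun i => e j + e i) cl).
    by rewrite -[X in _ --> X]addr0; apply: cvgD => //; exact: cvg_cst.
  move=> i; apply: le_trans (h j i).
  exact/psum_le_sdot/ell2B.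
have hl : ell2 l.
  have [hl _] := sdot_le (bnd 0%N).
  have -> : l = a 0%N - (a 0%N - l) by rewrite opprB addrC subrK.
  exact: ell2B.
by exists l => // j; have [] := sdot_le (bnd j).
Qed.

Record hilbert_subspace (V : set (nat -> C)) : Prop := HilbertSubspace {
  hilbert_sub : V `<=` ell2 ;
  hilbert0 : V 0 ;
  hilbertD : forall a b, V a -> V b -> V (a + b) ;
  hilbertZ : forall w a, V a -> V (scl w a) ;
  hilbert_closed : forall a, ell2 a ->
    (forall e : R, 0 < e -> exists2 b, V b & sdot (a - b) (a - b) < e) -> V a }.

Lemma sdot_parallelogram a b : ell2 a -> ell2 b ->
  sdot (a - b) (a - b) =
  2 * sdot a a + 2 * sdot b b - sdot (a + b) (a + b).
Proof.
move=> ha hb; rewrite -sclN1 sdot_quad//.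
have -> : a + b = a + scl 1%:C b by congr (_ + _); apply/funext=> k; rewrite /scl mul1r.
by rewrite sdot_quad//; ring.
Qed.

Lemma hilbert_projection V h : hilbert_subspace V -> ell2 h ->
  exists2 m, V m & forall v, V v -> sdot (h - m) v = 0.
Proof.
move=> [subV V0 VD VZ Vcl] hh.
pose D := [set sdot (h - v) (h - v) | v in V].
pose d := inf D.
have lbD : lbound D 0 by move=> _ [v Vv <-]; apply/sdot_ge0/ell2B => //; exact: subV.
have D0 : D !=set0 by exists (sdot (h - 0) (h - 0)); exists 0.
have hinf : has_inf D by split => //; exists 0.
have dle v : V v -> d <= sdot (h - v) (h - v).
  by move=> Vv; apply: ge_inf; [exists 0|exists v].
pose e n : R := n.+1%:R^-1.
have e0 n : 0 < e n by rewrite invr_gt0.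
have ecvg : e @ \oo --> (0 : R) by exact: cvg_harmonic.
have /choice[v hv] n : exists v, V v /\ sdot (h - v) (h - v) < d + e n.
  by have [_ [v Vv <-] hv] := inf_adherent (e0 n) hinf; exists v.
have hvn n : ell2 (v n) by apply: subV; have [] := hv n.
have hhv n : ell2 (h - v n) by exact: ell2B.
have [||i j|m hm vm] := @ell2_complete v (fun n => 2 * e n) => //.
- by rewrite -[X in _ --> X](mulr0 2); apply: cvgMl_tmp.
- have -> : v i - v j = (h - v j) - (h - v i).
    by apply/funext => k; rewrite !fctE; ring.
  rewrite sdot_parallelogram//.
  (* The midpoint of two near-minimisers lies in [V], hence at squared distance at least [d] from
     [h]. The parallelogram law then leaves [2 * e i + 2 * e j]. *)
  pose w := scl 2^-1%:C (v i + v j).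
  have Vw : V w by apply/VZ/VD; [have [] := hv i|have [] := hv j].
  have hw := subV _ Vw.
  have -> : h - v j + (h - v i) = scl 2%:C (h - w).
    apply/funext => k; rewrite /scl /w /scl !fctE rmorphV ?unitfE//=.
    have -> : (2%:C : C) = 2 by rewrite rmorph_nat.
    by field.
  have hhw := ell2B hh hw.
  rewrite sdotZl ?sdotZr//; last exact: ell2Z.
  have := dle _ Vw; have [_ ] := hv i; have [_] := hv j => /=; lra.
exists m.
  apply: Vcl => // eps eps0.
  have [N _ hN] : \forall n \near \oo, (fun n => 2 * e n) n < eps.
    have : (fun n => 2 * e n) @ \oo --> 0 by rewrite -[X in _ --> X](mulr0 2); apply: cvgMl_tmp.
    by move/cvgr_lt; exact.
  exists (v N); first by have [] := hv N.
  apply: le_lt_trans (hN N (leqnn N)).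
  have hB := ell2B (hvn N) hm; have hB' := ell2N hB.
  by rewrite -opprB sdotNl// sdotC sdotNl// opprK; exact: vm.
move=> u Vu; have hu := subV _ Vu.
have hhm : ell2 (h - m) by exact: ell2B.
(* Near-minimality alone: moving [v n] by any multiple of [u] stays in [V], so the squared distance
   drops by at most [e n]. This is a nonnegative quadratic in [t] with constant term [e n]. *)
have bnd n : sdot (h - v n) u ^+ 2 <= e n * sdot u u.
  apply: discr_le0 => t.
  have : V (v n - scl t%:C u).
    by rewrite -sclN1; apply: VD; [have [] := hv n|exact/VZ/VZ].
  move/dle.
  have -> : h - (v n - scl t%:C u) = (h - v n) + scl t%:C u by rewrite opprB addrA addrAC.
  rewrite sdot_quad//; have [_ ] := hv n; lra.
(* The constant 6 is 2 * 1 + 2 * 2, from (x + y)^2 <= 2 x^2 + 2 y^2 with x^2 <= [e n * sdot u u] and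
   y^2 <= [2 * e n * sdot u u]. *)
have key n : sdot (h - m) u ^+ 2 <= 6 * sdot u u * e n.
  have hB := ell2B (hvn n) hm.
  have -> : h - m = (h - v n) + (v n - m) by rewrite addrA subrK.
  rewrite sdotDl//.
  have := bnd n; have := sdot_CS hB hu; have := vm n => /= h1 h2 h3.
  have h4 : sdot (v n - m) (v n - m) * sdot u u <= 2 * e n * sdot u u.
    by rewrite ler_wpM2r// sdot_ge0.
  have := sqr_ge0 (sdot (h - v n) u - sdot (v n - m) u); lra.
have le0 : sdot (h - m) u ^+ 2 <= 0.
  apply: (ler_cvgn (cvg_cst _) _ key).
  by rewrite -[X in _ --> X](mulr0 (6 * sdot u u)); apply: cvgMl_tmp.
by apply/eqP; rewrite -sqrf_eq0 eq_le le0 sqr_ge0.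
Qed.

End square_summable_sequences.

(** * Cesaro and Euler means *)

Section cesaro_and_euler_means.
Context {R : realType}.
Local Notation C := R[i].
Implicit Types (a b : nat -> C) (z w : C).

Definition ces a (n : nat) : C := n.+1%:R^-1 * \sum_(0 <= k < n.+1) a k.

Lemma natC n : (n%:R : C) = (n%:R : R)%:C.
Proof. by rewrite rmorph_nat. Qed.

Lemma ces_eq a n : \sum_(0 <= k < n.+1) a k = n.+1%:R%:C * ces a n.
Proof. by rewrite /ces -natC mulrA mulfV ?pnatr_eq0// mul1r. Qed.

(** With b = [ces a] one has a_n = (n+1) b_n - n b_{n-1}, and 2 Re <b_{n-1}, b_n> <= |b_{n-1}|^2 +
    |b_n|^2 makes the sum telescope. The boundary term on the left is what the induction carries
    along. *)
Lemma ces_pos_strong a n :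
  psum (ces a) (ces a) n.+1 + n.+1%:R * rdot (ces a n) (ces a n) <=
  2 * psum a (ces a) n.+1.
Proof.
elim: n => [|n IHn].
  have a0 : ces a 0 = a 0%N by rewrite /ces big_nat1 invr1 mul1r.
  by rewrite !psumS a0 /psum /series /= !big_geq//; lra.
rewrite psumS [in leRHS]psumS.
have -> : a n.+1 = n.+2%:R%:C * ces a n.+1 - n.+1%:R%:C * ces a n.
  by rewrite -!ces_eq [X in X - _]big_nat_recr//= addrAC subrr add0r.
rewrite rdotDl rdotNl !rdotZl.
set b := ces a n.+1; set c := ces a n in IHn *.
have h : 2 * rdot c b <= rdot b b + rdot c c.
  have := rdot_ge0 (c - b); rewrite rdot_sqB /rdot; lra.
have h' : n.+1%:R * (2 * rdot c b) <= n.+1%:R * (rdot b b + rdot c c) by rewrite ler_wpM2l.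
rewrite -[in X in X%:R * rdot b b](addn1 n.+1) natrD; lra.
Qed.

Lemma ces_pos a n : psum (ces a) (ces a) n <= 2 * psum a (ces a) n.
Proof.
case: n => [|n]; first by rewrite /psum /series /= !big_geq// mulr0.
by apply: le_trans (ces_pos_strong a n); rewrite lerDl mulr_ge0// rdot_ge0.
Qed.

(** Hardy's inequality: positivity gives x <= 2 y, Cauchy-Schwarz gives y^2 <= x z, and together x
    <= 4 z. *)
Lemma psum_ces a n : psum (ces a) (ces a) n <= 4 * psum a a n.
Proof.
have h1 := ces_pos a n; have h2 := psum_CS a (ces a) n.
have h3 := psum_ge0 a n; have h4 := psum_ge0 (ces a) n.
set x := psum (ces a) (ces a) n in h1 h2 h4 *.
set y := psum a (ces a) n in h1 h2 *; set z := psum a a n in h2 h3 *.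
rewrite leNgt; apply/negP => zx.
have : x * (4 * z) < x * x by rewrite ltr_pM2l//; lra.
have : x * x <= (2 * y) * (2 * y) by apply: ler_pM.
by lra.
Qed.

Lemma ell2_ces a : ell2 a -> ell2 (ces a).
Proof.
by move=> [K hK]; exists (4 * K) => n; rewrite (le_trans (psum_ces a n))// ler_wpM2l.
Qed.

Lemma sdot_ces_ge0 a : ell2 a -> 0 <= sdot a (ces a).
Proof.
move=> ha; apply: (ler_cvgn (cvg_cst _) (cvg_psum ha (ell2_ces ha))) => n.
have := ces_pos a n; have := psum_ge0 (ces a) n; lra.
Qed.

Lemma cesD a b : ces (a + b) = ces a + ces b.
Proof. by apply/funext => n; rewrite /ces !fctE big_split/= mulrDr. Qed.

(** Accretivity in the form used for resolvents: 1 + t C does not shrink any partial sum, so a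
    preimage under it is square summable as soon as its image is. *)
Lemma ces_accretive_bound (t : R) a n : 0 <= t ->
  psum a a n <= psum (a + scl t%:C (ces a)) (a + scl t%:C (ces a)) n.
Proof.
move=> t0; rewrite psum_quad.
have h1 : 0 <= t * (2 * psum a (ces a) n).
  by rewrite mulr_ge0// (le_trans _ (ces_pos a n))// psum_ge0.
have h2 : 0 <= t ^+ 2 * psum (ces a) (ces a) n by rewrite mulr_ge0 ?sqr_ge0 ?psum_ge0.
lra.
Qed.

(** The Bernstein polynomials, that is, the binomial law with success probability [u]. *)
Definition bw (n k : nat) (u : R) : R := 'C(n, k)%:R * u ^+ k * (1 - u) ^+ (n - k).

Lemma bw_ge0 n k u : 0 <= u <= 1 -> 0 <= bw n k u.
Proof.
by move=> /andP[u0 u1]; rewrite /bw !mulr_ge0 ?exprn_ge0 ?subr_ge0.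
Qed.

Lemma bw_small n k u : (n < k)%N -> bw n k u = 0.
Proof. by move=> nk; rewrite /bw bin_small// !mul0r. Qed.

(** Fills a triangular sum up to a square one, so that the order of summation can be exchanged. *)
Lemma sum_bw n (F : pzRingType) (f : nat -> nat -> F) N : (n < N)%N ->
  (forall k, (n < k)%N -> f n k = 0) ->
  \sum_(0 <= k < n.+1) f n k = \sum_(0 <= k < N) f n k.
Proof.
move=> nN f0; rewrite [RHS](big_cat_nat (n := n.+1))//= [X in _ + X]big_nat.
by rewrite [X in _ + X]big1 ?addr0// => k /andP[+ _]; exact: f0.
Qed.

Lemma bw_sum1 n u : \sum_(0 <= k < n.+1) bw n k u = 1.
Proof.
rewrite big_mkord -[RHS](expr1n _ n) -[X in X ^+ n](subrK u) exprDn.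
by apply: eq_bigr => k _; rewrite /bw -mulr_natl; ring.
Qed.

Lemma bwSS n k u : bw n.+1 k.+1 u = u * bw n k u + (1 - u) * bw n k.+1 u.
Proof.
rewrite /bw subSS binS natrD exprS.
have [nk|kn] := leqP n k.
  have -> : 'C(n, k.+1) = 0%N by exact: bin_small.
  ring.
by rewrite -(subnSK kn) exprS; ring.
Qed.

(** A partial sum of the negative binomial law. Pascal's rule gives T = u S' + (1 - u) S for the
    columns k+1 (T, and S with one row less) and k (S'). As S <= T, this yields u S <= u S', hence u
    T <= u S'. *)
Lemma bw_col k N u : 0 <= u <= 1 -> u * \sum_(0 <= n < N) bw n k u <= 1.
Proof.
move=> u01; have /andP[u0 u1] := u01; elim: k N => [|k IHk] N.
  suff -> : u * \sum_(0 <= n < N) bw n 0 u = 1 - (1 - u) ^+ N.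
    by rewrite gerBl exprn_ge0// subr_ge0.
  elim: N => [|N IHN]; first by rewrite big_geq// expr0; ring.
  by rewrite big_nat_recr//= mulrDr IHN /bw bin0 expr0 subn0 exprS; ring.
case: N => [|N]; first by rewrite big_geq// mulr0.
have := IHk N.
have : \sum_(0 <= n < N) bw n k.+1 u <= \sum_(0 <= n < N.+1) bw n k.+1 u.
  by rewrite big_nat_recr//= lerDl bw_ge0.
set T := (\sum_(0 <= n < N.+1) _); set S := (\sum_(0 <= n < N) bw n k.+1 u).
set S' := (\sum_(0 <= n < N) bw n k u) => TS.
have -> : T = u * S' + (1 - u) * S.
  rewrite /T big_nat_recl// bw_small// add0r /S' /S !mulr_sumr -big_split/=.
  by apply: eq_bigr => n _; rewrite bwSS.
move: TS.
have -> : T = u * S' + (1 - u) * S.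
  rewrite /T big_nat_recl// bw_small// add0r /S' /S !mulr_sumr -big_split/=.
  by apply: eq_bigr => n _; rewrite bwSS.
move=> TS h.
have h2 : u * S <= u * S' by lra.
have : u * (u * S) <= u * (u * S') by rewrite ler_wpM2l.
have : u * ((1 - u) * S) <= (1 - u) * (u * S') by rewrite mulrCA ler_wpM2l// subr_ge0.
lra.
Qed.

Definition eul (u : R) a (n : nat) : C := \sum_(0 <= k < n.+1) (bw n k u)%:C * a k.

Lemma rdot_sumr (s : seq nat) (f : nat -> C) w :
  rdot (\sum_(k <- s) f k) w = \sum_(k <- s) rdot (f k) w.
Proof.
elim: s => [|k s IHs]; first by rewrite !big_nil rdot0.
by rewrite !big_cons rdotDl IHs.
Qed.

(** Convexity of the squared modulus: the difference of the two sides is the variance of [a] under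
    the law [p]. *)
Lemma rdot_jensen (s : seq nat) (p : nat -> R) a :
  (forall k, 0 <= p k) -> \sum_(k <- s) p k = 1 ->
  rdot (\sum_(k <- s) (p k)%:C * a k) (\sum_(k <- s) (p k)%:C * a k) <=
  \sum_(k <- s) p k * rdot (a k) (a k).
Proof.
move=> p0 p1; set m := \sum_(k <- s) _.
have : 0 <= \sum_(k <- s) p k * rdot (a k - m) (a k - m).
  by apply: sumr_ge0 => k _; rewrite mulr_ge0// rdot_ge0.
suff -> : \sum_(k <- s) p k * rdot (a k - m) (a k - m) =
   \sum_(k <- s) p k * rdot (a k) (a k) - rdot m m by rewrite subr_ge0.
transitivity (\sum_(k <- s) (p k * rdot (a k) (a k) - 2 * rdot ((p k)%:C * a k) m +
    p k * rdot m m)).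
  by apply: eq_bigr => k _; rewrite rdot_sqB rdotZl /rdot; ring.
rewrite big_split/= sumrB -mulr_suml p1 -mulr_sumr -rdot_sumr -/m; ring.
Qed.

(** A Schur test: the rows of the Euler matrix sum to 1, which allows Jensen's inequality, and its
    columns sum to at most 1 / u. Hence the squared norm of the mean is at most 1 / u. *)
Lemma psum_eul u a N : 0 <= u <= 1 ->
  u * psum (eul u a) (eul u a) N <= psum a a N.
Proof.
move=> u01; have /andP[u0 u1] := u01.
apply: (@le_trans _ _ (u * \sum_(0 <= n < N) \sum_(0 <= k < N) bw n k u * rdot (a k) (a k))).
  apply: ler_wpM2l => //; apply: ler_sum_nat => n /andP[_ nN].
  rewrite -(@sum_bw n _ (fun n k => bw n k u * rdot (a k) (a k)))//; last first.
    by move=> k nk; rewrite bw_small// mul0r.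
  by apply: rdot_jensen; [move=> k; exact: bw_ge0|exact: bw_sum1].
rewrite exchange_big/= mulr_sumr; apply: ler_sum => k _.
by rewrite -mulr_suml mulrA ler_piMl ?rdot_ge0 ?bw_col.
Qed.

Lemma ell2_eul u a : 0 < u <= 1 -> ell2 a -> ell2 (eul u a).
Proof.
move=> /andP[u0 u1] [K hK]; exists (u^-1 * K) => n.
rewrite ler_pdivlMl// (le_trans _ (hK n))// psum_eul//.
by rewrite u1 ltW.
Qed.

Lemma sdot_eul u a : 0 < u <= 1 -> ell2 a ->
  u * sdot (eul u a) (eul u a) <= sdot a a.
Proof.
move=> u01 ha; have hE := ell2_eul u01 ha; have /andP[u0 u1] := u01.
rewrite -ler_pdivlMl//; apply: (sdot_le _).2 => n.
rewrite ler_pdivlMl//; apply: le_trans (psum_le_sdot n ha).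
by apply: psum_eul; rewrite u1 ltW.
Qed.

Lemma eulD u a b : eul u (a + b) = eul u a + eul u b.
Proof.
apply/funext => n; rewrite /eul !fctE -big_split/=.
by apply: eq_bigr => k _; rewrite mulrDr.
Qed.

Lemma eulZ u w a : eul u (scl w a) = scl w (eul u a).
Proof.
apply/funext => n; rewrite /eul /scl mulr_sumr.
by apply: eq_bigr => k _; rewrite mulrCA.
Qed.

End cesaro_and_euler_means.

(** * Integrals on the half-line and the Lerch theorem *)

Lemma Rdominated_convergence d (T : measurableType d) (R : realType)
    (mu : {measure set T -> \bar R}) (D : set T) (fn : nat -> T -> R) (f g : T -> R) :
  measurable D -> (forall n, measurable_fun D (fn n)) -> measurable_fun D f ->
  {ae mu, forall x, D x -> fn ^~ x @ \oo --> f x} ->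
  mu.-integrable D (EFin \o g) ->
  (forall n x, D x -> `|fn n x| <= g x) ->
  mu.-integrable D (EFin \o f) /\
  (\int[mu]_(x in D) fn n x)%R @[n --> \oo] --> (\int[mu]_(x in D) f x)%R.
Proof.
move=> mD mfn mf cvf ig le_g.
have mfn' n : measurable_fun D (EFin \o fn n) by exact/measurable_EFinP.
have mf' : measurable_fun D (EFin \o f) by exact/measurable_EFinP.
have cvf' : {ae mu, forall x, D x -> (fun n => (EFin \o fn n) x) @ \oo --> (EFin \o f) x}.
  apply: filterS cvf => x h /h hx.
  by apply: cvg_EFin => //; exact: nearW.
have leg' : {ae mu, forall x n, D x -> (`|(EFin \o fn n) x| <= (EFin \o g) x)%E}.
  by apply: aeW => x n Dx /=; rewrite lee_fin le_g.
have [intf _ cvi] := dominated_convergence mD mfn' mf' cvf' ig leg'.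
split => //; rewrite /Rintegral.
by apply: fine_cvg; rewrite fineK//; exact: integrable_fin_num.
Qed.

Section integrals_on_half_line.
Context {R : realType}.
Local Notation mu := (@lebesgue_measure R).
Local Notation D := (`]0%R, +oo[%classic : set R).
Implicit Types (f g F h : R -> R).

Lemma expR_cvgNy : expR (- x : R) @[x --> +oo] --> (0 : R).
Proof. exact: cvgr_expR. Qed.

Lemma expRM_cvg0 (a : R) : 0 < a -> expR (- (a * x)) @[x --> +oo] --> (0 : R).
Proof.
move=> a0; apply: (cvg_comp _ _ _ expR_cvgNy).
exact: gt0_cvgMry.
Qed.

Lemma is_derive_expRM (a x : R) :
  is_derive x 1 (fun x => expR (- (a * x))) (- a * expR (- (a * x))).
Proof. by apply: is_derive_eq; rewrite /GRing.scale /=; ring. Qed.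

Lemma integrable_expRM (a : R) : 0 < a ->
  mu.-integrable D (EFin \o (fun x => expR (- (a * x)))).
Proof.
move=> a0; apply: (@integrableS _ _ _ mu `[0%R, +oo[%classic) => //.
  by apply: subset_itvr; rewrite bnd_simp.
have cf : continuous (fun x : R => expR (- (a * x))).
  by move=> x; apply: differentiable_continuous; apply/derivable1_diffP; apply: ex_derive.
apply/integrableP; split.
  by apply/measurable_EFinP; apply: measurable_funTS; exact: continuous_measurable_fun.
under eq_integral do rewrite /= ger0_norm ?expR_ge0//.
rewrite (@ge0_continuous_FTC2y R _ (fun x => - a^-1 * expR (- (a * x))) 0 0)//.
- by rewrite ltry.
- exact: continuous_subspaceT.
- by rewrite -[X in _ --> X](mulr0 (- a^-1)); apply: cvgMl_tmp; exact: expRM_cvg0.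
- apply: cvg_at_right_filter; apply: cvgMl_tmp; exact: cf.
- move=> x _; rewrite derive1E.
  have h : is_derive x 1 (fun x0 : R => - a^-1 * expR (- (a * x0))) (expR (- (a * x))).
    apply: is_derive_eq; rewrite /GRing.scale /=; field; exact: lt0r_neq0.
  exact: (@derive_val _ _ _ _ _ _ _ h).
Qed.

(** As [f] may change sign, the integral is reached by dominated convergence from the truncations to
    ]0, n+1], on each of which the fundamental theorem of calculus applies. *)
Lemma integral_decay F f : (forall x : R, is_derive x (1 : R) F (f x)) -> continuous f ->
  mu.-integrable D (EFin \o f) -> F x @[x --> +oo] --> (0 : R) ->
  (\int[mu]_(x in D) f x)%R = - F 0.
Proof.
move=> dF cf intf F0.
have mf : measurable_fun setT f by exact: continuous_measurable_fun.
pose fn n : R -> R := f \_ `]0%R, n.+1%:R].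
have mfn n : measurable_fun D (fn n).
  by apply: measurable_funTS; apply/(measurable_restrictT _ _).1 => //; exact: measurable_funTS.
have h1 : (\int[mu]_(x in D) fn n x)%R @[n --> \oo] --> (\int[mu]_(x in D) f x)%R.
  apply: (@Rdominated_convergence _ _ _ mu D fn f (fun x => `|f x|) _ _ _ _ _ _).2 => //.
  - exact: measurable_funTS.
  - apply: aeW => x /=; rewrite in_itv/= andbT => x0.
    apply: cvg_near_cst; near=> n; rewrite /fn patchE mem_set//= in_itv/= x0/=.
    near: n; apply: filterS (nbhs_infty_ger x) => n; move/le_trans; apply.
    by rewrite ler_nat.
  - exact: integrable_norm.
  - move=> n x _; rewrite /fn patchE /=; case: ifP => //; by rewrite normr0 normr_ge0.
have h2 : (\int[mu]_(x in D) fn n x)%R @[n --> \oo] --> - F 0.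
  have -> : (fun n => (\int[mu]_(x in D) fn n x)%R) = (fun n => F n.+1%:R - F 0).
    apply/funext => n; rewrite /fn -Rintegral_mkcondr.
    have -> : D `&` `]0%R, n.+1%:R] = `]0%R, n.+1%:R]%classic :> set R.
      by rewrite setIC; apply/setIidPl; apply: subset_itvl; rewrite bnd_simp.
    rewrite Rintegral_itv_obnd_cbnd; last first.
      by apply: integrableS intf => //; apply: subset_itvl; rewrite bnd_simp.
    rewrite /Rintegral (@continuous_FTC2 R f F)//.
    - exact: continuous_subspaceT.
    - have cF : continuous F.
        move=> x; apply: differentiable_continuous; apply/derivable1_diffP.
        exact: (@ex_derive _ _ _ _ _ _ _ (dF x)).
      split.
      + by move=> x _; exact: (@ex_derive _ _ _ _ _ _ _ (dF x)).
      + by apply: cvg_at_right_filter; exact: cF.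
      + by apply: cvg_at_left_filter; exact: cF.
    - by move=> x _; rewrite derive1E; exact: (@derive_val _ _ _ _ _ _ _ (dF x)).
  rewrite -[X in _ --> X]add0r; apply: cvgB; last exact: cvg_cst.
  apply: (cvg_comp (fun n => n.+1%:R : R) F _ F0).
  by rewrite (cvg_shiftS (fun n => n%:R : R)); exact: cvgr_idn.
exact: (cvg_unique _ h1 h2).
Unshelve. all: by end_near. Qed.

Lemma integrable_exp_bounded f (K a : R) : 0 < a -> measurable_fun D f ->
  (forall x, 0 < x -> `|f x| <= K * expR (- (a * x))) ->
  mu.-integrable D (EFin \o f).
Proof.
move=> a0 mf fK.
have K0 : 0 <= K.
  by have := fK 1 ltr01; move/(le_trans (normr_ge0 _)); rewrite pmulr_lge0 ?expR_gt0.
apply: (@le_integrable _ _ _ mu D _ _ (fun x => K%:E * (EFin \o (fun x => expR (- (a * x)))) x)%E) => //.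
- exact/measurable_EFinP.
- move=> x /=; rewrite in_itv/= andbT => x0.
  by rewrite lee_fin (le_trans (fK _ x0))// ler_norm.
- by apply: integrableZl => //; exact: integrable_expRM.
Qed.

Lemma integrableZl_EFin d (T : measurableType d) (nu : {measure set T -> \bar R})
    (E : set T) (r : R) (f : T -> R) : measurable E ->
  nu.-integrable E (EFin \o f) -> nu.-integrable E (EFin \o (fun x => r * f x)).
Proof.
move=> mE intf.
rewrite (_ : EFin \o _ = (fun x => r%:E * (EFin \o f) x)%E)//.
exact: integrableZl.
Qed.

Lemma Rintegral_sum d (T : measurableType d) (nu : {measure set T -> \bar R})
    (E : set T) (s : seq nat) (f : nat -> T -> R) :
  measurable E -> (forall k, nu.-integrable E (EFin \o f k)) ->
  nu.-integrable E (EFin \o (fun x => \sum_(k <- s) f k x)) /\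
  (\int[nu]_(x in E) (\sum_(k <- s) f k x))%R = \sum_(k <- s) (\int[nu]_(x in E) f k x)%R.
Proof.
move=> mE intf; elim: s => [|k s [IH1 IH2]].
  split.
    have -> : EFin \o (fun x => \sum_(k <- [::]) f k x) = cst 0%E.
      by apply/funext => x /=; rewrite big_nil.
    exact: integrable0.
  rewrite big_nil; under eq_Rintegral do rewrite big_nil.
  by rewrite Rintegral_cst// mul0r.
have E1 : (fun x => \sum_(k <- k :: s) f k x) = (fun x => f k x + \sum_(k <- s) f k x).
  by apply/funext => x; rewrite big_cons.
split.
  have -> : EFin \o (fun x => \sum_(k <- k :: s) f k x) =
     (EFin \o f k) \+ (EFin \o (fun x => \sum_(k <- s) f k x)).
    by rewrite E1; apply/funext => x /=; rewrite EFinD.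
  exact: integrableD.
by rewrite E1 RintegralD// IH2 big_cons.
Qed.

Lemma expRMn_cvg0 (a : R) : 0 < a -> expR (- (a * n%:R)) @[n --> \oo] --> (0 : R).
Proof.
move=> a0.
apply: (cvg_comp (fun n => n%:R : R) (fun x => expR (- (a * x))) _ (expRM_cvg0 a0)).
exact: cvgr_idn.
Qed.

Lemma bernoulli_le (v : R) n : 0 <= v <= 1 -> 1 - n%:R * v <= (1 - v) ^+ n.
Proof.
move=> /andP[v0 v1]; elim: n => [|n IHn]; first by rewrite expr0 mul0r subr0.
rewrite exprS; have : (1 - v) * (1 - n%:R * v) <= (1 - v) * (1 - v) ^+ n.
  by rewrite ler_wpM2l// subr_ge0.
apply: le_trans; rewrite -natr1.
have h : 0 <= n%:R * v * v by rewrite !mulr_ge0.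
lra.
Qed.

(* [1 - e^{-nx}] raised to the power [e^{nb}] is a polynomial in [e^{-x}] that
   tends to the indicator of [x > b]. *)
Definition step (b : R) (n : nat) (x : R) : R :=
  (1 - expR (- (n%:R * x))) ^+ Num.truncn (expR (b * n%:R)).

Lemma expRMn_bound n (x : R) : 0 < x -> 0 <= expR (- (n%:R * x)) <= 1.
Proof.
by move=> x0; rewrite expR_ge0 -expR0 ler_expR oppr_le0 mulr_ge0// ltW.
Qed.

Lemma step_ge0 b n (x : R) : 0 < x -> 0 <= step b n x <= 1.
Proof.
move=> x0; have /andP[h1 h2] := expRMn_bound n x0.
by rewrite /step exprn_ge0 ?exprn_ile1// ?subr_ge0// lerBlDr lerDl.
Qed.

(** By Bernoulli's inequality the distance to 1 is at most the exponent times e^{-nx}, hence at most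
    e^{-n(x-b)}. *)
Lemma step_cvg1 b (x : R) : 0 < x -> b < x -> step b n x @[n --> \oo] --> (1 : R).
Proof.
move=> x0 bx.
have c0 : 0 < x - b by rewrite subr_gt0.
apply: (@squeeze_cvgr _ _ _ _ (fun n => 1 - expR (- ((x - b) * n%:R))) (cst 1)).
- apply: nearW => n; have /andP[_ ->] := step_ge0 b n x0; rewrite andbT.
  apply: le_trans (bernoulli_le _ (expRMn_bound n x0)).
  rewrite lerD2l lerN2.
  have -> : expR (- ((x - b) * n%:R)) = expR (b * n%:R) * expR (- (n%:R * x)).
    by rewrite -expRD; congr expR; ring.
  by rewrite ler_wpM2r ?expR_ge0// Num.Theory.truncn_le expR_ge0.
- rewrite -[X in _ --> X](subr0 1); apply: cvgB; first exact: cvg_cst.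
  exact: expRMn_cvg0.
- exact: cvg_cst.
Qed.

Lemma step_cvg0 b (x : R) : 0 < x -> x < b -> step b n x @[n --> \oo] --> (0 : R).
Proof.
move=> x0 bx.
have c0 : 0 < b - x by rewrite subr_gt0.
apply: (@squeeze_cvgr _ _ _ _ (cst 0) (fun n => expR 1 * expR (- ((b - x) * n%:R)))).
- apply: nearW => n; have /andP[-> _] /= := step_ge0 b n x0.
  rewrite /step; set v := expR (- (n%:R * x)); set A := Num.truncn _.
  have /andP[v0 v1] : 0 <= v <= 1 by exact: expRMn_bound.
  have h1 : (1 - v) ^+ A <= expR (- v) ^+ A.
    by rewrite lerXn2r// ?nnegrE ?subr_ge0 ?expR_ge0//; exact: expR_ge1Dx.
  apply: (le_trans h1); rewrite -expRM_natr.
  (* The exponent exceeds e^{bn} - 1 and [v <= 1], so [v] times the exponent is at least [y - 1].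
     The bound e^{1-y} is then compared with e / y, using y <= e^y. *)
  pose y := expR ((b - x) * n%:R).
  have yE : y = expR (b * n%:R) * v by rewrite /y /v -expRD; congr expR; ring.
  have h2 : - v * A%:R <= 1 - y.
    have : expR (b * n%:R) < A.+1%:R by apply: Num.Theory.truncnS_gt.
    rewrite -natr1 yE => h2; nra.
  apply: (@le_trans _ _ (expR (1 - y))); first by rewrite ler_expR.
  rewrite expRD ler_wpM2l ?expR_ge0//.
  rewrite !expRN lef_pV2 ?posrE ?expR_gt0//.
  by apply: le_trans (expR_ge1Dx y); rewrite -/y lerDr.
- exact: cvg_cst.
- rewrite -[X in _ --> X](mulr0 (expR 1)); apply: cvgMl_tmp.
  exact: expRMn_cvg0.
Qed.

Lemma measurable_expRM (a : R) (E : set R) : measurable E ->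
  measurable_fun E (fun x => expR (- (a * x))).
Proof.
move=> mE; apply: measurable_funTS; apply: continuous_measurable_fun => x.
by apply: differentiable_continuous; apply/derivable1_diffP; apply: ex_derive.
Qed.

Lemma integrable_Mbounded h f (K : R) : mu.-integrable D (EFin \o h) ->
  measurable_fun D f -> (forall x, 0 < x -> `|f x| <= K) ->
  mu.-integrable D (EFin \o (fun x => h x * f x)).
Proof.
move=> ih mf fK.
have mh : measurable_fun D h by apply/measurable_EFinP; exact: measurable_int ih.
apply: (@le_integrable _ _ _ mu D _ _ (fun x => K%:E * (EFin \o h) x)%E) => //.
- by apply/measurable_EFinP; exact: measurable_funM.
- move=> x /=; rewrite in_itv/= andbT => x0.
  rewrite lee_fin !normrM mulrC ler_wpM2r//.
  by rewrite (le_trans (fK _ x0))// ler_norm.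
- exact: integrableZl.
Qed.

Lemma integral_step h b n : mu.-integrable D (EFin \o h) ->
  (forall k : nat, (\int[mu]_(x in D) (h x * expR (- (k%:R * x))))%R = 0) ->
  (\int[mu]_(x in D) (h x * step b n x))%R = 0.
Proof.
move=> ih h0; rewrite /step; set A := Num.truncn _.
pose f k x := (-1) ^+ k *+ 'C(A, k) * (h x * expR (- ((n * k)%:R * x))).
have fE x : h x * (1 - expR (- (n%:R * x))) ^+ A = \sum_(k <- index_iota 0 A.+1) f k x.
  rewrite exprBn mulr_sumr big_mkord; apply: eq_bigr => k _.
  rewrite /f expr1n mulr1 natrM -expRM_natr -!mulrnAr -[in RHS]mulr_natl -[in LHS]mulr_natl.
  rewrite (_ : - (n%:R * x) * k%:R = - (n%:R * k%:R * x)); ring.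
have intk k : mu.-integrable D (EFin \o (fun x => h x * expR (- ((n * k)%:R * x)))).
  apply: (@integrable_Mbounded _ _ 1) => //; first exact: measurable_expRM.
  by move=> x x0; have /andP[? ?] := expRMn_bound (n * k) x0; rewrite ger0_norm.
under eq_Rintegral do rewrite fE.
have intf k : mu.-integrable D (EFin \o f k).
  exact: integrableZl_EFin.
rewrite (Rintegral_sum _ _ intf).2// big1// => k _.
by rewrite /f RintegralZl// h0 mulr0.
Qed.

(** In the limit of [integral_step] the integral of [h] over every half-line ]b, +oo[ vanishes.
    Hence so does the primitive of [h], and Lebesgue differentiation concludes. *)
Lemma lerch h : mu.-integrable D (EFin \o h) ->
  (forall k : nat, (\int[mu]_(x in D) (h x * expR (- (k%:R * x))))%R = 0) ->
  {ae mu, forall x, 0 < x -> h x = 0}.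
Proof.
move=> ih h0.
have mh : measurable_fun D h by apply/measurable_EFinP; exact: measurable_int ih.
pose I b : R -> R := \1_(`]b, +oo[%classic : set R).
have mI b : measurable_fun D (I b).
  by apply: measurable_funTS; exact: measurable_indic.
have hI b : (\int[mu]_(x in D) (h x * I b x))%R = 0.
  have [|||||_ c] := @Rdominated_convergence _ _ _ mu D (fun n x => h x * step b n x)
    (fun x => h x * I b x) (fun x => `|h x|) (measurable_itv _).
  - move=> n; apply: measurable_funM => //; apply: measurable_funX.
    by apply: measurable_funB => //; exact: measurable_expRM.
  - by apply: measurable_funM => //; exact: mI.
  (* The pointwise limit of the steps is identified off the single point [b]. *)
  - exists [set b]; split => //; first exact: lebesgue_measure_set1.
    move=> x /= /not_implyP[]; rewrite in_itv/= andbT => x0 nc.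
    apply: contrapT => /eqP; rewrite neq_lt => xb; apply: nc.
    apply: cvgMl_tmp; rewrite /I indicE /=.
    case/orP: xb => xb.
    + rewrite memNset/=; first exact: step_cvg0.
      by rewrite in_itv/= andbT; apply/negP; rewrite -leNgt ltW.
    + rewrite mem_set/=; first exact: step_cvg1.
      by rewrite in_itv/= andbT.
  - exact: integrable_norm.
  - move=> n x /=; rewrite in_itv/= andbT => x0; have /andP[s0 s1] := step_ge0 b n x0.
    by rewrite normrM (ger0_norm s0) ler_piMr.
  have : (fun n => (\int[mu]_(x in D) (h x * step b n x))%R) @ \oo --> (0 : R).
    by under eq_fun do rewrite integral_step//; exact: cvg_cst.
  by move=> c0; exact: (cvg_unique _ c c0).
pose g := h \_ D.
have ig : mu.-integrable setT (EFin \o g).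
  by rewrite /g -restrict_EFin; apply/(integrable_mkcond _ _).1.
have g0 x : (\int[mu]_(t in `]-oo, x]) g t)%R = 0.
  rewrite /g -Rintegral_mkcondl Rintegral_mkcondr.
  transitivity (\int[mu]_(y in D) (h y - h y * I x y))%R.
    apply: eq_Rintegral => y _; rewrite patchE /I indicE.
    case: (leP y x) => yx.
      rewrite mem_set/= ?in_itv//= memNset/= ?mulr0 ?subr0//.
      by rewrite in_itv/= andbT; apply/negP; rewrite -leNgt.
    rewrite memNset/= ?in_itv/=; last by apply/negP; rewrite -ltNge.
    by rewrite mem_set/= ?in_itv/= ?andbT// mulr1 subrr.
  rewrite RintegralB ?hI ?subr0//; last first.
    apply: (@integrable_Mbounded _ _ 1) => // y y0.
    by rewrite /I indicE normr_nat; case: (_ \in _).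
  (* The moment [k = 0] is the total integral, needed to pass from ]x, +oo[ to its complement. *)
  by have := h0 0%N; under eq_Rintegral do rewrite mul0r oppr0 expR0 mulr1.
have igy y : mu.-integrable `]-oo, y] (EFin \o g).
  by apply: integrableS ig.
have := FTC1Ny igy (integrable_locally (measurable_itv _) ih).
apply: filterS; first exact: (ae_filter_ringOfSetsType mu).
move=> x [_]; have -> : (fun y => (\int[mu]_(t in `]-oo, y]) g t)%R) = cst 0.
  by apply/funext => y; exact: g0.
rewrite derive1_cst => /esym; rewrite /g patchE => + x0.
by rewrite mem_set//= in_itv/= x0.
Qed.

End integrals_on_half_line.

Lemma cvg_exprn {R : realType} (T : Type) (F : set_system T) {FF : Filter F}
  (f : T -> R) (a : R) n : f @ F --> a -> (fun x => f x ^+ n) @ F --> a ^+ n.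
Proof.
move=> fa; elim: n => [|n IHn]; first exact: cvg_cst.
under eq_fun do rewrite exprS; rewrite exprS; exact: cvgM.
Qed.

(** * Invariance under the Cesaro operator and under the Euler means *)

Section hausdorff_moments.
Context {R : realType}.
Local Notation C := R[i].
Local Notation mu := (@lebesgue_measure R).
Local Notation D := (`]0%R, +oo[%classic : set R).
Implicit Types (a b : nat -> C).

Local Notation E t := (expR (- t : R)).

Lemma expRN01 (t : R) : 0 <= t -> 0 < E t <= 1.
Proof. by move=> t0; rewrite expR_gt0 -expR0 ler_expR oppr_le0. Qed.

(** Written as a difference between the degrees n and n - 1, so that the sum over degrees
    telescopes. At [n = 0] the default index [n.-1 = 0] comes with the factor 0. *)
Lemma is_derive_bw (n k : nat) (t : R) :
  is_derive t (1 : R) (fun t => E t * bw n k (E t))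
    (- (E t * (n.+1%:R * bw n k (E t) - n%:R * bw n.-1 k (E t)))).
Proof.
have [nk|kn] := ltnP n k.
  rewrite !(@bw_small _ _ k)//; last by case: (n) nk => //= m; exact: ltnW.
  rewrite !mulr0 subr0 mulr0 oppr0.
  under eq_fun do rewrite bw_small// mulr0.
  exact: is_derive_cst.
have -> : (fun t : R => E t * bw n k (E t)) =
    (fun t => 'C(n, k)%:R * (E (k.+1%:R * t) * (1 - E t) ^+ (n - k))).
  apply/funext => s; rewrite /bw.
  have -> : E (k.+1%:R * s) = E s * E s ^+ k.
    by rewrite -exprS -expRM_natl; congr expR; ring.
  ring.
have d1 : is_derive t (1 : R) (fun t : R => 1 - E t) (E t).
  by apply: is_derive_eq; rewrite /GRing.scale /=; ring.
have d2 : is_derive t (1 : R) (fun t : R => (1 - E t) ^+ (n - k))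
    ((n - k)%:R * (1 - E t) ^+ (n - k).-1 * E t).
  have := is_deriveX (n - k) d1; rewrite exprfctE; exact.
have d3 := is_derive_expRM k.+1%:R t.
have d4 := is_deriveM d3 d2.
have d5 := is_deriveZ ('C(n, k)%:R : R) d4.
apply: (is_derive_eq d5).
rewrite /GRing.scale /= {d1 d2 d3 d4 d5}.
have -> : E (k.+1%:R * t) = E t * E t ^+ k.
  by rewrite -exprS -expRM_natl; congr expR; ring.
move: kn => /subnKC <-; rewrite addKn; case: (n - k)%N => [|m].
  rewrite addn0 /bw subnn expr0 binn.
  have -> : k%:R * ('C(k.-1, k)%:R * E t ^+ k * (1 - E t) ^+ (k.-1 - k)) = 0.
    by case: k => [|k]; rewrite ?mul0r// bin_small// !mul0r mulr0.
  ring.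
rewrite addnS /= /bw subSn ?leq_addr// addKn.
have -> : (k + m).+1%:R * ('C(k + m, k)%:R * E t ^+ k * (1 - E t) ^+ m) =
    (m.+1%:R * 'C((k + m).+1, k)%:R) * (E t ^+ k * (1 - E t) ^+ m) :> R.
  rewrite -mulrA mulrA -!natrM; congr (_%:R * _).
  by rewrite -[X in 'C(X, k)]/((k + m).+1.-1) mul_bin_down subSn ?leq_addr// addKn.
rewrite exprS -[(k + m).+2]addn1 -[(k + m).+1]addn1 !natrD; ring.
Qed.

Lemma is_derive_sum_bw (n k : nat) (t : R) :
  is_derive t (1 : R) (fun t => \sum_(0 <= i < n.+1) E t * bw i k (E t))
    (- (E t * (n.+1%:R * bw n k (E t)))).
Proof.
elim: n => [|n IHn].
  under eq_fun do rewrite big_nat1.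
  by apply: (is_derive_eq (is_derive_bw 0 k t)); rewrite mul0r subr0.
under eq_fun do rewrite big_nat_recr//=.
apply: (is_derive_eq (is_deriveD IHn (is_derive_bw n.+1 k t))).
by rewrite /=; ring.
Qed.

Lemma bw_le1 n k u : 0 <= u <= 1 -> bw n k u <= 1 :> R.
Proof.
move=> u01; have [kn|nk] := leqP k n; last by rewrite bw_small.
rewrite -(bw_sum1 n u) big_mkord (bigD1 (Ordinal (kn : (k < n.+1)%N)))//= lerDl.
by apply: sumr_ge0 => i _; exact: bw_ge0.
Qed.

Lemma continuous_expRM (a : R) : continuous (fun x : R => E (a * x)).
Proof.
by move=> x; apply: differentiable_continuous; apply/derivable1_diffP; apply: ex_derive.
Qed.

Lemma continuous_bw n k : continuous (fun t : R => bw n k (E t)).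
Proof.
move=> t; rewrite /bw.
have cE : {for t, continuous (fun t : R => E t)}.
  by apply: differentiable_continuous; apply/derivable1_diffP; apply: ex_derive.
apply: cvgM; last by apply: cvg_exprn; apply: cvgB; [exact: cvg_cst|exact: cE].
by apply: cvgMl_tmp; apply: cvg_exprn; exact: cE.
Qed.

Lemma continuous_mom_fun j n k : continuous (fun t : R => E (j%:R * t) * bw n k (E t)).
Proof.
by move=> t; apply: cvgM; [exact: continuous_expRM|exact: continuous_bw].
Qed.

(** With u = e^{-t} this is the integral over [0, 1] of u^j times the Bernstein polynomial, a Beta
    integral: the entries of a Hausdorff matrix. *)
Definition mom (j n k : nat) : R :=
  (\int[mu]_(t in D) (E (j.+1%:R * t) * bw n k (E t)))%R.

Lemma mom_fun_bound j n k t : 0 < t ->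
  `|E (j.+1%:R * t) * bw n k (E t)| <= E t.
Proof.
move=> t0; have /andP[e0 e1] := expRN01 (ltW t0).
have e01 : 0 <= E t <= 1 by rewrite e1 ltW.
have b0 := bw_ge0 n k e01.
rewrite ger0_norm; last exact: mulr_ge0 (expR_ge0 _) b0.
rewrite -[leRHS]mulr1; apply: ler_pM => //; last exact: bw_le1.
by rewrite ler_expR lerN2 ler_peMl ?ler1n// ltW.
Qed.

Lemma integrable_mom j n k :
  mu.-integrable D (EFin \o (fun t => E (j.+1%:R * t) * bw n k (E t))).
Proof.
apply: (@integrable_exp_bounded _ _ 1 1) => //.
  by apply: measurable_funTS; apply: continuous_measurable_fun; exact: continuous_mom_fun.
by move=> t t0; rewrite !mul1r; exact: mom_fun_bound.
Qed.

Lemma mom_small j n k : (n < k)%N -> mom j n k = 0.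
Proof.
move=> nk; rewrite /mom; under eq_Rintegral do rewrite bw_small// mulr0.
by rewrite Rintegral_cst// mul0r.
Qed.

(** Column [k] of the identity (1 + j C) H = C, for H the matrix [mom j]. It says that the
    derivative of e^{-jt} times the telescoping sum of [is_derive_sum_bw] integrates to minus the
    value at 0. *)
Lemma mom_rec j n k : (k <= n)%N ->
  n.+1%:R * mom j n k + j%:R * \sum_(0 <= i < n.+1) mom j i k = 1.
Proof.
move=> kn.
pose g i t := E (j.+1%:R * t) * bw i k (E t).
pose F t := E (j%:R * t) * \sum_(0 <= i < n.+1) E t * bw i k (E t).
pose f t := - (n.+1%:R * g n t) - j%:R * \sum_(0 <= i < n.+1) g i t.
have FE t : F t = \sum_(0 <= i < n.+1) g i t.
  rewrite /F mulr_sumr; apply: eq_bigr => i _; rewrite mulrA -expRD.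
  by rewrite /g -natr1; congr (expR _ * _); ring.
have dF t : is_derive t (1 : R) F (f t).
  apply: (is_derive_eq (is_deriveM (is_derive_expRM j%:R t) (is_derive_sum_bw n k t))).
  rewrite /GRing.scale /= [X in _ + X](_ : _ = - j%:R * F t); last by rewrite /F; ring.
  rewrite FE /f mulNr; congr (_ + _).
  have -> : g n t = E (j%:R * t) * E t * bw n k (E t).
    by rewrite /g -expRD -natr1; congr (expR _ * _); ring.
  by ring.
have ig := integrable_mom j ^~ k.
have [isum sumE] := @Rintegral_sum R _ _ mu D (index_iota 0 n.+1) g (measurable_itv _) ig.
have icf : mu.-integrable D (EFin \o (fun t => - n.+1%:R * g n t)).
  by apply: (@integrableZl_EFin R _ _ mu D) => //; exact: ig.
have ics : mu.-integrable D (EFin \o (fun t => - j%:R * \sum_(0 <= i < n.+1) g i t)).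
  exact: (@integrableZl_EFin R _ _ mu D).
have fE : f = (fun t => - n.+1%:R * g n t + - j%:R * \sum_(0 <= i < n.+1) g i t).
  by apply/funext => t; rewrite /f !mulNr.
have cf : continuous f.
  have cg i : continuous (g i) by exact: continuous_mom_fun.
  have csum m : continuous (fun t => \sum_(0 <= i < m) g i t).
    elim: m => [|m IHm] t.
      by under eq_fun do rewrite big_geq//; exact: cvg_cst.
    by under eq_fun do rewrite big_nat_recr//=; apply: cvgD; [exact: IHm|exact: cg].
  by rewrite fE => t; apply: cvgD; apply: cvgMl_tmp; [exact: cg|exact: csum].
have intf : mu.-integrable D (EFin \o f).
  rewrite fE (_ : EFin \o _ = (EFin \o (fun t => - n.+1%:R * g n t)) \+
    (EFin \o (fun t => - j%:R * \sum_(0 <= i < n.+1) g i t)))//.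
  exact: integrableD.
have F0 : F x @[x --> +oo] --> (0 : R).
  apply: (@squeeze_cvgr _ _ _ _ (fun t => - (n.+1%:R * E (1 * t))) (fun t => n.+1%:R * E (1 * t))).
  - near=> t; have t0 : 0 < t by near: t; exact: nbhs_pinfty_gt.
    rewrite -ler_norml FE (le_trans (ler_norm_sum _ _ _))// mul1r.
    apply: (@le_trans _ _ (\sum_(0 <= i < n.+1) E t)).
      by apply: ler_sum => i _; exact: mom_fun_bound.
    by rewrite big_const_nat iter_addr_0 subn0 mulr_natl.
  - rewrite -[X in _ --> X]oppr0 -[X in _ --> - X](mulr0 n.+1%:R); apply: cvgN.
    by apply: cvgMl_tmp; exact: expRM_cvg0.
  - rewrite -[X in _ --> X](mulr0 n.+1%:R).
    by apply: cvgMl_tmp; exact: expRM_cvg0.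
have := integral_decay dF cf intf F0.
(* At u = 1 the weight [bw i k] is 1 for [i = k] and 0 otherwise, and the index [k] occurs since
   [k <= n]. *)
have -> : F 0 = 1.
  rewrite FE /g oppr0 mulr0 oppr0 expR0 big_mkord.
  rewrite (bigD1 (Ordinal (kn : (k < n.+1)%N)))//= big1 ?addr0.
    by rewrite /bw binn subnn expr1n expr0 !mul1r.
  move=> i ik; rewrite mul1r /bw subrr.
  have [ki|] := ltnP k i; first by rewrite -(subnSK ki) expr0n mulr0.
  rewrite leq_eqVlt => /orP[/eqP ik'|ik']; last by rewrite bin_small// !mul0r.
  by case/eqP: ik; exact: val_inj.
have e1 := @RintegralZl _ _ _ mu D (g n) (- n.+1%:R) (measurable_itv _) (ig n).
have e2 := @RintegralZl _ _ _ mu D _ (- j%:R) (measurable_itv _) isum.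
have e3 := @RintegralD _ _ _ mu D _ _ (measurable_itv _) icf ics.
rewrite fE e3 e1 e2 sumE => h.
by rewrite -[RHS]opprK -h !mulNr opprD !opprK.
Unshelve. all: by end_near. Qed.

End hausdorff_moments.

Section hausdorff_means.
Context {R : realType}.
Local Notation C := R[i].
Local Notation mu := (@lebesgue_measure R).
Local Notation D := (`]0%R, +oo[%classic : set R).
Implicit Types (a b : nat -> C) (V : set (nat -> C)).
Local Notation E t := (expR (- t : R)).

(* [hmean j] is both the integral over [t > 0] of [e^{-(j+1)t} eul (e^{-t})]
   and [ces] composed with the resolvent [(1 + j ces)^-1]. *)
Definition hmean (j : nat) a (n : nat) : C :=
  \sum_(0 <= k < n.+1) (mom j n k : R)%:C * a k.

Lemma hmean_rec j a : hmean j a + scl j%:R%:C (ces (hmean j a)) = ces a.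
Proof.
apply/funext => n; rewrite !fctE /scl.
have n0 : (n.+1%:R%:C : C) != 0 by rewrite -natC pnatr_eq0.
apply: (mulfI n0); rewrite mulrDr mulrCA -!ces_eq.
have -> : \sum_(0 <= i < n.+1) hmean j a i =
    \sum_(0 <= k < n.+1) (\sum_(0 <= i < n.+1) mom j i k)%:C * a k.
  under eq_big_nat => i /andP[_ ni].
    rewrite /hmean (@sum_bw _ _ (fun i k => (mom j i k)%:C * a k) n.+1)//; last first.
      by move=> k ik; rewrite mom_small// mul0r.
    over.
  rewrite exchange_big/=; apply: eq_bigr => k _.
  by rewrite rmorph_sum/= mulr_suml.
rewrite /hmean !mulr_sumr -big_split/=; apply: eq_big_nat => k /andP[_ kn].
rewrite !mulrA -mulrDl -[RHS]mul1r; congr (_ * _).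
by rewrite -!rmorphM -rmorphD/= mom_rec.
Qed.

(** The resolvent identity expresses [ces a] as 1 + j C applied to [hmean j a], so accretivity
    bounds the partial sums of the latter by those of the former. *)
Lemma ell2_hmean j a : ell2 a -> ell2 (hmean j a).
Proof.
move=> /ell2_ces[K hK]; exists K => n; apply: le_trans (hK n).
by rewrite -(hmean_rec j); exact: ces_accretive_bound.
Qed.

Lemma hmean0 a : hmean 0 a = ces a.
Proof.
by rewrite -[RHS](hmean_rec 0) rmorph0 scl0 addr0.
Qed.

Lemma continuous_sum_nat m (f : nat -> R -> R) : (forall i, continuous (f i)) ->
  continuous (fun t => \sum_(0 <= i < m) f i t).
Proof.
move=> cf; elim: m => [|m IHm] t.
  by under eq_fun do rewrite big_geq//; exact: cvg_cst.
by under eq_fun do rewrite big_nat_recr//=; apply: cvgD; [exact: IHm|exact: cf].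
Qed.

Lemma three_quarters_le (x : R) : 0 < x -> x / 4 + x / 4 + x / 4 <= x.
Proof. lra. Qed.

Section pairing.
Variables (a b : nat -> C).
Hypotheses (ha : ell2 a) (hb : ell2 b).

Let q t := sdot (eul (E t) a) b.
Let s t N := psum (eul (E t) a) b N.
Let A := sdot a a.
Let B := sdot b b.

Let eul_ell2 t : 0 <= t -> ell2 (eul (E t) a).
Proof. by move=> t0; apply: ell2_eul => //; exact: expRN01. Qed.

Let eul_sdot t : 0 <= t -> sdot (eul (E t) a) (eul (E t) a) <= expR t * A.
Proof.
by move=> t0; have := sdot_eul (expRN01 t0) ha; rewrite expRN mulrC ler_pdivrMr ?expR_gt0// mulrC.
Qed.

(** Cauchy-Schwarz against the tail of [b]. The last factor is independent of [t], so the partial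
    pairings converge uniformly on bounded intervals, which is what [sdot_eul_eq0] exploits. *)
Lemma eul_tail N t : 0 <= t ->
  (q t - s t N) ^+ 2 <= expR t * A * (B - psum b b N).
Proof.
move=> t0; have he := eul_ell2 t0.
pose b' n := if (n < N)%N then 0 else b n.
have psb c n : (N <= n)%N -> psum b' c n = psum b c n - psum b c N.
  move=> /subnK <-; elim: (n - N)%N => [|m IHm].
    rewrite add0n subrr /psum /series /= big_nat big1// => i /andP[_ iN].
    by rewrite /b' iN rdot0.
  rewrite addSn !psumS IHm /b' ltnNge leq_addl/=; ring.
have psbb n : (N <= n)%N -> psum b' b' n = psum b b n - psum b b N.
  move=> Nn; rewrite psb// (psumC b b') psb//.
  by rewrite psb// subrr subr0.
have cq : (fun n => (psum (eul (E t) a) b n - s t N) ^+ 2) @ \oo --> (q t - s t N) ^+ 2.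
  by apply: cvg_exprn; apply: cvgB; [exact: cvg_psum|exact: cvg_cst].
apply: (cvgr_to_le cq); near=> n.
have Nn : (N <= n)%N by near: n; exact: nbhs_infty_ge.
have -> : psum (eul (E t) a) b n - s t N = psum b' (eul (E t) a) n.
  by rewrite psb// /s !(psumC _ b).
apply: (le_trans (psum_CS _ _ _)); rewrite mulrC.
apply: ler_pM; rewrite ?psum_ge0//.
  exact: le_trans (psum_le_sdot n he) (eul_sdot t0).
by rewrite psbb// lerB// psum_le_sdot.
Unshelve. all: by end_near. Qed.

Let K := Num.sqrt (A * B).

Lemma sqr_le_exp_half (x t : R) : x ^+ 2 <= expR t * A * B -> `|x| <= K * E (- (2^-1 * t)).
Proof.
move=> h; have AB0 : 0 <= A * B by rewrite mulr_ge0// sdot_ge0.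
have r0 : 0 <= K * E (- (2^-1 * t)) by rewrite mulr_ge0 ?sqrtr_ge0 ?expR_ge0.
rewrite -(@ler_pXn2r _ 2) ?nnegrE// real_normK ?num_real// exprMn sqr_sqrtr//.
rewrite opprK -expRM_natl (_ : 2%:R * (2^-1 * t) = t); last by field.
by rewrite mulrC mulrA.
Qed.

Lemma psum_eul_bound N t : 0 <= t -> `|s t N| <= K * E (- (2^-1 * t)).
Proof.
move=> t0; apply: sqr_le_exp_half; apply: (le_trans (psum_CS _ _ _)).
apply: ler_pM; rewrite ?psum_ge0//; last exact: psum_le_sdot.
exact: le_trans (psum_le_sdot N (eul_ell2 t0)) (eul_sdot t0).
Qed.

Lemma cvg_psum_eul t : 0 <= t -> s t N @[N --> \oo] --> q t.
Proof. by move=> t0; apply: cvg_psum => //; exact: eul_ell2. Qed.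

Lemma psum_eulE N t : s t N =
  \sum_(0 <= n < N) \sum_(0 <= k < n.+1) rdot (a k) (b n) * bw n k (E t).
Proof.
rewrite /s /psum /series /=; apply: eq_bigr => n _.
by rewrite /eul rdot_sumr; apply: eq_bigr => k _; rewrite rdotZl mulrC.
Qed.

Lemma continuous_psum_eul N : continuous (fun t => s t N).
Proof.
have -> : s ^~ N = (fun t =>
    \sum_(0 <= n < N) \sum_(0 <= k < n.+1) rdot (a k) (b n) * bw n k (E t)).
  by apply/funext => t; exact: psum_eulE.
apply: continuous_sum_nat => n; apply: continuous_sum_nat => k t.
by apply: cvgMl_tmp; exact: continuous_bw.
Qed.

Lemma integral_psum_eul j N :
  (\int[mu]_(t in D) (E (j.+1%:R * t) * s t N))%R = psum (hmean j a) b N.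
Proof.
under eq_Rintegral do rewrite psum_eulE mulr_sumr.
have intk n k : mu.-integrable D (EFin \o (fun t => E (j.+1%:R * t) * (rdot (a k) (b n) * bw n k (E t)))).
  rewrite (_ : EFin \o _ = EFin \o (fun t => rdot (a k) (b n) * (E (j.+1%:R * t) * bw n k (E t)))).
    by apply: (@integrableZl_EFin R _ _ mu D) => //; exact: integrable_mom.
  by apply/funext => t /=; rewrite mulrCA.
have intn n := @Rintegral_sum R _ _ mu D (index_iota 0 n.+1) _ (measurable_itv _) (intk n).
have intn' n : mu.-integrable D (EFin \o (fun t => E (j.+1%:R * t) * \sum_(0 <= k < n.+1) rdot (a k) (b n) * bw n k (E t))).
  apply: eq_integrable (intn n).1 => // t _ /=.
  by rewrite mulr_sumr.
rewrite (@Rintegral_sum R _ _ mu D (index_iota 0 N) _ (measurable_itv _) intn').2.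
rewrite /psum /series /=; apply: eq_bigr => n _.
under eq_Rintegral do rewrite mulr_sumr.
rewrite (intn n).2 /hmean rdot_sumr; apply: eq_bigr => k _.
rewrite rdotZl mulrC -(@RintegralZl _ _ _ mu D _ _ (measurable_itv _) (integrable_mom j n k)).
by apply: eq_Rintegral => t _; rewrite mulrCA.
Qed.

Lemma integral_sdot_eul j :
  mu.-integrable D (EFin \o (fun t => E (j.+1%:R * t) * q t)) /\
  (\int[mu]_(t in D) (E (j.+1%:R * t) * q t))%R = sdot (hmean j a) b.
Proof.
have mE : measurable_fun D (fun t => E (j.+1%:R * t)) by exact: measurable_expRM.
have ms N : measurable_fun D (fun t => s t N).
  by apply: measurable_funTS; apply: continuous_measurable_fun; exact: continuous_psum_eul.
have mf N : measurable_fun D (fun t => E (j.+1%:R * t) * s t N) by exact: measurable_funM.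
have cvD t : D t -> E (j.+1%:R * t) * s t N @[N --> \oo] --> E (j.+1%:R * t) * q t.
  by rewrite /= in_itv/= andbT => /ltW t0; apply: cvgMl_tmp; exact: cvg_psum_eul.
(* The Euler mean grows at most like e^{t/2} and the kernel is at most e^{-t}, whence a majorant
   with rate 1/2 for every [j] and [N]. *)
have ig : mu.-integrable D (EFin \o (fun t => K * E (2^-1 * t))).
  by apply: (@integrableZl_EFin R _ _ mu D) => //; apply: integrable_expRM.
have mq : measurable_fun D (fun t => E (j.+1%:R * t) * q t).
  exact: (measurable_fun_cvg mf cvD).
have le_g N t : D t -> `|E (j.+1%:R * t) * s t N| <= K * E (2^-1 * t).
  rewrite /= in_itv/= andbT => t0.
  rewrite normrM ger0_norm ?expR_ge0//.
  apply: (@le_trans _ _ (E t * (K * E (- (2^-1 * t))))).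
    apply: ler_pM; rewrite ?expR_ge0//; last exact/psum_eul_bound/ltW.
    by rewrite ler_expR lerN2 ler_peMl ?ler1n// ltW.
  rewrite mulrCA -expRD; apply: ler_wpM2l; first exact: sqrtr_ge0.
  by rewrite ler_expR; lra.
have [i1 i2] := @Rdominated_convergence _ _ _ mu D
  (fun N t => E (j.+1%:R * t) * s t N) _ _ (measurable_itv _) mf mq (aeW mu cvD) ig le_g.
split => //.
have i3 := cvg_psum (ell2_hmean j ha) hb.
move: i2; under eq_fun do rewrite integral_psum_eul.
by move=> i2; exact: (cvg_unique _ i2 i3).
Qed.

(** The Lerch theorem concludes only almost everywhere. The pairing is a locally uniform limit of
    continuous functions and a null set contains no interval, so zeros arbitrarily close to [t]
    force a zero at [t]. *)
Lemma sdot_eul_eq0 : {ae mu, forall t, 0 < t -> q t = 0} ->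
  forall t, 0 <= t -> q t = 0.
Proof.
move=> q0 t t0; apply: contrapT => /eqP qn0.
have eps0 : 0 < `|q t| by rewrite normr_gt0.
pose eps := `|q t| / 4.
have e0 : 0 < eps by rewrite divr_gt0.
have cB : (fun N => expR (t + 1) * A * (B - psum b b N)) @ \oo --> (0 : R).
  rewrite -[X in _ --> X](mulr0 (expR (t + 1) * A)); apply: cvgMl_tmp.
  rewrite -[X in _ --> X](subrr B); apply: cvgB; first exact: cvg_cst.
  exact: cvg_psum_sq.
have [N _ /(_ N (leqnn N)) hN] : \forall N \near \oo, expR (t + 1) * A * (B - psum b b N) < eps ^+ 2.
  by move/cvgr_lt : cB; apply; rewrite exprn_gt0.
have tail x : 0 <= x -> x <= t + 1 -> `|q x - s x N| < eps.
  move=> x0 xt; rewrite -(@ltr_pXn2r _ 2) ?nnegrE ?(ltW e0)// real_normK ?num_real//.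
  apply: le_lt_trans hN; apply: (le_trans (eul_tail N x0)).
  apply: ler_wpM2r; first by rewrite subr_ge0 psum_le_sdot.
  by apply: ler_wpM2r; [exact: sdot_ge0|rewrite ler_expR].
have /cvgrPdist_lt/(_ _ e0) /nbhs_ballP[d /= d0 hd] := @continuous_psum_eul N t.
pose d' := Num.min d 1.
have d'0 : 0 < d' by rewrite lt_min d0/=.
(* The zero is sought to the right of [t], which keeps it positive even for [t = 0]. *)
have [x [tx xd qx]] : exists x, [/\ t < x, x < t + d' & q x = 0].
  case: q0 => Z [mZ Z0 sZ].
  apply: contrapT => hx.
  have sub : `]t, t + d'[%classic `<=` Z.
    move=> x /=; rewrite in_itv/= => /andP[tx xd]; apply: sZ => /= h.
    by apply: hx; exists x; split => //; apply: h; exact: le_lt_trans tx.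
  have : (mu (`]t, (t + d')%R[%classic : set R) <= mu Z)%E.
    by apply: le_measure; rewrite ?inE.
  rewrite Z0 lebesgue_measure_itv/= lte_fin ltrDl d'0 -EFinB lee_fin.
  by rewrite addrAC subrr add0r leNgt d'0.
have d'1 : d' <= 1 by rewrite ge_min lexx orbT.
have d'd : d' <= d by rewrite ge_min lexx.
have h1 := tail t t0 _; have h2 := tail x _ _.
have h3 : `|s t N - s x N| < eps.
  apply: hd; rewrite /ball/= distrC gtr0_norm ?subr_gt0// ltrBlDl.
  by rewrite (lt_le_trans xd)// lerD2l.
have : `|q t| < eps + eps + eps.
  have -> : q t = (q t - s t N) + (s t N - s x N) + (s x N - q x) by rewrite qx; ring.
  apply: (le_lt_trans (ler_normD _ _)); apply: ltrD.
    apply: (le_lt_trans (ler_normD _ _)); apply: ltrD => //; apply: h1; rewrite lerDl; exact: ler01.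
  rewrite distrC; apply: h2; first exact: le_trans (ltW tx).
  by rewrite (le_trans (ltW xd))// lerD2l.
by apply/negP; rewrite -leNgt three_quarters_le.
Qed.

End pairing.
Lemma orthogonal_orthogonal V h : hilbert_subspace V -> ell2 h ->
  (forall b, ell2 b -> (forall v, V v -> sdot v b = 0) -> sdot h b = 0) -> V h.
Proof.
move=> hV hh hb; have [m Vm mP] := hilbert_projection hV hh.
have hm := hilbert_sub hV Vm; have hhm := ell2B hh hm.
have h0 : sdot h (h - m) = 0.
  by apply: hb => // v Vv; rewrite sdotC mP.
have : sdot (h - m) (h - m) = 0 by rewrite {1}sdotBl// h0 sdotC mP// subr0.
by move/(sdot0_eq0 hhm)/subr0_eq ->.
Qed.

(** The residual [n] of the projection of [hmean j a] is orthogonal to [V], while [n + j C n] lies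
    in [V] because the part [m] in [V] can be subtracted from the resolvent identity. Accretivity
    then forces [n = 0]. *)
Lemma hmean_stable V j a : hilbert_subspace V -> (forall v, V v -> V (ces v)) ->
  V a -> V (hmean j a).
Proof.
move=> hV hC Va; have ha := hilbert_sub hV Va.
have hy := ell2_hmean j ha.
have [m Vm mP] := hilbert_projection hV hy.
have hm := hilbert_sub hV Vm.
set y := hmean j a in hy mP *; pose n := y - m.
have hn : ell2 n by exact: ell2B.
have Vn : V (n + scl j%:R%:C (ces n)).
  have -> : n + scl j%:R%:C (ces n) = ces a - (m + scl j%:R%:C (ces m)).
    rewrite -(hmean_rec j a) -/y.
    have -> : ces y = ces n + ces m by rewrite -cesD /n subrK.
    have -> : y = n + m by rewrite /n subrK.
    by apply/funext => k; rewrite /scl !fctE; ring.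
  rewrite -sclN1; apply: (hilbertD hV); first exact: hC.
  apply: (hilbertZ hV); apply: (hilbertD hV) => //.
  by apply: (hilbertZ hV); exact: hC.
have := mP _ Vn; rewrite -/n sdotDr//; last exact/ell2Z/ell2_ces.
rewrite sdotZr//; last exact: ell2_ces.
have h1 := sdot_ge0 hn; have h2 := sdot_ces_ge0 hn => h3.
have h4 : 0 <= j%:R * sdot n (ces n) by rewrite mulr_ge0.
have /(sdot0_eq0 hn)/subr0_eq -> // : sdot n n = 0 by lra.
Qed.

Theorem cesaro_euler_invariant V : hilbert_subspace V ->
  (forall a, V a -> V (ces a)) <->
  (forall (t : R) a, 0 <= t -> V a -> V (eul (E t) a)).
Proof.
move=> hV; split=> [hC t a t0 Va|hE a Va].
  have ha := hilbert_sub hV Va.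
  apply: (orthogonal_orthogonal hV) => [|b hb bV].
    by apply: ell2_eul => //; exact: expRN01.
  apply: sdot_eul_eq0 => //.
  have [ih _] := integral_sdot_eul ha hb 0.
  (* The factor e^{-x} makes the pairing integrable and shifts the nodes by one: its moment [k] is
     the pairing of [hmean k a] with [b]. *)
  have : {ae mu, forall x, 0 < x -> E (1%:R * x) * sdot (eul (E x) a) b = 0}.
    apply: lerch => // k; rewrite -[RHS](bV _ (hmean_stable k hV hC Va)).
    rewrite -(integral_sdot_eul ha hb k).2; apply: eq_Rintegral => x _.
    by rewrite mulrAC -expRD -natr1; congr (expR _ * _); ring.
  apply: filterS; first exact: (ae_filter_ringOfSetsType mu).
  by move=> x h /h /eqP; rewrite mulf_eq0 gt_eqF ?expR_gt0//= => /eqP.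
have ha := hilbert_sub hV Va.
apply: (orthogonal_orthogonal hV) => [|b hb bV]; first exact: ell2_ces.
rewrite -hmean0 -(integral_sdot_eul ha hb 0).2.
rewrite (@eq_Rintegral _ _ _ mu D (fun=> 0)); last first.
  move=> x; rewrite inE/= in_itv/= andbT => /ltW x0.
  by rewrite bV ?mulr0//; exact: hE.
by rewrite Rintegral_cst// mul0r.
Qed.

End hausdorff_means.

(** * Sequences and functions on the disc *)

Section complex_sequences.
Context {R : realType}.
Local Notation C := R[i].
Implicit Types (z w : C) (a b : nat -> C).

Lemma normC_normc z : `|z| = (normc z)%:C.
Proof. by []. Qed.

Lemma lt1_normc z : (`|z| < 1) = (normc z < 1).
Proof. by rewrite normC_normc -[X in _ < X]/(1%:C) ltcR. Qed.

Lemma normc_ge0 z : 0 <= normc z.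
Proof. by case: z => ? ?; exact: sqrtr_ge0. Qed.

Lemma rdot_lt1 z : `|z| < 1 -> rdot z z < 1.
Proof. by rewrite lt1_normc rdot_normc => z1; rewrite exprn_ilt1 ?normc_ge0. Qed.

Lemma normc_re z : `|Re z| <= normc z.
Proof.
rewrite -(@ler_pXn2r _ 2) ?nnegrE ?normc_ge0// real_normK ?num_real//.
by rewrite -rdot_normc rdot_re_sq.
Qed.

Lemma normc_im z : `|Im z| <= normc z.
Proof.
rewrite -(@ler_pXn2r _ 2) ?nnegrE ?normc_ge0// real_normK ?num_real//.
by rewrite -rdot_normc rdot_im_sq.
Qed.

Lemma normc_le z : normc z <= `|Re z| + `|Im z|.
Proof.
rewrite -(@ler_pXn2r _ 2) ?nnegrE ?normc_ge0 ?addr_ge0//.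
rewrite -rdot_normc /rdot -!expr2 -(real_normK (num_real (Re z))) -(real_normK (num_real (Im z))).
by rewrite sqrrD addrAC lerDl mulrn_wge0// mulr_ge0.
Qed.

Lemma cvgC (u : nat -> C) (l : C) :
  ((u : nat -> C^o) @ \oo --> (l : C^o)) <->
  ((fun n => Re (u n)) @ \oo --> Re l /\ (fun n => Im (u n)) @ \oo --> Im l).
Proof.
split.
  move=> /cvgrPdist_lt h.
  have h' (e : R) : 0 < e -> \forall n \near \oo, normc (l - u n) < e.
    by move=> e0; have := h e%:C; rewrite ltcR => /(_ e0); apply: filterS => n; rewrite normC_normc ltcR.
  split; apply/cvgrPdist_lt => e e0; have := h' e e0; apply: filterS => n.
    by apply: le_lt_trans; rewrite -raddfB normc_re.
  by apply: le_lt_trans; rewrite -raddfB normc_im.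
move=> [/cvgrPdist_lt hr /cvgrPdist_lt hi]; apply/cvgrPdist_lt => e.
rewrite ltcE /= => /andP[/eqP e2 e1].
have e3 : 0 < Re e / 2 by rewrite divr_gt0.
near=> n.
rewrite normC_normc; have -> : e = (Re e)%:C by apply/eqP; rewrite eq_complex /= eqxx e2 eqxx.
rewrite ltcR (le_lt_trans (normc_le _))// !raddfB.
rewrite [ltRHS](splitr (Re e)); apply: ltrD.
  by near: n; exact: hr.
by near: n; exact: hi.
Unshelve. all: by end_near. Qed.

(** Convergence at r = 1/2 gives |c_n| <= K 2^n, so for r <= 1/4 the terms past the first add up to
    at most 4 K r. As the whole sum is 0, so is c_0 in the limit r to 0. *)
Lemma pseries_eq0_head (c : nat -> R) :
  (forall r, 0 < r -> r < 1 -> series (fun n => c n * r ^+ n) @ \oo --> (0 : R)) ->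
  c 0%N = 0.
Proof.
move=> h.
have h2 := h 2^-1 _ _.
have [K K0 hK] : exists2 K, 0 <= K & forall n, `|c n| <= K * 2 ^+ n.
  have c0 : cvgn (series (fun n => c n * 2^-1 ^+ n)) by apply/cvg_ex; exists 0; apply: h2; lra.
  have /cvg_seq_bounded[K [Kr hK]] : cvgn (fun n => c n * 2^-1 ^+ n).
    by apply/cvg_ex; exists 0; exact: cvg_series_cvg_0.
  exists (`|K| + 1); first by rewrite addr_ge0.
  move=> n; have := hK (`|K| + 1); rewrite ltr_pwDr ?ler_norm// => /(_ isT n I) /=.
  rewrite normrM normrX (ger0_norm (_ : 0 <= 2^-1 :> R)) ?invr_ge0//.
  by rewrite exprVn ler_pdivrMr ?exprn_gt0.
have key r : 0 < r -> r <= 4^-1 -> `|c 0%N| <= 4 * K * r.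
  move=> r0 r4.
  have geo N : \sum_(0 <= i < N) (2 * r) ^+ i <= 2.
    elim: N => [|N IHN]; first by rewrite big_geq.
    rewrite big_nat_recl//= expr0; under eq_bigr do rewrite exprS.
    rewrite -mulr_sumr.
    have S0 : 0 <= \sum_(0 <= i < N) (2 * r) ^+ i.
      by apply: sumr_ge0 => i _; rewrite exprn_ge0// mulr_ge0// ltW.
    nra.
  have r1 : r < 1 by lra.
  have hc : (fun N => c 0%N - series (fun n => c n * r ^+ n) N.+1) @ \oo --> c 0%N.
    rewrite -[X in _ --> X]subr0; apply: cvgB; first exact: cvg_cst.
    by rewrite (cvg_shiftS (series (fun n => c n * r ^+ n))); exact: h.
  have /cvg_norm hn := hc.
  apply: (cvgr_to_le hn); apply: nearW => N /=.
  rewrite /series /= big_nat_recl//= expr0 mulr1 opprD addrA subrr add0r normrN.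
  apply: (le_trans (ler_norm_sum _ _ _)).
  apply: (@le_trans _ _ (2 * r * K * \sum_(0 <= i < N) (2 * r) ^+ i)); last first.
    have -> : 4 * K * r = 2 * r * K * 2 by ring.
    by rewrite ler_wpM2l// !mulr_ge0// ltW.
  rewrite mulr_sumr; apply: ler_sum => i _.
  rewrite normrM (ger0_norm (exprn_ge0 _ (ltW r0))).
  have -> : 2 * r * K * (2 * r) ^+ i = K * 2 ^+ i.+1 * r ^+ i.+1.
    by rewrite exprMn !exprS; ring.
  by rewrite ler_wpM2r// exprn_ge0// ltW.
apply/eqP; rewrite -normr_le0; apply/ler_addgt0Pr => e e0; rewrite add0r.
(* The summand 1 in the denominator keeps it positive when [K = 0]. *)
pose r := Num.min 4^-1 (e / (4 * K + 1)).
have K1 : 0 < 4 * K + 1 by lra.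
have r0 : 0 < r by rewrite lt_min divr_gt0//; lra.
apply: (le_trans (key r r0 _)); first by rewrite ge_min lexx.
have : r <= e / (4 * K + 1) by rewrite ge_min lexx orbT.
rewrite ler_pdivlMr// => h3; lra.
Qed.

Lemma pseries_eq0 (c : nat -> R) n :
  (forall r, 0 < r -> r < 1 -> series (fun n => c n * r ^+ n) @ \oo --> (0 : R)) ->
  c n = 0.
Proof.
elim: n c => [|n IHn] c h; first exact: pseries_eq0_head.
apply: (IHn (fun n => c n.+1)) => r r0 r1.
have c0 := pseries_eq0_head h.
have := h r r0 r1; rewrite -(cvg_shiftS (series _)) => hr.
have -> : series (fun k => c k.+1 * r ^+ k) = (fun N => r^-1 * series (fun k => c k * r ^+ k) N.+1).
  apply/funext => N; rewrite /series /= big_nat_recl//= c0 mul0r add0r mulr_sumr.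
  by apply: eq_bigr => k _; rewrite exprS; field; rewrite gt_eqF.
by rewrite -[X in _ --> X](mulr0 r^-1); apply: cvgMl_tmp.
Qed.

(** Restriction to real points of ]0, 1[ separates real and imaginary parts. Uniqueness is what
    identifies [coef], which is defined by choice, with any known expansion. *)
Lemma taylor_coefs_unique (f : C -> C) a b :
  taylor_coefs f a -> taylor_coefs f b -> a = b.
Proof.
move=> ha hb.
have hr (r : R) : 0 < r -> r < 1 -> `|r%:C : C| < 1.
  by move=> r0 r1; rewrite normc_def /= expr0n addr0 sqrtr_sqr ger0_norm ?ltW// -[X in _ < X]/(1%:C) ltcR.
have part c (r : R) N : power_series c r%:C N =
    series (fun n => Re (c n) * r ^+ n) N +i* series (fun n => Im (c n) * r ^+ n) N.
  rewrite /power_series /series /=; elim: N => [|N IHN]; first by rewrite !big_geq.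
  rewrite !big_nat_recr//= IHN -rmorphXn/=; case: (c N) => x y.
  by apply/eqP; rewrite eq_complex /= !mulr0 subr0 add0r !eqxx.
have hz n : Re (a n) - Re (b n) = 0 /\ Im (a n) - Im (b n) = 0.
  split.
    apply: (pseries_eq0 (c := fun n => Re (a n) - Re (b n))) => r r0 r1.
    have /cvgC[ha1 _] := ha _ (hr r r0 r1); have /cvgC[hb1 _] := hb _ (hr r r0 r1).
    rewrite -(subrr (Re (f r%:C))); have h1 := cvgB ha1 hb1.
  rewrite (_ : series _ = (fun n => Re (power_series a r%:C n) - Re (power_series b r%:C n)))//; first exact: h1.
  apply/funext => N; rewrite !part /=.
  by rewrite /series /= -sumrB; apply: eq_bigr => k _; rewrite mulrBl.
  apply: (pseries_eq0 (c := fun n => Im (a n) - Im (b n))) => r r0 r1.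
  have /cvgC[_ ha1] := ha _ (hr r r0 r1); have /cvgC[_ hb1] := hb _ (hr r r0 r1).
  rewrite -(subrr (Im (f r%:C))); have h1 := cvgB ha1 hb1.
  rewrite (_ : series _ = (fun n => Im (power_series a r%:C n) - Im (power_series b r%:C n)))//; first exact: h1.
  apply/funext => N; rewrite !part /=.
  by rewrite /series /= -sumrB; apply: eq_bigr => k _; rewrite mulrBl.
apply/funext => n; have [/subr0_eq h1 /subr0_eq h2] := hz n.
by apply/eqP; rewrite eq_complex h1 h2 !eqxx.
Qed.

End complex_sequences.

Section hardy_space_of_sequences.
Context {R : realType}.
Local Notation C := R[i].
Local Notation E t := (expR (- t : R)).
Implicit Types (z w : C) (a b d : nat -> C) (f g : C -> C).

(** The coefficients of the Szego kernel at [z]: pairing with it evaluates at [z]. *)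
Definition kern z (n : nat) : C := conjc z ^+ n.

Lemma rdot_conj z : rdot (conjc z) (conjc z) = rdot z z.
Proof. by case: z => ? ?; rewrite /rdot /=; ring. Qed.

Lemma rdotX z n : rdot (z ^+ n) (z ^+ n) = rdot z z ^+ n.
Proof.
elim: n => [|n IHn]; first by rewrite /rdot /= mul0r addr0 mulr1.
by rewrite !exprS rdotM IHn.
Qed.

Lemma ell2_kern z : `|z| < 1 -> ell2 (kern z).
Proof.
move=> /rdot_lt1 z1; exists (1 - rdot z z)^-1 => N.
have p0 : 0 < 1 - rdot z z by rewrite subr_gt0.
rewrite -[leRHS]mul1r ler_pdivlMr//.
have -> : psum (kern z) (kern z) N * (1 - rdot z z) = 1 - rdot z z ^+ N.
  elim: N => [|N IHN]; first by rewrite /psum /series /= big_geq// mul0r expr0 subrr.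
  by rewrite psumS mulrDl IHN /kern rdotX rdot_conj exprS; ring.
by rewrite gerBl exprn_ge0// rdot_ge0.
Qed.

(** [sdot] sees only the real part of the Hermitian product; the imaginary part of w is recovered as
    the real part of -i w. *)
Definition evalC a z : C := sdot a (kern z) +i* sdot (scl (- 'i) a) (kern z).

Lemma cvg_power_series a z : ell2 a -> `|z| < 1 ->
  power_series a z @ \oo --> (evalC a z : C^o).
Proof.
move=> ha z1; have hk := ell2_kern z1; apply/cvgC => /=.
have sE n : power_series a z n = psum a (kern z) n +i* psum (scl (- 'i) a) (kern z) n.
  rewrite /power_series /psum /series /=; elim: n => [|n IHn]; first by rewrite !big_geq.
  rewrite !big_nat_recr//= IHn /kern /scl.
  have -> : conjc z ^+ n = conjc (z ^+ n) by rewrite rmorphXn.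
  case: (a n) (z ^+ n) => x y [x' y'].
  by apply/eqP; rewrite eq_complex /rdot /=; apply/andP; split; apply/eqP; ring.
by split; under eq_fun do rewrite sE; apply: cvg_psum => //; exact: ell2Z.
Qed.

Definition fn a z : C := if `|z| < 1 then evalC a z else 0.

Lemma taylor_coefs_fn a : ell2 a -> taylor_coefs (fn a) a.
Proof. by move=> ha z z1; rewrite /fn z1; exact: cvg_power_series. Qed.

Lemma square_summableP a : square_summable a <-> ell2 a.
Proof.
rewrite /square_summable; under eq_fun do rewrite -rdot_normc.
split => [h|]; last exact: cvg_psum_sq.
by exists (sdot a a) => n; exact: nondecreasing_cvgn_le (psum_nd a) h n.
Qed.

Lemma H2D_fn a : ell2 a -> H2D (fn a).
Proof.
move=> ha; split.
  by exists a; [exact/square_summableP|exact: taylor_coefs_fn].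
by move=> z z1; rewrite /fn (negbTE z1).
Qed.

Lemma coef_fn a : ell2 a -> coef (fn a) = a.
Proof.
move=> /taylor_coefs_fn ha; rewrite /coef.
by apply: (taylor_coefs_unique _ ha); exact: (xgetI _ ha).
Qed.

Lemma H2D_coef f : H2D f -> ell2 (coef f) /\ f = fn (coef f).
Proof.
move=> [[a /square_summableP ha af] f0].
have -> : coef f = a.
  by apply: (taylor_coefs_unique _ af); exact: (xgetI _ af).
split=> //; apply/funext => z; rewrite /fn; case: ifPn => z1; last exact: f0.
exact: (cvg_unique _ (af z z1) (cvg_power_series ha z1)).
Qed.

Lemma evalCD a b z : ell2 a -> ell2 b -> `|z| < 1 -> evalC (a + b) z = evalC a z + evalC b z.
Proof.
move=> ha hb z1; have hk := ell2_kern z1.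
have sclD w : scl w (a + b) = scl w a + scl w b.
  by apply/funext => n; rewrite /scl !fctE mulrDr.
rewrite /evalC sclD !sdotDl//; exact: ell2Z.
Qed.

Lemma fnD a b : ell2 a -> ell2 b -> fn (a + b) = (fun z => fn a z + fn b z).
Proof.
move=> ha hb; apply/funext => z; rewrite /fn; case: ifPn => z1; last by rewrite addr0.
exact: evalCD.
Qed.

Lemma fnZ w a : ell2 a -> fn (scl w a) = (fun z => w * fn a z).
Proof.
move=> ha; apply/funext => z; rewrite /fn; case: ifPn => z1; last by rewrite mulr0.
apply: (cvg_unique _ (cvg_power_series (ell2Z w ha) z1)) => //.
have h := cvg_power_series ha z1.
have -> : power_series (scl w a) z = (fun n => w * power_series a z n : C^o).
  apply/funext => n; rewrite /power_series /series /= mulr_sumr.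
  by apply: eq_bigr => k _; rewrite /scl mulrA.
exact: (@cvgMl_tmp C).
Qed.

Lemma fnB a b : ell2 a -> ell2 b -> fn (a - b) = (fun z => fn a z - fn b z).
Proof.
move=> ha hb; rewrite fnD//; last exact: ell2N.
by rewrite -sclN1 fnZ//; apply/funext => z; rewrite rmorphN mulN1r.
Qed.

Lemma fn0 : fn 0 = (fun=> 0).
Proof.
by rewrite -(scl0 0) fnZ; [apply/funext => z; rewrite mul0r|exact: ell2_0].
Qed.

Lemma H2D_norm_fn a : ell2 a -> H2D_norm (fn a) = Num.sqrt (sdot a a).
Proof.
move=> ha; rewrite /H2D_norm coef_fn//; congr Num.sqrt; rewrite /sdot /psum.
by congr (limn (series _)); apply/funext => n; rewrite rdot_normc.
Qed.

Lemma H2D_dot_fn a b : ell2 a -> ell2 b ->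
  H2D_dot (fn a) (fn b) = sdot a b +i* sdot (scl (- 'i) a) b.
Proof.
move=> ha hb; rewrite /H2D_dot !coef_fn//.
apply: (cvg_lim (@norm_hausdorff _ C^o)).
apply/cvgC => /=.
have sE n : series (fun n => a n * (b n)^* : C^o) n = psum a b n +i* psum (scl (- 'i) a) b n.
  rewrite /psum /series /=; elim: n => [|n IHn]; first by rewrite !big_geq.
  rewrite !big_nat_recr//= IHn /scl; case: (a n) (b n) => x y [x' y'].
  by apply/eqP; rewrite eq_complex /rdot /=; apply/andP; split; apply/eqP; ring.
by split; under eq_fun do rewrite sE; apply: cvg_psum => //; exact: ell2Z.
Qed.

Lemma cesaro_op_fn a : ell2 a -> cesaro_op (fn a) = fn (ces a).
Proof.
move=> ha; apply/funext => z; rewrite /cesaro_op /fn coef_fn//.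
case: ifPn => // z1; apply: (cvg_lim (@norm_hausdorff _ C^o)).
by apply: cvg_power_series => //; exact: ell2_ces.
Qed.

End hardy_space_of_sequences.

(** * Adjoints of the Euler means and composition operators on the disc *)

Section composition_invariance.
Context {R : realType}.
Local Notation C := R[i].
Local Notation E t := (expR (- t : R)).
Implicit Types (z w : C) (a b d : nat -> C) (f g : C -> C).

Definition delta (w : C) (k n : nat) : C := if n == k then w else 0.

Lemma psum_delta w k a n : psum (delta w k) a n = if (k < n)%N then rdot w (a k) else 0.
Proof.
elim: n => [|n IHn]; first by rewrite /psum /series /= big_geq.
rewrite psumS IHn /delta ltnS eq_sym.
by case: (ltngtP k n) => [_|_|->]/=; rewrite ?rdot0 ?addr0 ?add0r.
Qed.

Lemma ell2_delta w k : ell2 (delta w k).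
Proof.
exists (rdot w w) => n; rewrite psum_delta /delta eqxx.
by case: ifP => // _; exact: rdot_ge0.
Qed.

Definition trunc a (N n : nat) : C := if (n < N)%N then a n else 0.

Lemma psum_trunc a b N n : psum (trunc a N) b n = psum a b (minn n N).
Proof.
elim: n => [|n IHn]; first by rewrite min0n /psum /series /= !big_geq.
rewrite psumS IHn /trunc; case: ltnP => nN.
  by rewrite !(minn_idPl _)// ?psumS// ltnW.
by rewrite rdot0 addr0 !(minn_idPr _)// leqW.
Qed.

Lemma ell2_trunc a N : ell2 (trunc a N).
Proof.
exists (psum a a N) => n; rewrite psum_trunc psumC psum_trunc.
by apply: psum_nd; rewrite !geq_min leqnn !orbT.
Qed.

Lemma sdot_trunc a b N : sdot (trunc a N) b = psum a b N.
Proof.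
apply/cvg_lim => //; apply: cvg_near_cst; near=> n.
rewrite psum_trunc (minn_idPr _)//; near: n; exact: nbhs_infty_ge.
Unshelve. all: by end_near. Qed.

Lemma truncS a N : trunc a N.+1 = trunc a N + scl (Re (a N))%:C (delta 1 N) +
  scl (Im (a N))%:C (delta 'i N).
Proof.
apply/funext => n; rewrite !fctE /trunc /scl /delta ltnS.
case: (ltngtP n N) => [_|_|->]/=; rewrite ?mulr0 ?addr0//.
rewrite add0r; case: (a N) => x y.
by apply/eqP; rewrite eq_complex /= !mulr0 !mul0r !mulr1 !subr0 !addr0 !add0r !eqxx.
Qed.

Lemma sdot_trunc_compl a N : ell2 a ->
  sdot (a - trunc a N) (a - trunc a N) = sdot a a - psum a a N.
Proof.
move=> ha; have ht := ell2_trunc a N.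
rewrite sdotBl ?sdotBr//; last exact: ell2B.
rewrite (sdotC a (trunc _ _)) !sdot_trunc psumC.
have -> : psum (trunc a N) a N = psum a a N by rewrite psum_trunc minnn.
by rewrite subrr subr0.
Qed.

(** Riesz representation of the bounded functional sending a to the pairing of its Euler mean with
    [b]. As that functional is only real linear, both unit vectors 1 and i are tested at each index
    to read off [d]. *)
Lemma eul_adjoint (t : R) b : 0 <= t -> ell2 b ->
  exists2 d, ell2 d & forall a, ell2 a -> sdot a d = sdot (eul (E t) a) b.
Proof.
move=> t0 hb; have u01 := expRN01 t0; set u := E t in u01 *.
have /andP[u0 u1] := u01.
pose L a := sdot (eul u a) b.
have LD a a' : ell2 a -> ell2 a' -> L (a + a') = L a + L a'.
  by move=> ha ha'; rewrite /L eulD sdotDl//; exact: ell2_eul.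
have LZ (r : R) a : ell2 a -> L (scl r%:C a) = r * L a.
  by move=> ha; rewrite /L eulZ sdotZl//; exact: ell2_eul.
pose d n : C := L (delta 1 n) +i* L (delta 'i n).
have Ltr a N : L (trunc a N) = psum a d N.
  elim: N => [|N IHN].
    rewrite /psum /series /= big_geq//.
    have -> : trunc a 0 = scl (0 : R)%:C (delta 0 0).
      by apply/funext => n; rewrite /trunc /scl rmorph0 mul0r.
    by rewrite LZ ?mul0r//; exact: ell2_delta.
  have h1 := ell2_delta 1 N; have h2 := ell2_delta 'i N.
  rewrite truncS !LD ?LZ//; try exact: ell2Z; last first.
  - by apply: ell2D; [exact: ell2_trunc|exact: ell2Z].
  - exact: ell2_trunc.
  by rewrite IHN psumS /rdot /d /= addrA.
have Lbd a : ell2 a -> L a ^+ 2 <= u^-1 * sdot a a * sdot b b.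
  move=> ha; have he := ell2_eul u01 ha.
  apply: (le_trans (sdot_CS he hb)); rewrite ler_wpM2r ?sdot_ge0//.
  by rewrite ler_pdivlMl// sdot_eul.
(* Tested on the truncation of [d] itself, boundedness reads p^2 <= u^{-1} p |b|^2 for the partial
   sum p, and one factor p cancels. *)
have hd : ell2 d.
  exists (u^-1 * sdot b b) => N.
  have h0 := psum_ge0 d N.
  have := Lbd _ (ell2_trunc d N).
  rewrite Ltr sdot_trunc psumC psum_trunc minnn.
  set p := psum d d N in h0 *; rewrite mulrAC => h.
  case: (eqVneq p 0) => [->|pn0].
    by rewrite mulr_ge0 ?invr_ge0 ?sdot_ge0// ltW.
  have pp : 0 < p by rewrite lt_def pn0.
  by move: h; rewrite expr2 ler_pM2r.
exists d => // a ha.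
have c1 := cvg_psum ha hd.
have c2 : psum a d @ \oo --> L a.
  apply/cvgrPdist_le => e e0.
  have cA : (fun N => u^-1 * (sdot a a - psum a a N) * sdot b b) @ \oo --> (0 : R).
    rewrite -[X in _ --> X](mul0r (sdot b b)); apply: cvgMr_tmp.
    rewrite -[X in _ --> X](mulr0 u^-1); apply: cvgMl_tmp.
    rewrite -[X in _ --> X](subrr (sdot a a)); apply: cvgB; first exact: cvg_cst.
    exact: cvg_psum_sq.
  have : \forall N \near \oo, u^-1 * (sdot a a - psum a a N) * sdot b b < e ^+ 2.
    by move/cvgr_lt : cA; apply; rewrite exprn_gt0.
  apply: filterS => N hN.
  rewrite -(@ler_pXn2r _ 2) ?nnegrE ?(ltW e0)// real_normK ?num_real//.
  have ht := ell2_trunc a N.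
  have -> : L a - psum a d N = L (a - trunc a N).
    by rewrite -Ltr -[in RHS]sclN1 LD ?LZ ?mulN1r//; exact: ell2Z.
  apply: le_trans (Lbd _ (ell2B ha ht)) _.
  by rewrite sdot_trunc_compl// ltW.
exact: (cvg_unique _ c1 c2).
Qed.

Definition comp_disc (t : R) (f : C -> C) (z : C) : C :=
  if `|z| < 1 then f ((E t)%:C * z + 1 - (E t)%:C) else 0.

Lemma comp_disc_bound (t : R) z : 0 <= t -> `|z| < 1 -> `|(E t)%:C * z + 1 - (E t)%:C| < 1.
Proof.
move=> t0; have /andP[u0 u1] := expRN01 t0.
rewrite !lt1_normc => z1; set u := E t in u0 u1 *.
have -> : u%:C * z + 1 - u%:C = u%:C * z + (1 - u)%:C by rewrite rmorphB rmorph1 addrA.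
have := ler_normD (u%:C * z) (1 - u)%:C.
rewrite !normC_normc -rmorphD lecR; move=> h; apply: (le_lt_trans h) => {h}.
rewrite ComplexField.Normc.normcM.
have nr (r : R) : 0 <= r -> normc r%:C = r by move=> r0; rewrite /normc /= expr0n addr0 sqrtr_sqr ger0_norm.
rewrite !nr ?subr_ge0//; last exact: ltW.
by rewrite addrA ltrBlDr addrC ltrD2l -[ltRHS]mulr1 ltr_pM2l.
Qed.

Lemma conjc_affine (u : R) z : conjc (u%:C * z + 1 - u%:C) = (1 - u)%:C + u%:C * conjc z.
Proof.
case: z => x y; apply/eqP; rewrite eq_complex /=.
by apply/andP; split; apply/eqP; ring.
Qed.

(** The source of the composition operator: by the binomial theorem an Euler mean moves the kernel
    at [z] to the kernel at the image of [z]. *)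
Lemma eul_kern (u : R) z : eul u (kern z) = kern (u%:C * z + 1 - u%:C).
Proof.
apply/funext => n; rewrite /eul /kern conjc_affine exprDn big_mkord.
apply: eq_bigr => k _.
rewrite /bw !rmorphM !rmorphXn rmorph_nat exprMn -[RHS]mulr_natl.
move: ('C(n, k)%:R) (u%:C ^+ k) ((1 - u)%:C ^+ (n - k)) (conjc z ^+ k) => c1 c2 c3 c4.
by rewrite -!mulrA; congr (_ * _); rewrite mulrCA.
Qed.

(** Evaluation at [z] is pairing with the kernel at [z]. Moving the adjoint onto the kernel and
    applying [eul_kern] evaluates [b] at the image point. *)
Lemma fn_adjoint (t : R) b d : 0 <= t -> ell2 b -> ell2 d ->
  (forall a, ell2 a -> sdot a d = sdot (eul (E t) a) b) ->
  fn d = comp_disc t (fn b).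
Proof.
move=> t0 hb hd had; apply/funext => z; rewrite /fn /comp_disc; case: (boolP (`|z| < 1)) => [z1|_]; last by [].
rewrite (comp_disc_bound t0 z1).
have hk := ell2_kern z1.
(* For the real inner product the adjoint of multiplication by -i is multiplication by i. *)
have sw a c : sdot (scl (- 'i) a) c = sdot (scl 'i c) a.
  rewrite sdotC /sdot /psum; congr (limn (series _)); apply/funext => n.
  by rewrite /scl; case: (a n) (c n) => ? ? [? ?]; rewrite /rdot /=; ring.
by rewrite /evalC !sw !(sdotC _ (kern _)) !had ?eulZ ?eul_kern//; exact: ell2Z.
Qed.

Variable M : set (C -> C).
Hypothesis hM : closed_subspace M.

Let V : set (nat -> C) := [set a | ell2 a /\ M (fn a)].

Lemma hilbert_subspace_coefs : hilbert_subspace V.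
Proof.
case: hM => subM M0 MP Mcl; split.
- by move=> a [].
- by split; [exact: ell2_0|rewrite fn0].
- move=> a b [ha Ma] [hb Mb]; split; first exact: ell2D.
  rewrite fnD//; have := MP 1 _ _ Ma Mb.
  by congr M; apply/funext => z; rewrite mul1r.
- move=> w a [ha Ma]; split; first exact: ell2Z.
  rewrite fnZ//; have := MP w _ _ Ma M0.
  by congr M; apply/funext => z; rewrite addr0.
- move=> a ha acl; split => //; apply: Mcl; first exact: H2D_fn.
  move=> e e0; have [b [hb Mb] ab] := acl (e ^+ 2) (exprn_gt0 _ e0).
  exists (fn b) => //; rewrite -fnB// H2D_norm_fn; last exact: ell2B.
  by rewrite -(@ltr_pXn2r _ 2) ?nnegrE ?sqrtr_ge0 ?(ltW e0)// sqr_sqrtr// sdot_ge0//; exact: ell2B.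
Qed.

Lemma orthogonal_complement_fn b : ell2 b ->
  orthogonal_complement M (fn b) <-> forall v, V v -> sdot v b = 0.
Proof.
move=> hb; split=> [[_ h] v [hv Mv]|h].
  by have := h _ Mv; rewrite H2D_dot_fn// => /eqP; rewrite eq_complex /= => /andP[/eqP].
split; first exact: H2D_fn.
move=> f Mf; have [hf fE] := H2D_coef (closed_subspace_sub hM Mf).
have Vf : V (coef f) by split => //; rewrite -fE.
rewrite fE H2D_dot_fn// (h _ Vf) (h _ (hilbertZ hilbert_subspace_coefs _ Vf)).
by apply/eqP; rewrite eq_complex /= !eqxx.
Qed.

Theorem cesaro_composition_invariant :
  cesaro_op @` M `<=` M <->
  (forall (t : R) g, 0 <= t -> orthogonal_complement M g ->
     orthogonal_complement M (comp_disc t g)).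
Proof.
have hV := hilbert_subspace_coefs.
have -> : cesaro_op @` M `<=` M <-> (forall a, V a -> V (ces a)).
  split=> [h a [ha Ma]|h _ [f Mf <-]].
    split; first exact: ell2_ces.
    by rewrite -cesaro_op_fn//; apply: h; exists (fn a).
  have [hf fE] := H2D_coef (closed_subspace_sub hM Mf).
  rewrite fE cesaro_op_fn//; apply: (h _ _).2.
  by split => //; rewrite -fE.
rewrite (cesaro_euler_invariant hV); split=> h t.
  move=> g t0 Ng; have [hg gE] := H2D_coef Ng.1.
  have [d hd had] := eul_adjoint t0 hg.
  rewrite gE -(fn_adjoint t0 hg hd had); apply/orthogonal_complement_fn => // v Vv.
  rewrite had; last exact: hilbert_sub hV _ Vv.
  have Ng' : orthogonal_complement M (fn (coef g)) by rewrite -gE.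
  exact: (orthogonal_complement_fn hg).1 Ng' _ (h t v t0 Vv).
move=> a t0 Va; have ha := hilbert_sub hV Va.
apply: (orthogonal_orthogonal hV) => [|b hb bV].
  by apply: ell2_eul => //; exact: expRN01.
have [d hd had] := eul_adjoint t0 hb.
have := h t (fn b) t0 ((orthogonal_complement_fn hb).2 bV).
rewrite -(fn_adjoint t0 hb hd had) => hh.
rewrite -(had _ ha); exact: (orthogonal_complement_fn hd).1 hh _ Va.
Qed.

End composition_invariance.

(** * Laguerre functions and the inverse Laplace transform *)

Section laguerre_functions.
Context {R : realType}.
Local Notation C := R[i].
Local Notation mu := (@lebesgue_measure R).
Local Notation D := (`]0%R, +oo[%classic : set R).
Local Notation E t := (expR (- t : R)).
Implicit Types (p q : {poly R}).

(** At [i = 0] the coefficient is a division by zero, hence 0, so this antiderivative vanishes at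
    0. *)
Definition prim p : {poly R} := \poly_(i < (size p).+1) (p`_i.-1 / i%:R).

Lemma deriv_prim p : (prim p)^`() = p.
Proof.
apply/polyP => i; rewrite coef_deriv coef_poly ltnS /=.
case: ltnP => [|hi]; last by rewrite mul0rn nth_default.
by move=> _; rewrite -[LHS]mulr_natr divfK// pnatr_eq0.
Qed.

Lemma prim0 p : (prim p).[0] = 0.
Proof. by rewrite horner_coef0 coef_poly /= invr0 mulr0. Qed.

(* [(lag n).[x] = L_n(2 x)] for the Laguerre polynomials [L_n]. *)
Fixpoint lag (n : nat) : {poly R} :=
  if n is m.+1 then lag m - 2 *: prim (lag m) else 1.

Lemma lag0 n : (lag n).[0] = 1.
Proof.
by elim: n => [|n IHn] /=; rewrite ?hornerE// IHn prim0 mulr0 subr0.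
Qed.

Lemma deriv_lagS n : (lag n.+1)^`() = (lag n)^`() - 2 *: lag n.
Proof. by rewrite /= derivB derivZ deriv_prim. Qed.

Lemma deriv_lag n : (lag n)^`() = - 2 *: \sum_(0 <= j < n) lag j.
Proof.
elim: n => [|n IHn]; first by rewrite big_geq// scaler0 /= derivC.
by rewrite deriv_lagS IHn [in RHS]big_nat_recr// [in RHS]scalerDr -scaleNr.
Qed.

(** Each factor x is paid for by half of the exponential rate, since x <= (2 / c) e^{cx/2}. *)
Lemma poly_exp_bound p (c : R) : 0 < c -> exists K : R, forall x, 0 <= x ->
  `|p.[x]| <= K * expR (c * x).
Proof.
elim/poly_ind: p c => [|p k IHp] c c0.
  by exists 0 => x _; rewrite horner0 normr0 mul0r.
have c2 : 0 < c / 2 by rewrite divr_gt0.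
have [K hK] := IHp _ c2.
have K0 : 0 <= K.
  have := hK 0 (lexx _); rewrite mulr0 expR0 mulr1; exact: le_trans.
exists (K * (2 / c) + `|k|) => x x0.
rewrite hornerMXaddC mulrDl; apply: (le_trans (ler_normD _ _)); apply: lerD.
  rewrite normrM (ger0_norm x0).
  have h1 : x <= 2 / c * expR (c / 2 * x).
    have h := expR_ge1Dx (c / 2 * x).
    have -> : x = 2 / c * (c / 2 * x) by field; rewrite gt_eqF.
    apply: ler_wpM2l; first by rewrite divr_ge0// ltW.
    have -> : c / 2 * (2 / c * (c / 2 * x)) = c / 2 * x by field; rewrite gt_eqF.
    lra.
  apply: (le_trans (ler_pM _ x0 (hK x x0) h1)) => //.
  have -> : c * x = c / 2 * x + c / 2 * x by field.
  by rewrite expRD mulrACA.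
by rewrite ler_peMr// -expR0 ler_expR mulr_ge0// ltW.
Qed.

Section laplace_by_parts.
Variables (al be : R).
Hypothesis al0 : 0 < al.

Let ecos x := E (al * x) * cos (be * x).
Let esin x := E (al * x) * sin (be * x).

Let is_derive_ecos (x : R) : is_derive x (1 : R) ecos (- al * ecos x - be * esin x).
Proof. by apply: is_derive_eq; rewrite /ecos /esin /GRing.scale /=; ring. Qed.

Let is_derive_esin (x : R) : is_derive x (1 : R) esin (- al * esin x + be * ecos x).
Proof. by apply: is_derive_eq; rewrite /ecos /esin /GRing.scale /=; ring. Qed.

Let is_derive_cont (f : R -> R) (f' : R -> R) :
  (forall x : R, is_derive x (1 : R) f (f' x)) -> continuous f.
Proof.
move=> df x; apply: differentiable_continuous; apply/derivable1_diffP.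
exact: (@ex_derive _ _ _ _ _ _ _ (df x)).
Qed.

(** Integration by parts for a polynomial against a function decaying like e^{-al x}. Half of the
    rate absorbs the polynomial, which gives integrability and the vanishing at infinity. *)
Let horner_decay p (f : R -> R) (f' : R -> R) :
  (forall x : R, is_derive x (1 : R) f (f' x)) -> continuous f' ->
  (forall x, `|f x| <= E (al * x)) ->
  (exists K : R, forall x, `|f' x| <= K * E (al * x)) ->
  [/\ mu.-integrable D (EFin \o (fun x => p.[x] * f x)),
    mu.-integrable D (EFin \o (fun x => p.[x] * f' x)) &
    (\int[mu]_(x in D) (p^`().[x] * f x) + \int[mu]_(x in D) (p.[x] * f' x))%R
      = - (p.[0] * f 0)].
Proof.
move=> df cf' fb [K f'b].
have cf := is_derive_cont df.
have al2 : 0 < al / 2 by rewrite divr_gt0.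
have bound q (h : R -> R) L : continuous h -> (forall x, `|h x| <= L * E (al * x)) ->
    exists B : R, forall x, 0 <= x -> `|q.[x] * h x| <= B * E (al / 2 * x).
  move=> ch hL; have [B hB] := poly_exp_bound q al2.
  exists (B * L) => x x0; rewrite normrM.
  apply: (le_trans (ler_pM _ _ (hB x x0) (hL x))) => //.
  rewrite mulrACA -expRD (_ : al / 2 * x + - (al * x) = - (al / 2 * x))//.
  by field.
have integ q h L : continuous h -> (forall x, `|h x| <= L * E (al * x)) ->
    mu.-integrable D (EFin \o (fun x => q.[x] * h x)).
  move=> ch hL; have [B hB] := bound q h L ch hL.
  apply: (@integrable_exp_bounded _ _ B (al / 2)) => //; last by move=> x /ltW; exact: hB.
  apply: measurable_funTS; apply: continuous_measurable_fun => x.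
  by apply: cvgM; [exact: continuous_horner|exact: ch].
have fb' x : `|f x| <= 1 * E (al * x) by rewrite mul1r.
have i1 := integ p f 1 cf fb'; have i2 := integ p f' K cf' f'b.
have i3 := integ p^`() f 1 cf fb'.
split => //.
rewrite -RintegralD//.
apply: (@integral_decay R (fun x => p.[x] * f x)).
- move=> x; apply: (is_derive_eq (is_deriveM (is_derive_poly p x) (df x))).
  by rewrite /GRing.scale /= addrC mulrC.
- move=> x; apply: cvgD; apply: cvgM; try exact: continuous_horner; [exact: cf|exact: cf'].
- rewrite (_ : EFin \o _ = (EFin \o (fun x => p^`().[x] * f x)) \+ (EFin \o (fun x => p.[x] * f' x)))//.
  exact: integrableD.
have [B hB] := bound p f 1 cf fb'.
apply: (@squeeze_cvgr _ _ _ _ (fun t => - (B * E (al / 2 * t))) (fun t => B * E (al / 2 * t))).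
- near=> t; rewrite -ler_norml; apply: hB; apply/ltW; near: t; exact: nbhs_pinfty_gt.
- rewrite -[X in _ --> X]oppr0 -[X in _ --> - X](mulr0 B); apply: cvgN.
  by apply: cvgMl_tmp; exact: expRM_cvg0.
- rewrite -[X in _ --> X](mulr0 B).
  by apply: cvgMl_tmp; exact: expRM_cvg0.
Unshelve. all: by end_near. Qed.

Let ecos_bound x : `|ecos x| <= E (al * x).
Proof. by rewrite /ecos normrM ger0_norm ?expR_ge0// ler_piMr ?expR_ge0 ?cos_max. Qed.

Let esin_bound x : `|esin x| <= E (al * x).
Proof. by rewrite /esin normrM ger0_norm ?expR_ge0// ler_piMr ?expR_ge0 ?sin_max. Qed.

Let comb_bound (c1 c2 : R) (f1 f2 : R -> R) :
  (forall x, `|f1 x| <= E (al * x)) -> (forall x, `|f2 x| <= E (al * x)) ->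
  forall x, `|c1 * f1 x + c2 * f2 x| <= (`|c1| + `|c2|) * E (al * x).
Proof.
move=> h1 h2 x; apply: (le_trans (ler_normD _ _)).
by rewrite !normrM mulrDl lerD// ler_wpM2l.
Qed.

Let cont_comb (c1 c2 : R) : continuous (fun x => c1 * ecos x + c2 * esin x).
Proof.
have cc := is_derive_cont is_derive_ecos; have cs := is_derive_cont is_derive_esin.
by move=> x; apply: cvgD; apply: cvgMl_tmp; [exact: cc|exact: cs].
Qed.

Definition Jcos p := (\int[mu]_(x in D) (p.[x] * ecos x))%R.
Definition Jsin p := (\int[mu]_(x in D) (p.[x] * esin x))%R.

Let parts_cos p : [/\ mu.-integrable D (EFin \o (fun x => p.[x] * ecos x)),
    mu.-integrable D (EFin \o (fun x => p.[x] * (- al * ecos x + - be * esin x))) &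
    Jcos p^`() + (\int[mu]_(x in D) (p.[x] * (- al * ecos x + - be * esin x)))%R = - p.[0]].
Proof.
have hd (x : R) : is_derive x (1 : R) ecos (- al * ecos x + - be * esin x).
  by apply: (is_derive_eq (is_derive_ecos x)); rewrite (mulNr be).
have hb : exists K : R, forall x, `|- al * ecos x + - be * esin x| <= K * E (al * x).
  by exists (`|- al| + `|- be|); apply: comb_bound; [exact: ecos_bound|exact: esin_bound].
have [i1 i2 e] := horner_decay p hd (@cont_comb _ _) ecos_bound hb.
split => //; rewrite /Jcos e /ecos !mulr0 oppr0 expR0 cos0; ring.
Qed.

Let parts_sin p : [/\ mu.-integrable D (EFin \o (fun x => p.[x] * esin x)),
    mu.-integrable D (EFin \o (fun x => p.[x] * (be * ecos x + - al * esin x))) &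
    Jsin p^`() + (\int[mu]_(x in D) (p.[x] * (be * ecos x + - al * esin x)))%R = 0].
Proof.
have hd (x : R) : is_derive x (1 : R) esin (be * ecos x + - al * esin x).
  by apply: (is_derive_eq (is_derive_esin x)); rewrite addrC.
have hb : exists K : R, forall x, `|be * ecos x + - al * esin x| <= K * E (al * x).
  by exists (`|be| + `|- al|); apply: comb_bound; [exact: ecos_bound|exact: esin_bound].
have [i1 i2 e] := horner_decay p hd (@cont_comb _ _) esin_bound hb.
split => //; rewrite /Jsin e /esin !mulr0 sin0 !mulr0 oppr0//.
Qed.

Lemma integrable_ecos p : mu.-integrable D (EFin \o (fun x => p.[x] * (E (al * x) * cos (be * x)))).
Proof. by have [] := parts_cos p. Qed.

Lemma integrable_esin p : mu.-integrable D (EFin \o (fun x => p.[x] * (E (al * x) * sin (be * x)))).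
Proof. by have [] := parts_sin p. Qed.

Let Jcomb p (c1 c2 : R) : (\int[mu]_(x in D) (p.[x] * (c1 * ecos x + c2 * esin x)))%R =
  c1 * Jcos p + c2 * Jsin p.
Proof.
have ic := integrable_ecos p; have is_ := integrable_esin p.
rewrite /Jcos /Jsin -!RintegralZl// -RintegralD//; last 2 first.
- exact: (@integrableZl_EFin R _ _ mu D).
- exact: (@integrableZl_EFin R _ _ mu D).
by apply: eq_Rintegral => x _; ring.
Qed.

Lemma Jcos_deriv p : Jcos p^`() = al * Jcos p + be * Jsin p - p.[0].
Proof. by have [_ _] := parts_cos p; rewrite Jcomb => h; lra. Qed.

Lemma Jsin_deriv p : Jsin p^`() = al * Jsin p - be * Jcos p.
Proof. by have [_ _] := parts_sin p; rewrite Jcomb => h; lra. Qed.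

Lemma Jcos_linear p q (c : R) : Jcos (p + c *: q) = Jcos p + c * Jcos q.
Proof.
have h1 := integrable_ecos p; have h2 := integrable_ecos q.
rewrite /Jcos -RintegralZl// -RintegralD//; last exact: (@integrableZl_EFin R _ _ mu D).
by apply: eq_Rintegral => x _; rewrite hornerD hornerZ; ring.
Qed.

Lemma Jsin_linear p q (c : R) : Jsin (p + c *: q) = Jsin p + c * Jsin q.
Proof.
have h1 := integrable_esin p; have h2 := integrable_esin q.
rewrite /Jsin -RintegralZl// -RintegralD//; last exact: (@integrableZl_EFin R _ _ mu D).
by apply: eq_Rintegral => x _; rewrite hornerD hornerZ; ring.
Qed.

(** Integration by parts reads om J(p) = p(0) + J(p'). Since consecutive Laguerre polynomials agree
    at 0 and their derivatives differ by 2 [lag n], each step multiplies om J by 1 - 2 / om. For om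
    = 1 + s this factor is (s - 1) / (s + 1). *)
Lemma Jlag n : (al +i* be) * (Jcos (lag n) -i* Jsin (lag n)) =
  (1 - 2 / (al +i* be)) ^+ n.
Proof.
set om : C := al +i* be.
have om0 : om != 0 by rewrite eq_complex /= negb_and gt_eqF.
have HJ p : om * (Jcos p -i* Jsin p) = p.[0]%:C + (Jcos p^`() -i* Jsin p^`()).
  rewrite Jcos_deriv Jsin_deriv /om.
  by apply/eqP; rewrite eq_complex /=; apply/andP; split; apply/eqP; ring.
elim: n => [|n IHn].
  rewrite HJ expr0 /= derivC /Jcos /Jsin.
  under eq_Rintegral do rewrite horner0 mul0r.
  under [X in _ -i* X]eq_Rintegral do rewrite horner0 mul0r.
  rewrite !Rintegral_cst// !mul0r hornerC oppr0.
  by apply/eqP; rewrite eq_complex /= !addr0 !eqxx.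
rewrite HJ deriv_lagS lag0 -scaleNr Jcos_linear Jsin_linear.
have -> : (1 : R)%:C + ((Jcos (lag n)^`() + - 2 * Jcos (lag n)) -i*
     (Jsin (lag n)^`() + - 2 * Jsin (lag n))) =
   ((lag n).[0]%:C + (Jcos (lag n)^`() -i* Jsin (lag n)^`())) - 2 * (Jcos (lag n) -i* Jsin (lag n)).
  rewrite lag0 natC.
  by apply/eqP; rewrite eq_complex /=; apply/andP; split; apply/eqP; ring.
rewrite -HJ exprSr -IHn; field.
exact: om0.
Qed.

End laplace_by_parts.

Let I n m := Jcos 2 0 (lag n * lag m).

Let Jcos_sum (s : seq nat) (c : R) (f : nat -> {poly R}) :
  Jcos 2 0 (c *: \sum_(j <- s) f j) = c * \sum_(j <- s) Jcos 2 0 (f j).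
Proof.
have al0 : (0 : R) < 2 by [].
elim: s => [|k s IHs].
  rewrite !big_nil scaler0 mulr0 /Jcos; under eq_Rintegral do rewrite horner0 mul0r.
  by rewrite Rintegral_cst// mul0r.
by rewrite !big_cons scalerDr addrC Jcos_linear// IHs mulrDr addrC.
Qed.

(** Integration by parts at rate 2 applied to a product, with the derivatives expanded by
    [deriv_lag]. The right-hand side is the boundary value 1 divided by 2. *)
Let I_rec n m : I n m + \sum_(0 <= j < n) I j m + \sum_(0 <= j < m) I n j = 2^-1.
Proof.
have al0 : (0 : R) < 2 by [].
have := @Jcos_deriv 2 0 al0 (lag n * lag m).
rewrite hornerM !lag0 mulr1 mul0r addr0 derivM !deriv_lag -/(I n m).
rewrite -scalerAl mulr_suml -scalerAr mulr_sumr.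
rewrite Jcos_linear// Jcos_sum -/(I _ _) => h.
have := Jcos_sum (index_iota 0 m) 1 (fun j => lag n * lag j).
rewrite scale1r mul1r => h2; move: h; rewrite h2.
rewrite -[X in -2 * X + _]/(\sum_(0 <= j < n) I j m) -[X in _ + -2 * X]/(\sum_(0 <= j < m) I n j).
lra.
Qed.

Let sum_eqn n m : \sum_(0 <= j < n) (if j == m then 2^-1 else 0 : R) = if (m < n)%N then 2^-1 else 0.
Proof.
elim: n => [|n IHn]; first by rewrite big_geq.
rewrite big_nat_recr//= IHn ltnS.
by case: (ltngtP m n) => [_|_|_]; rewrite ?addr0 ?add0r.
Qed.

(** The recurrence determines all the integrals by induction on n + m: off the diagonal exactly one
    of the two sums already equals 1/2, on the diagonal both vanish. *)
Let I_orth n m : I n m = if n == m then 2^-1 else 0.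
Proof.
move: {2}(n + m)%N (leqnn (n + m)) => N.
elim: N n m => [|N IHN] n m nmN; have := I_rec n m.
  move: nmN; rewrite leqn0 addn_eq0 => /andP[/eqP -> /eqP ->].
  by rewrite !big_geq// !addr0 eqxx.
have -> : \sum_(0 <= j < n) I j m = if (m < n)%N then 2^-1 else 0.
  rewrite -sum_eqn; apply: eq_big_nat => j /andP[_ jn]; apply: IHN.
  by rewrite -ltnS (leq_trans _ nmN)// ltn_add2r.
have -> : \sum_(0 <= j < m) I n j = if (n < m)%N then 2^-1 else 0.
  rewrite -sum_eqn; apply: eq_big_nat => j /andP[_ jm]; rewrite eq_sym; apply: IHN.
  by rewrite -ltnS (leq_trans _ nmN)// ltn_add2l.
by case: (ltngtP n m) => _; lra.
Qed.

(** The factor [Num.sqrt 2] compensates for the value 1/2 on the diagonal in [I_orth]. *)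
Definition lagf (n : nat) (x : R) : R := Num.sqrt 2 * ((lag n).[x] * E x).

Lemma continuous_lagf n : continuous (lagf n).
Proof.
have cE : continuous (fun x : R => E x).
  by move=> x; apply: differentiable_continuous; apply/derivable1_diffP; apply: ex_derive.
by move=> x; apply: cvgMl_tmp; apply: cvgM; [exact: continuous_horner|exact: cE].
Qed.

Let lagfM n m x : lagf n x * lagf m x = 2 * ((lag n * lag m).[x] * (E (2 * x) * cos (0 * x))).
Proof.
rewrite /lagf hornerM mul0r cos0 mulr1 (_ : E (2 * x) = E x * E x); last first.
  by rewrite -expRD; congr expR; ring.
have : Num.sqrt 2 * Num.sqrt 2 = 2 :> R by rewrite -expr2 sqr_sqrtr.
move: (Num.sqrt 2) => r2 <-; ring.
Qed.

Lemma integrable_lagfM n m : mu.-integrable D (EFin \o (fun x => lagf n x * lagf m x)).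
Proof.
have al0 : (0 : R) < 2 by [].
have h := integrable_ecos 0 al0 (lag n * lag m).
rewrite (_ : EFin \o _ = EFin \o (fun x =>
  2 * ((lag n * lag m).[x] * (E (2 * x) * cos (0 * x))))); last first.
  by apply/funext => x /=; rewrite lagfM.
exact: (@integrableZl_EFin R _ _ mu D).
Qed.

Lemma orthonormal_lagf n m : (\int[mu]_(x in D) (lagf n x * lagf m x))%R = (n == m)%:R.
Proof.
have al0 : (0 : R) < 2 by [].
under eq_Rintegral do rewrite lagfM.
rewrite RintegralZl//; last exact: integrable_ecos.
have := I_orth n m; rewrite /I /Jcos => ->.
by case: eqP => _; rewrite ?mulfV// mulr0.
Qed.

End laguerre_functions.

(** * Square-integrable functions and a weak form of the Riesz-Fischer theorem *)

Section square_integrable.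
Context d (T : measurableType d) (R : realType) (mu : {measure set T -> \bar R}).
Variables (D : set T) (mD : measurable D).
Implicit Types (f g : T -> R).

Lemma integrable_le f g : measurable_fun D f -> mu.-integrable D (EFin \o g) ->
  (forall x, D x -> `|f x| <= g x) -> mu.-integrable D (EFin \o f).
Proof.
move=> mf ig fg; apply: le_integrable ig => //; first exact/measurable_EFinP.
by move=> x Dx /=; rewrite lee_fin (le_trans (fg x Dx))// ler_norm.
Qed.

Lemma integrable_addr f g : mu.-integrable D (EFin \o f) ->
  mu.-integrable D (EFin \o g) -> mu.-integrable D (EFin \o (fun x => f x + g x)).
Proof.
move=> hf hg; rewrite (_ : EFin \o _ = (EFin \o f) \+ (EFin \o g))//.
exact: integrableD.
Qed.

Lemma integrable_sq_mul f g : measurable_fun D f -> measurable_fun D g ->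
  mu.-integrable D (EFin \o (fun x => f x ^+ 2)) ->
  mu.-integrable D (EFin \o (fun x => g x ^+ 2)) ->
  mu.-integrable D (EFin \o (fun x => f x * g x)).
Proof.
move=> mf mg hf hg; apply: integrable_le (integrable_addr hf hg) _.
  exact: measurable_funM.
move=> x _; rewrite normrM -(real_normK (num_real (f x))) -(real_normK (num_real (g x))).
have := sqr_ge0 (`|f x| - `|g x|); have : 0 <= `|f x| * `|g x| by rewrite mulr_ge0.
move: (`|f x|) (`|g x|) => a b; lra.
Qed.

End square_integrable.

Section riesz_fischer.
Context d (T : measurableType d) (R : realType) (mu : {measure set T -> \bar R}).
Variables (D : set T) (mD : measurable D).
Variables (e : nat -> T -> R).
Hypotheses (me : forall n, measurable_fun D (e n))
  (ie : forall n m, mu.-integrable D (EFin \o (fun x => e n x * e m x)))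
  (orth : forall n m, (\int[mu]_(x in D) (e n x * e m x))%R = (n == m)%:R).
Variables (c : nat -> R) (K : R).
Hypothesis cK : forall N, \sum_(0 <= n < N) c n ^+ 2 <= K.

Let s M N x := \sum_(M <= n < N) c n * e n x.

Let ms M N : measurable_fun D (s M N).
Proof.
rewrite /s; elim: N => [|N IHN].
  by under eq_fun do rewrite big_geq//; exact: measurable_cst.
have [MN|NM] := leqP M N; last by under eq_fun do rewrite big_geq//; exact: measurable_cst.
under eq_fun do rewrite big_nat_recr//=.
by apply: measurable_funD => //; apply: measurable_funM => //; exact: measurable_cst.
Qed.

Let sq_s M N : mu.-integrable D (EFin \o (fun x => s M N x ^+ 2)) /\
  (\int[mu]_(x in D) (s M N x ^+ 2))%R = \sum_(M <= n < N) c n ^+ 2.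
Proof.
have sE x : s M N x ^+ 2 = \sum_(M <= n < N) \sum_(M <= m < N) (c n * c m) * (e n x * e m x).
  rewrite expr2 /s mulr_suml; apply: eq_bigr => n _.
  by rewrite mulr_sumr; apply: eq_bigr => m _; ring.
have i1 n m : mu.-integrable D (EFin \o (fun x => (c n * c m) * (e n x * e m x))).
  exact: integrableZl_EFin.
have i2 n := @Rintegral_sum R _ _ mu D (index_iota M N) _ mD (i1 n).
have [i3 i4] := @Rintegral_sum R _ _ mu D (index_iota M N) _ mD (fun n => (i2 n).1).
split; first by apply: eq_integrable i3 => // x _; rewrite /= sE.
under eq_Rintegral do rewrite sE.
rewrite i4 big_nat [RHS]big_nat; apply: eq_bigr => n /andP[Mn nN].
rewrite (i2 n).2 (bigD1_seq n) ?mem_index_iota ?Mn ?iota_uniq//= big1 ?addr0.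
  by rewrite RintegralZl// orth eqxx mulr1.
by move=> m mn; rewrite RintegralZl// orth eq_sym (negbTE mn) mulr0.
Qed.

Let S N := \sum_(0 <= n < N) c n ^+ 2.

Let exN : exists N : nat -> nat, [/\ forall k, (k <= N k)%N, forall k, (N k <= N k.+1)%N &
  forall k, \sum_(N k <= n < N k.+1) c n ^+ 2 <= 4^-1 ^+ k].
Proof.
have ndS : nondecreasing_seq S.
  by apply/nondecreasing_seqP => n; rewrite /S big_nat_recr//= lerDl sqr_ge0.
have cS : cvgn S by apply: nondecreasing_is_cvgn => //; exists K => _ [n _ <-]; exact: cK.
have /choice[n0 hn0] k : exists n, limn S - S n < 4^-1 ^+ k.
  have e0 : (0 : R) < 4^-1 ^+ k by rewrite exprn_gt0 ?invr_gt0.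
  have /cvgrPdist_lt/(_ _ e0)[n _ /(_ n (leqnn n)) hn] := cS.
  by exists n; apply: le_lt_trans hn; exact: ler_norm.
(* Adding up the thresholds, each raised by one, gives a nondecreasing sequence that dominates both
   [k] and [n0 k]. *)
pose N k := (\sum_(0 <= i < k.+1) (n0 i).+1)%N.
have NS k : (N k <= N k.+1)%N by rewrite /N [leqRHS]big_nat_recr//= leq_addr.
exists N; split => // k.
  by elim: k => [|k IHk]//; rewrite /N big_nat_recr//= (leq_ltn_trans IHk)// /N addnS ltnS leq_addr.
have nN : (n0 k <= N k)%N.
  by rewrite /N big_nat_recr//= (leq_trans (leqnSn _))// leq_addl.
have : S (N k.+1) = S (N k) + \sum_(N k <= n < N k.+1) c n ^+ 2.
  by rewrite /S -big_cat_nat.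
have := nondecreasing_cvgn_le ndS cS (N k.+1); have := ndS _ _ nN; have := hn0 k; lra.
Qed.

(** The sum is characterised by its pairings, the form in which Laplace transforms are computed. It
    is built as a pointwise limit along a sparse subsequence of partial sums, under one
    square-integrable majorant. *)
Theorem riesz_fischer : exists G : T -> R, [/\ measurable_fun D G,
  mu.-integrable D (EFin \o (fun x => G x ^+ 2)) &
  forall (psi : T -> R) (l : R), measurable_fun D psi ->
    mu.-integrable D (EFin \o (fun x => psi x ^+ 2)) ->
    series (fun n => c n * (\int[mu]_(x in D) (e n x * psi x))%R) @ \oo --> l ->
    (\int[mu]_(x in D) (G x * psi x))%R = l].
Proof.
have [N [kN NS hN]] := exN.
pose dk k := s (N k) (N k.+1).
(* The squared norm of block [k] is at most 4^{-k}; with the weight 2^k the integrals still add up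
   to at most 2, so the sum [Q] is finite almost everywhere. *)
pose q k x := 2 ^+ k * dk k x ^+ 2.
have q0 k x : 0 <= q k x by rewrite mulr_ge0 ?sqr_ge0 ?exprn_ge0.
have mq k : measurable_fun D (q k).
  by apply: measurable_funM; [exact: measurable_cst|apply: measurable_funX; exact: ms].
have iq k : (\int[mu]_(x in D) (q k x)%:E <= (2^-1 ^+ k)%:E)%E.
  have [i1 i2] := sq_s (N k) (N k.+1).
  rewrite -[leLHS]fineK; last by apply: integrable_fin_num => //; exact: integrableZl_EFin.
  rewrite lee_fin -[leLHS]/(\int[mu]_(x in D) q k x)%R RintegralZl// i2.
  apply: (@le_trans _ _ (2 ^+ k * 4^-1 ^+ k)); first by rewrite ler_wpM2l ?exprn_ge0.
  by rewrite -exprMn (_ : 2 * 4^-1 = 2^-1)//; field.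
pose Q x := (\sum_(k <oo) (q k x)%:E)%E.
have mQ : measurable_fun D Q.
  apply: ge0_emeasurable_sum => [k x Dx _|k _]; first by rewrite lee_fin.
  exact/measurable_EFinP.
have Q0 x : (0 <= Q x)%E by apply: nneseries_ge0 => k _ _; rewrite lee_fin.
have intQ : mu.-integrable D Q.
  apply/integrableP; split => //; under eq_integral do rewrite gee0_abs//.
  rewrite /Q integral_nneseries//; last 2 first.
  - by move=> k; exact/measurable_EFinP.
  - by move=> k x _; rewrite lee_fin.
  apply: (@le_lt_trans _ _ 2%:E); last exact: ltry.
  apply: lime_le; first by apply: is_cvg_nneseries => k _ _; apply: integral_ge0 => x _; rewrite lee_fin.
  apply: nearW => n; apply: (@le_trans _ _ (\sum_(0 <= k < n) (2^-1 ^+ k)%:E)%E).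
    by apply: lee_sum => k _.
  rewrite sumEFin lee_fin.
  elim: n => [|n IHn]; first by rewrite big_geq.
  by rewrite big_nat_recl//= expr0; under eq_bigr do rewrite exprS; rewrite -mulr_sumr; lra.
pose A := D `&` [set x | Q x \is a fin_num].
have mA : measurable A by exact: emeasurable_fin_num.
pose qf x := fine (Q x).
have qf0 x : 0 <= qf x by exact: fine_ge0.
have mqf : measurable_fun D qf by apply: measurableT_comp => //; exact: measurable_fine.
have iqf : mu.-integrable D (EFin \o qf).
  apply: le_integrable intQ => //; first exact/measurable_EFinP.
  move=> x Dx /=; rewrite (gee0_abs (Q0 x)) ger0_norm// /qf.
  by case: (Q x) (Q0 x) => [r||]//= _; rewrite leey.
have sumq n x : A x -> \sum_(0 <= k < n) q k x <= qf x.
  move=> [_ /= Qfin]; rewrite -lee_fin /qf fineK// -sumEFin.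
  by apply: nneseries_lim_ge => k _ _; rewrite lee_fin.
have geo n : \sum_(0 <= k < n) 2^-1 ^+ k <= 2 :> R.
  elim: n => [|n IHn]; first by rewrite big_geq.
  by rewrite big_nat_recl//= expr0; under eq_bigr do rewrite exprS; rewrite -mulr_sumr; lra.
pose a n x := \sum_(0 <= k < n) `|dk k x|.
(* Weighted Cauchy-Schwarz, splitting each modulus as 2^{-k/2} times 2^{k/2} |d_k|. Pointwise this
   gives absolute convergence of the blocks. *)
have a_sq n x : A x -> a n x ^+ 2 <= 2 * qf x.
  move=> Ax; apply: (@le_trans _ _ ((\sum_(0 <= k < n) 2^-1 ^+ k) * (\sum_(0 <= k < n) q k x))).
    apply: discr_le0 => t.
    have -> : \sum_(0 <= k < n) 2^-1 ^+ k + 2 * t * a n x + t ^+ 2 * \sum_(0 <= k < n) q k x =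
        \sum_(0 <= k < n) 2^-1 ^+ k * (1 + t * 2 ^+ k * `|dk k x|) ^+ 2.
      rewrite /a !mulr_sumr -!big_split/=; apply: eq_bigr => k _.
      rewrite /q -(real_normK (num_real (dk k x))).
      have h2 : 2^-1 ^+ k * 2 ^+ k = 1 :> R by rewrite -exprMn mulVf// expr1n.
      move: (`|dk k x|) (2^-1 ^+ k) (2 ^+ k) h2 => z u v h2.
      have -> : u * (1 + t * v * z) ^+ 2 = u + 2 * t * (u * v) * z + t ^+ 2 * (u * v) * v * z ^+ 2 by ring.
      by rewrite h2; ring.
    by apply: sumr_ge0 => k _; rewrite mulr_ge0 ?sqr_ge0 ?exprn_ge0.
  apply: ler_pM => //; [|exact: sumr_ge0|exact: sumq].
  by apply: sumr_ge0 => k _; rewrite exprn_ge0 ?invr_ge0.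
have sN k x : s 0 (N k) x = s 0 (N 0%N) x + \sum_(0 <= i < k) dk i x.
  elim: k => [|k IHk]; first by rewrite [X in _ + X]big_geq// addr0.
  rewrite [X in _ + X]big_nat_recr//= addrA -IHk.
  by rewrite /s (@big_cat_nat _ _ _ (N k))//.
pose f k x := s 0 (N k) x * \1_A x.
(* From (z + w)^2 <= 2 z^2 + 2 w^2, for the initial partial sum z and the sum w of the blocks, with
   w^2 <= [2 * qf x]. *)
pose g x := 2 * s 0 (N 0%N) x ^+ 2 + 4 * qf x.
have mf k : measurable_fun D (f k).
  by apply: measurable_funM; [exact: ms|apply: measurable_funTS; exact: measurable_indic].
have ig : mu.-integrable D (EFin \o g).
  apply: integrable_addr => //; last exact: integrableZl_EFin.
  by apply: integrableZl_EFin => //; exact: (sq_s 0 (N 0%N)).1.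
have fg k x : f k x ^+ 2 <= g x.
  rewrite /f indicE; have [/set_mem Ax|_] := boolP (x \in A); last first.
    by rewrite mulr0 expr0n /g addr_ge0// mulr_ge0 ?sqr_ge0.
  rewrite mulr1 sN /g; have h := a_sq k x Ax.
  have : (\sum_(0 <= i < k) dk i x) ^+ 2 <= a k x ^+ 2.
    by rewrite -(real_normK (num_real (\sum_(0 <= i < k) dk i x))) lerXn2r ?nnegrE ?sumr_ge0 ?ler_norm_sum.
  have := sqr_ge0 (s 0 (N 0%N) x - \sum_(0 <= i < k) dk i x).
  move: (s 0 _ x) (\sum_(0 <= i < k) dk i x) (a k x) (qf x) h => z w v r; lra.
pose G x := limn (fun k => f k x).
have cvf x : (fun k => f k x) @ \oo --> G x.
  suff : cvgn (fun k => f k x) by [].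
  rewrite /f indicE; have [/set_mem Ax|_] := boolP (x \in A); last first.
    by under eq_fun do rewrite mulr0; exact: is_cvg_cst.
  under eq_fun do rewrite mulr1 sN.
  apply: is_cvgD; first exact: is_cvg_cst.
  apply: (@normed_cvg R R^o (dk ^~ x)).
  rewrite (_ : [normed series (dk ^~ x)] = a ^~ x)//.
  apply: nondecreasing_is_cvgn.
    by apply/nondecreasing_seqP => n; rewrite /a big_nat_recr//= lerDl.
  exists (1 + 2 * qf x) => _ [n _ <-].
  by have := a_sq n x Ax; have := qf0 x; move: (a n x) (qf x) => u v; nra.
have mG : measurable_fun D G by apply: (measurable_fun_cvg mf) => x _; exact: cvf.
have Gg x : G x ^+ 2 <= g x.
  have h : (fun k => f k x ^+ 2) @ \oo --> G x ^+ 2 by apply: cvg_exprn; exact: cvf.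
  by apply: (cvgr_to_le h); exact: nearW.
exists G; split => //.
  apply: (integrable_le mD _ ig); first exact: measurable_funX.
  by move=> x _; rewrite ger0_norm ?sqr_ge0.
move=> psi l mpsi ipsi cl.
have igp := integrable_addr mD ig ipsi.
have mfp k : measurable_fun D (fun x => f k x * psi x) by exact: measurable_funM.
have mGp : measurable_fun D (fun x => G x * psi x) by exact: measurable_funM.
have lefp k x : D x -> `|f k x * psi x| <= g x + psi x ^+ 2.
  move=> _; rewrite normrM; have := fg k x.
  rewrite -(real_normK (num_real (f k x))) -(real_normK (num_real (psi x))).
  have := sqr_ge0 (`|f k x| - `|psi x|); have : 0 <= `|f k x| * `|psi x| by rewrite mulr_ge0.
  move: (`|f k x|) (`|psi x|) (g x) => u v w; lra.
have cvfp : {ae mu, forall x, D x -> (fun k => f k x * psi x) @ \oo --> G x * psi x}.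
  by apply: aeW => x _; apply: cvgMr_tmp; exact: cvf.
have [_ c1] := Rdominated_convergence mD mfp mGp cvfp igp lefp.
have isp M N' : (\int[mu]_(x in D) (s M N' x * psi x))%R =
    \sum_(M <= n < N') c n * (\int[mu]_(x in D) (e n x * psi x))%R.
  have iep n : mu.-integrable D (EFin \o (fun x => e n x * psi x)).
    by apply: integrable_sq_mul => //; apply: eq_integrable (ie n n) => // x _ /=; rewrite expr2.
  have i1 n : mu.-integrable D (EFin \o (fun x => c n * (e n x * psi x))) by exact: integrableZl_EFin.
  have [_ i2] := @Rintegral_sum R _ _ mu D (index_iota M N') _ mD i1.
  transitivity (\int[mu]_(x in D) (\sum_(M <= n < N') c n * (e n x * psi x)))%R.
    apply: eq_Rintegral => x _; rewrite /s mulr_suml.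
    by apply: eq_bigr => n _; rewrite mulrA.
  by rewrite i2; apply: eq_bigr => n _; rewrite RintegralZl.
(* The cut-off to [A] leaves the integral unchanged, as [A] has full measure in [D]. *)
have fs k : (\int[mu]_(x in D) (f k x * psi x))%R =
    series (fun n => c n * (\int[mu]_(x in D) (e n x * psi x))%R) (N k).
  rewrite /series /= -isp /Rintegral; congr fine; apply: ae_eq_integral => //.
  - exact/measurable_EFinP.
  - by apply/measurable_EFinP; apply: measurable_funM => //; exact: ms.
  - apply: filterS (integrable_ae mD intQ) => x h Dx.
    by rewrite /f indicE mem_set ?mulr1//; split => //; exact: h.
have c2 : (fun k => (\int[mu]_(x in D) (f k x * psi x))%R) @ \oo --> l.
  under eq_fun do rewrite fs.
  apply: (cvg_comp N _ _ cl) => X [m _ hX]; exists m => // k /= mk.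
  by apply: hX => /=; exact: leq_trans mk (kN k).
exact: (cvg_unique _ c1 c2).
Qed.

End riesz_fischer.

(** * Laplace transforms of Laguerre expansions *)

Section laplace_transform.
Context {R : realType}.
Local Notation C := R[i].
Local Notation mu := (@lebesgue_measure R).
Local Notation D := (`]0%R, +oo[%classic : set R).
Local Notation E t := (expR (- t : R)).
Implicit Types (a b : nat -> C) (g : R -> C) (s w : C).

Definition ecos s (x : R) : R := E (Re s * x) * cos (Im s * x).
Definition esin s (x : R) : R := E (Re s * x) * sin (Im s * x).

Lemma cexp_ecos s (x : R) : cexp (- (s * x%:C)) = ecos s x -i* esin s x.
Proof.
case: s => x1 x2; rewrite /cexp /ecos /esin /=.
rewrite !mulr0 subr0 add0r cosN sinN.
by apply/eqP; rewrite eq_complex /=; apply/andP; split; apply/eqP; ring.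
Qed.

Lemma continuous_ecos s : continuous (ecos s).
Proof.
move=> x; rewrite /ecos; apply: cvgM; first exact: continuous_expRM.
by apply: (continuous_comp (f := fun x => Im s * x)); [exact: mulrl_continuous|exact: continuous_cos].
Qed.

Lemma continuous_esin s : continuous (esin s).
Proof.
move=> x; rewrite /esin; apply: cvgM; first exact: continuous_expRM.
by apply: (continuous_comp (f := fun x => Im s * x)); [exact: mulrl_continuous|exact: continuous_sin].
Qed.

Lemma measurable_ecos s : measurable_fun D (ecos s).
Proof. by apply: measurable_funTS; apply: continuous_measurable_fun; exact: continuous_ecos. Qed.

Lemma measurable_esin s : measurable_fun D (esin s).
Proof. by apply: measurable_funTS; apply: continuous_measurable_fun; exact: continuous_esin. Qed.

Let sq_bound (r c : R) : `|c| <= 1 -> `|(E r * c) ^+ 2| <= 1 * E (2 * r).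
Proof.
move=> c1; rewrite mul1r normrX normrM ger0_norm ?expR_ge0//.
have -> : E (2 * r) = E r ^+ 2 by rewrite -expRM_natl; congr expR; ring.
rewrite lerXn2r ?nnegrE ?expR_ge0// ?mulr_ge0 ?expR_ge0//.
by rewrite ler_piMr ?expR_ge0.
Qed.

Lemma integrable_ecos2 s : 0 < Re s -> mu.-integrable D (EFin \o (fun x => ecos s x ^+ 2)).
Proof.
move=> s0; apply: (@integrable_exp_bounded _ _ 1 (2 * Re s)); first exact: mulr_gt0.
  by apply: measurable_funX; exact: measurable_ecos.
by move=> x _; rewrite -mulrA; apply: sq_bound; exact: cos_max.
Qed.

Lemma integrable_esin2 s : 0 < Re s -> mu.-integrable D (EFin \o (fun x => esin s x ^+ 2)).
Proof.
move=> s0; apply: (@integrable_exp_bounded _ _ 1 (2 * Re s)); first exact: mulr_gt0.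
  by apply: measurable_funX; exact: measurable_esin.
by move=> x _; rewrite -mulrA; apply: sq_bound; exact: sin_max.
Qed.

Lemma cayley_lt1 s : 0 < Re s -> `|(s - 1) / (s + 1)| < 1.
Proof.
move=> s0; rewrite lt1_normc -(@ltr_pXn2r _ 2) ?nnegrE ?normc_ge0// expr1n -rdot_normc.
have s1 : s + 1 != 0.
  by case: s s0 => x y /= x0; rewrite eq_complex /= negb_and gt_eqF// addr_gt0.
have p0 : 0 < rdot (s + 1) (s + 1).
  rewrite rdot_normc exprn_gt0// lt_def normc_ge0 andbT.
  by apply: contra s1 => /eqP/ComplexField.Normc.eq0_normc ->.
rewrite -(@ltr_pM2r _ (rdot (s + 1) (s + 1)))// mul1r -rdotM divfK//.
by case: s s0 {s1 p0} => x y; rewrite /rdot /= => x0; lra.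
Qed.

(** [U_map] of the monomial of degree [n], evaluated at [s]. *)
Definition lag_symbol s (n : nat) : C :=
  (Num.sqrt 2)%:C / (1 + s) * ((s - 1) / (s + 1)) ^+ n.

Lemma ell2_lag_symbol s : 0 < Re s -> ell2 (lag_symbol s).
Proof.
move=> s0; have w1 := cayley_lt1 s0; set w := (s - 1) / (s + 1) in w1.
rewrite (_ : lag_symbol s = scl ((Num.sqrt 2)%:C / (1 + s)) (kern (conjc w))).
  by apply/ell2Z/ell2_kern; rewrite normcJ.
by apply/funext => n; rewrite /lag_symbol /scl /kern conjcK.
Qed.

(** The factor e^{-x} in the Laguerre function raises the rate, so [Jlag] is applied at 1 + s. *)
Lemma laplace_lagf s n : 0 < Re s ->
  (\int[mu]_(x in D) (lagf n x * ecos s x))%R = Re (lag_symbol s n) /\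
  (\int[mu]_(x in D) (lagf n x * esin s x))%R = - Im (lag_symbol s n).
Proof.
move=> s0; have s10 : 0 < Re s + 1 by rewrite addr_gt0.
pose jc := Jcos (Re s + 1) (Im s) (lag n); pose js := Jsin (Re s + 1) (Im s) (lag n).
have hJ := Jlag (Im s) s10 n.
have omE : (Re s + 1) +i* Im s = 1 + s.
  by case: (s) => x y; apply/eqP; rewrite eq_complex /= add0r addrC !eqxx.
rewrite omE -/jc -/js in hJ.
have om0 : 1 + s != 0 by rewrite -omE eq_complex /= negb_and gt_eqF.
have zE : lag_symbol s n = (Num.sqrt 2)%:C * (jc -i* js).
  have -> : jc -i* js = (1 + s)^-1 * (1 - 2 / (1 + s)) ^+ n by rewrite -hJ mulKf.
  rewrite /lag_symbol mulrA; congr (_ * _ ^+ _).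
  by rewrite (addrC s 1); field.
have EE x : E ((Re s + 1) * x) = E x * E (Re s * x).
  by rewrite -expRD; congr expR; ring.
split.
  transitivity (Num.sqrt 2 * jc); last by rewrite zE /= mul0r subr0.
  rewrite /jc /Jcos -RintegralZl//; last exact: integrable_ecos.
  by apply: eq_Rintegral => x _; rewrite EE /lagf /ecos; ring.
transitivity (Num.sqrt 2 * js); last by rewrite zE /= mul0r addr0 mulrN opprK.
rewrite /js /Jsin -RintegralZl//; last exact: integrable_esin.
by apply: eq_Rintegral => x _; rewrite EE /lagf /esin; ring.
Qed.

Lemma ell2_reim a : ell2 a ->
  ell2 (fun n => (Re (a n))%:C) /\ ell2 (fun n => (Im (a n))%:C).
Proof.
move=> [K hK]; split; exists K => n; apply: le_trans (hK n);
  apply: ler_sum => k _; rewrite /rdot /= mulr0 addr0 -!expr2.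
- by rewrite lerDl sqr_ge0.
- by rewrite lerDr sqr_ge0.
Qed.

(** Riesz-Fischer is applied to the real and imaginary parts of the coefficients separately. Testing
    both sums against the cosine and sine parts of the kernel gives four real series, which
    recombine into the power series of [fn a] at the Cayley image of [s]. *)
Lemma laplace_inverse_exists a : ell2 a -> exists g, L2 mu D g /\
  forall s, 0 < Re s -> laplace g s = U_map (fn a) s.
Proof.
move=> ha; have [har hai] := ell2_reim ha.
have bnd (c : nat -> R) : ell2 (fun n => (c n)%:C) -> exists K, forall N, \sum_(0 <= n < N) c n ^+ 2 <= K.
  move=> [K hK]; exists K => N; apply: le_trans (hK N).
  by apply: ler_sum => k _; rewrite /rdot /= mulr0 addr0 expr2.
have ml n : measurable_fun D (lagf n).
  by apply: measurable_funTS; apply: continuous_measurable_fun; exact: continuous_lagf.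
have rf := @riesz_fischer _ _ R mu D (measurable_itv _) _ ml integrable_lagfM orthonormal_lagf.
have [Kr hKr] := bnd _ har; have [Ki hKi] := bnd _ hai.
have [Gr [mGr iGr hGr]] := rf _ _ hKr; have [Gi [mGi iGi hGi]] := rf _ _ hKi.
exists (fun x => Gr x +i* Gi x); split.
  split => //=.
  have := @integrable_addr _ _ R mu D (measurable_itv _) _ _ iGr iGi => /integrableP[_].
  apply: le_lt_trans; rewrite le_eqVlt; apply/orP; left; apply/eqP.
  apply: eq_integral => x _ /=; rewrite sqr_sqrtr ?addr_ge0 ?sqr_ge0//.
  by rewrite ger0_norm// addr_ge0 ?sqr_ge0.
move=> s s0; have hz := ell2_lag_symbol s0; have [hzr hzi] := ell2_reim hz.
have w1 := cayley_lt1 s0.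
have prod (c e : nat -> R) : ell2 (fun n => (c n)%:C) -> ell2 (fun n => (e n)%:C) ->
    series (fun n => c n * e n) @ \oo --> sdot (fun n => (c n)%:C) (fun n => (e n)%:C).
  move=> hc he; have := cvg_psum hc he.
  rewrite {1}/psum (_ : (fun n => rdot (c n)%:C (e n)%:C) = (fun n => c n * e n))//.
  by apply/funext => n; rewrite /rdot /= mulr0 addr0.
have lc := measurable_ecos s; have ls := measurable_esin s.
have ic := integrable_ecos2 s0; have is_ := integrable_esin2 s0.
have c1 := prod _ _ har hzr; have c2 := prod _ _ hai hzi.
have c3 := prod _ _ har hzi; have c4 := prod _ _ hai hzr.
set l1 := sdot _ _ in c1; set l2 := sdot _ _ in c2; set l3 := sdot _ _ in c3; set l4 := sdot _ _ in c4.
have A1 : (\int[mu]_(x in D) (Gr x * ecos s x))%R = l1.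
  by apply: hGr => //; under eq_fun do rewrite (laplace_lagf _ s0).1.
have A2 : (\int[mu]_(x in D) (Gi x * ecos s x))%R = l4.
  by apply: hGi => //; under eq_fun do rewrite (laplace_lagf _ s0).1.
have serN (u : nat -> R) l : series u @ \oo --> l -> series (fun n => - u n) @ \oo --> - l.
  move=> ul; rewrite (_ : series _ = (fun n => - series u n)); first exact: cvgN.
  by apply/funext => n; rewrite /series /= sumrN.
have A3 : (\int[mu]_(x in D) (Gr x * esin s x))%R = - l3.
  apply: hGr => //; under eq_fun do rewrite (laplace_lagf _ s0).2 mulrN.
  exact: serN.
have A4 : (\int[mu]_(x in D) (Gi x * esin s x))%R = - l2.
  apply: hGi => //; under eq_fun do rewrite (laplace_lagf _ s0).2 mulrN.
  exact: serN.
have irc := @integrable_sq_mul _ _ R mu D (measurable_itv _) _ _ mGr lc iGr ic.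
have irs := @integrable_sq_mul _ _ R mu D (measurable_itv _) _ _ mGr ls iGr is_.
have iic := @integrable_sq_mul _ _ R mu D (measurable_itv _) _ _ mGi lc iGi ic.
have iis := @integrable_sq_mul _ _ R mu D (measurable_itv _) _ _ mGi ls iGi is_.
have -> : laplace (fun x => Gr x +i* Gi x) s = (l1 - l2) +i* (l4 + l3).
  rewrite /laplace /cintegral.
  have -> : (\int[mu]_(x in D) Re ((Gr x +i* Gi x) * cexp (- (s * x%:C))))%R = l1 - l2.
    rewrite -A1 -A4 -RintegralD//; apply: eq_Rintegral => x _.
    by rewrite cexp_ecos /= mulrN opprK.
  have -> // : (\int[mu]_(x in D) Im ((Gr x +i* Gi x) * cexp (- (s * x%:C))))%R = l4 + l3.
  rewrite -A2 -[l3]opprK -A3 -RintegralB//; apply: eq_Rintegral => x _.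
  by rewrite cexp_ecos /= mulrN addrC.
rewrite /U_map /fn w1.
set w := (s - 1) / (s + 1) in w1 *; set k := (Num.sqrt 2)%:C / (1 + s).
have /cvgC[h1 h2] : ((fun n => k * power_series a w n) : nat -> C^o) @ \oo --> (k * evalC a w : C^o).
  by apply: (@cvgMl_tmp C); exact: cvg_power_series.
have kE n : k * power_series a w n =
    (series (fun n => Re (a n) * Re (lag_symbol s n)) n - series (fun n => Im (a n) * Im (lag_symbol s n)) n) +i*
    (series (fun n => Im (a n) * Re (lag_symbol s n)) n + series (fun n => Re (a n) * Im (lag_symbol s n)) n).
  rewrite /power_series /series /=; elim: n => [|n IHn].
    by rewrite !big_geq// mulr0 subr0 addr0.
  rewrite !big_nat_recr//= mulrDr IHn mulrCA -/(lag_symbol s n).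
  case: (a n) (lag_symbol s n) => x y [x' y'].
  by apply/eqP; rewrite eq_complex /=; apply/andP; split; apply/eqP; ring.
apply/eqP; rewrite eq_complex /=; apply/andP; split; apply/eqP.
  apply: (cvg_unique _ (cvgB c1 c2)) => //.
  by move: h1; under eq_fun do rewrite kE.
apply: (cvg_unique _ (cvgD c4 c3)) => //.
by move: h2; under eq_fun do rewrite kE.
Qed.

End laplace_transform.

(** * Changes of variables *)

Section density.
Local Open Scope ereal_scope.
Context d (T : measurableType d) (R : realType).
Variables (m nu : {measure set T -> \bar R}) (w : T -> R).
Hypotheses (mw : measurable_fun setT w) (w0 : forall x, (0 <= w x)%R).
Hypothesis nuE : forall A, measurable A -> nu A = \int[m]_(x in A) (w x)%:E.

Import HBNNSimple.

Let integral_density_nnsfun (f : {nnsfun T >-> R}) :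
  \int[nu]_x (f x)%:E = \int[m]_x ((f x)%:E * (w x)%:E).
Proof.
under eq_integral do rewrite fimfunE -fsumEFin//.
under [RHS]eq_integral => x _.
  rewrite fimfunE -fsumEFin// ge0_mule_fsuml; last first.
    by move=> r; rewrite EFinM nnfun_muleindic_ge0.
  over.
rewrite ge0_integral_fsum//; last 2 first.
- by move=> r; apply/measurable_EFinP/measurable_funM.
- by move=> n x _; rewrite EFinM nnfun_muleindic_ge0.
rewrite [RHS]ge0_integral_fsum//; last 2 first.
- move=> r; apply: emeasurable_funM; apply/measurable_EFinP => //.
  exact: measurable_funM.
- by move=> n x _; rewrite mule_ge0//; [rewrite EFinM nnfun_muleindic_ge0|rewrite lee_fin].
apply: eq_fsbigr => r _; rewrite integralZl_indic_nnsfun//.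
rewrite integral_indic// setIT nuE//.
have [r0|r0] := ltP r 0%R.
  rewrite preimage_nnfun0// integral_set0 mule0 integral0_eq// => x _.
  by rewrite indic0 mulr0 mul0e.
transitivity (r%:E * \int[m]_x ((\1_(f @^-1` [set r]) x)%:E * (w x)%:E)); last first.
  rewrite -ge0_integralZl//.
  - by apply: eq_integral => x _; rewrite muleA EFinM.
  - by apply: emeasurable_funM; apply/measurable_EFinP.
  - by move=> x _; rewrite mule_ge0// lee_fin.
congr (_ * _); rewrite integral_mkcond; apply: eq_integral => x _.
by rewrite patchE indicE; case: ifPn => _; rewrite ?mul1e ?mul0e.
Qed.

Lemma ge0_integral_density (f : T -> \bar R) : measurable_fun setT f ->
  (forall x, 0 <= f x) -> \int[nu]_x f x = \int[m]_x (f x * (w x)%:E).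
Proof.
move=> mf f0; pose f_ := nnsfun_approx measurableT mf.
have cf x : (f_ n x)%:E @[n --> \oo] --> f x by apply: cvg_nnsfun_approx.
have ndf x : {homo (fun n => (f_ n x)%:E) : a b / (a <= b)%N >-> a <= b}.
  by move=> a b ab; rewrite lee_fin; exact/lefP/nd_nnsfun_approx.
transitivity (limn (fun n => \int[nu]_x (f_ n x)%:E)).
  rewrite -monotone_convergence//.
  - by apply: eq_integral => x _; apply/esym/cvg_lim => //.
  - by move=> n; apply/measurable_EFinP.
  - by move=> n x _; rewrite lee_fin.
transitivity (limn (fun n => \int[m]_x ((f_ n x)%:E * (w x)%:E))); last first.
  rewrite -monotone_convergence//.
  - apply: eq_integral => x _; apply/cvg_lim => //.
    by apply: cvgeMr => //.
  - by move=> n; apply: emeasurable_funM; apply/measurable_EFinP.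
  - by move=> n x _; rewrite mule_ge0// lee_fin.
  - by move=> x _ a b ab; rewrite lee_wpmul2r ?lee_fin//; exact: ndf.
by congr (limn _); apply/funext => n; exact: integral_density_nnsfun.
Qed.

End density.

Section change_of_variables.
Context (R : realType).
Local Notation mu := (@lebesgue_measure R).
Local Notation D := (`]0%R, +oo[%classic : set R).

(** The image of Lebesgue measure under a translation has the same values on half-open intervals, so
    uniqueness of Lebesgue measure identifies the two. *)
Lemma ge0_integral_translation (f : R -> \bar R) (t : R) :
  measurable_fun setT f -> (forall x, (0 <= f x)%E) ->
  (\int[mu]_y f (y - t)%R = \int[mu]_y f y)%E.
Proof.
move=> mf f0; pose p (x : R) : measurableTypeR R := x - t.
have mp : measurable_fun setT p by exact: measurable_funB.
have := @ge0_integral_pushforward _ _ (measurableTypeR R) (measurableTypeR R) R p mp mu setT f measurableT mf (fun y _ => f0 y).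
rewrite preimage_setT => <-; apply: eq_measure_integral => A mA _.
pose q : {measure set (measurableTypeR R) -> \bar R} := pushforward mu p.
apply/esym; apply: (@lebesgue_measure_unique R (q mp)) => // _ [[a b] _ <-].
rewrite /q /= /pushforward (_ : p @^-1` _ = `](a + t), (b + t)]%classic); last first.
  by apply/seteqP; split => x; rewrite /p /= !in_itv/= ltrBrDr lerBlDr.
by rewrite !lebesgue_measure_itv/= !lte_fin ltrD2r -!EFinB opprD addrACA subrr addr0.
Qed.

(** The function 1 / x on the positive half-line, written through [expR] and [ln] so that
    measurability and the substitution x = e^y are immediate. *)
Definition inv_pos (x : R) : R := \1_D x * expR (- ln x).

Lemma inv_pos_ge0 x : 0 <= inv_pos x.
Proof. by rewrite mulr_ge0// expR_ge0. Qed.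

Lemma measurable_inv_pos : measurable_fun setT inv_pos.
Proof.
apply: measurable_funM; first exact: measurable_indic.
by apply: measurableT_comp => //; apply: measurableT_comp.
Qed.

(* The measure [dx / x] on the half-line, whose image under [ln] is Lebesgue. *)
Definition haar_pos (A : set (measurableTypeR R)) : \bar R :=
  (\int[mu]_(x in A) (inv_pos x)%:E)%E.

Let haar_pos0 : haar_pos set0 = 0%E.
Proof. by rewrite /haar_pos integral_set0. Qed.

Let haar_pos_ge0 A : (0 <= haar_pos A)%E.
Proof. by apply: integral_ge0 => x _; rewrite lee_fin inv_pos_ge0. Qed.

Let haar_pos_sigma_additive : semi_sigma_additive haar_pos.
Proof.
move=> A mA tA mUA; rewrite /haar_pos ge0_integral_bigcup//=.
- apply: is_cvg_ereal_nneg_natsum_cond => n _ _.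
  by apply: integral_ge0 => y _; rewrite lee_fin inv_pos_ge0.
- apply/measurable_EFinP; exact: measurable_funTS measurable_inv_pos.
- by move=> y _; rewrite lee_fin inv_pos_ge0.
Qed.

HB.instance Definition _ := isMeasure.Build _ _ _
  haar_pos haar_pos0 haar_pos_ge0 haar_pos_sigma_additive.

Lemma haar_pos_itv (a b : R) : a < b -> haar_pos (@ln R @^-1` `]a, b]%classic) = (b - a)%:E.
Proof.
move=> ab; have eab : expR a < expR b by rewrite ltr_expR.
transitivity (\int[mu]_(x in `]expR a, expR b]) (expR (- ln x))%:E)%E.
  rewrite /haar_pos integral_mkcond [RHS]integral_mkcond; apply: eq_integral => x _.
  rewrite !patchE /inv_pos indicE.
  have [x0|x0] := ltP 0 x; last first.
    rewrite (memNset (A := D)); last by rewrite /= in_itv/= andbT; apply/negP; rewrite -leNgt.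
    rewrite mul0r if_same memNset// /= in_itv/=; apply/negP; rewrite negb_and -leNgt.
    by rewrite (le_trans x0 (expR_ge0 _)).
  rewrite (mem_set (A := D)) ?mul1r; last by rewrite /= in_itv/= x0.
  have la : (expR a < x) = (a < ln x) by rewrite -{1}[x]lnK ?posrE// ltr_expR.
  have lb : (x <= expR b) = (ln x <= b) by rewrite -{1}[x]lnK ?posrE// ler_expR.
  by congr (if _ then _ else _); apply/idP/idP; rewrite !inE /= !in_itv/= la lb.
rewrite integral_itv_obnd_cbnd; last first.
  by apply/measurable_EFinP; apply: measurableT_comp => //; apply: measurableT_comp => //; exact: measurable_funTS.
have ge0 x : x \in `[expR a, expR b] -> 0 < x.
  by rewrite in_itv/= => /andP[+ _]; apply: lt_le_trans; exact: expR_gt0.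
rewrite (@continuous_FTC2 R _ (@ln R))//.
- by rewrite !expRK.
- apply: continuous_in_subspaceT => x /[!inE] /ge0 x0.
  apply: continuous_comp; last exact: continuous_expR.
  by apply: continuousN; exact: continuous_ln.
- split.
  + by move=> x /[!in_itv]/= /andP[xa _]; apply: ex_derive; apply: is_derive1_ln; exact: lt_trans (expR_gt0 _) xa.
  + by apply: cvg_at_right_filter; apply: continuous_ln; exact: expR_gt0.
  + by apply: cvg_at_left_filter; apply: continuous_ln; exact: expR_gt0.
- move=> x /[!in_itv]/= /andP[xa _]; have x0 : 0 < x := lt_trans (expR_gt0 _) xa.
  by rewrite derive1E (@derive_val _ _ _ _ _ _ _ (is_derive1_ln x0)) expRN lnK.
Qed.

(** The substitution x = e^y for measurable [f], obtained from measures: the image of dx / x under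
    [ln] agrees with Lebesgue measure on half-open intervals. *)
Lemma ge0_integral_expR (f : R -> \bar R) : measurable_fun setT f ->
  (forall x, (0 <= f x)%E) ->
  (\int[mu]_y (f (expR y) * (expR y)%:E) = \int[mu]_(x in D) f x)%E.
Proof.
move=> mf f0; pose phi y := (f (expR y) * (expR y)%:E)%E.
have mphi : measurable_fun setT phi.
  apply: emeasurable_funM; first exact: measurableT_comp.
  exact/measurable_EFinP.
have phi0 y : (0 <= phi y)%E by rewrite mule_ge0// lee_fin expR_ge0.
have mln : measurable_fun setT (@ln R : R -> measurableTypeR R) by exact: measurable_ln.
pose q : {measure set (measurableTypeR R) -> \bar R} := pushforward haar_pos (@ln R : measurableTypeR R -> measurableTypeR R).
transitivity (\int[q mln]_y phi y)%E.
  apply: eq_measure_integral => A mA _.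
  apply: (@lebesgue_measure_unique R (q mln)) => // _ [[a b] _ <-].
  rewrite /q /= /pushforward; have [ab|ba] := ltP a b.
    by rewrite haar_pos_itv// lebesgue_measure_itv/= lte_fin ab EFinB.
  by rewrite set_itv_ge ?bnd_simp -?leNgt// preimage_set0 !measure0.
have := @ge0_integral_pushforward _ _ (measurableTypeR R) (measurableTypeR R) R (@ln R) mln haar_pos setT phi measurableT mphi (fun y _ => phi0 y).
rewrite preimage_setT => ->.
rewrite (@ge0_integral_density _ _ R mu haar_pos inv_pos measurable_inv_pos inv_pos_ge0)//; first last.
- by move=> x /=.
- exact: measurableT_comp.
rewrite [RHS]integral_mkcond; apply: eq_integral => x _.
rewrite patchE /inv_pos indicE /phi /=; case: ifPn => [|xD]; last by rewrite mul0r mule0.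
rewrite inE /= in_itv/= andbT => x0.
by rewrite lnK// mul1r -muleA -EFinM expRN lnK// mulfV ?gt_eqF// mule1.
Qed.

End change_of_variables.

Section null_sets.
Context (R : realType).
Local Notation mu := (@lebesgue_measure R).
Local Notation D := (`]0%R, +oo[%classic : set R).

Lemma null_translation (A : set R) (t : R) : measurable A -> mu A = 0%E ->
  mu ((fun y => y - t) @^-1` A) = 0%E.
Proof.
move=> mA A0; rewrite -A0.
have mp : measurable_fun setT (fun y : R => y - t) by exact: measurable_funB.
have mB : measurable ((fun y : R => y - t) @^-1` A) by rewrite -[X in measurable X]setTI; exact: mp.
have mA1 : measurable_fun setT (fun x => (\1_A x : R)%:E) by exact/measurable_EFinP/measurable_indic.
have A1 x : (0 <= (\1_A x : R)%:E)%E by rewrite lee_fin.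
transitivity (\int[mu]_y (\1_A (y - t) : R)%:E)%E.
  by rewrite -[X in mu X]setIT -integral_indic.
by rewrite (ge0_integral_translation t mA1 A1) integral_indic// setIT.
Qed.

Lemma null_preimage_expR (A : set R) : measurable A -> mu A = 0%E ->
  mu (@expR R @^-1` A) = 0%E.
Proof.
move=> mA A0.
have mB : measurable (@expR R @^-1` A) by rewrite -[X in measurable X]setTI; exact: measurable_expR.
(* The factor 1 / x cancels the Jacobian e^y of the substitution. *)
pose f (x : R) := ((\1_A x : R) * inv_pos x)%:E.
have mf : measurable_fun setT f.
  by apply/measurable_EFinP/measurable_funM; [exact: measurable_indic|exact: measurable_inv_pos].
have f0 x : (0 <= f x)%E by rewrite lee_fin mulr_ge0// inv_pos_ge0.
transitivity (\int[mu]_y (f (expR y) * (expR y)%:E))%E.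
  rewrite -[X in mu X]setIT -integral_indic//; apply: eq_integral => y _.
  rewrite /f /inv_pos (_ : \1_D (expR y) = 1); last by rewrite indicE mem_set//= in_itv/= expR_gt0.
  by rewrite -EFinM mul1r expRK -mulrA -expRD addNr expR0 mulr1.
rewrite ge0_integral_expR//; apply/eqP; rewrite eq_le integral_ge0// andbT.
apply: (@le_trans _ _ (\int[mu]_x f x)%E); first by apply: ge0_subset_integral.
rewrite (_ : (\int[mu]_x f x)%E = (\int[mu]_(x in A) f x)%E).
  by rewrite null_set_integral//; exact: measurable_funTS.
rewrite [RHS]integral_mkcond; apply: eq_integral => x _.
by rewrite patchE /f indicE; case: (x \in A) => //; rewrite mul0r.
Qed.

Lemma null_preimage_ln (B : set R) : measurable B -> mu B = 0%E ->
  mu (D `&` @ln R @^-1` B) = 0%E.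
Proof.
move=> mB B0.
have mA : measurable (@ln R @^-1` B) by rewrite -[X in measurable X]setTI; exact: measurable_ln.
have mf : measurable_fun setT (fun x : R => (\1_(@ln R @^-1` B) x : R)%:E).
  exact/measurable_EFinP/measurable_indic.
rewrite setIC -integral_indic// -ge0_integral_expR//.
transitivity (\int[mu]_(y in B) (expR y)%:E)%E.
  rewrite [RHS]integral_mkcond; apply: eq_integral => y _.
  rewrite patchE indicE -EFinM; have -> : (expR y \in @ln R @^-1` B) = (y \in B).
    by apply/idP/idP; rewrite !inE /= expRK.
  by case: (y \in B); rewrite ?mul1r ?mul0r.
by rewrite null_set_integral//; apply/measurable_EFinP/measurable_funTS.
Qed.

Lemma ae_translation (P : R -> Prop) (t : R) :
  {ae mu, forall x, P x} -> {ae mu, forall y, P (y - t)}.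
Proof.
move=> [A [mA A0 PA]]; exists ((fun y => y - t) @^-1` A); split.
- by rewrite -[X in measurable X]setTI; apply: measurable_funB.
- exact: null_translation.
- by move=> y /= nP; apply: PA.
Qed.

Lemma ae_expR (P : R -> Prop) :
  {ae mu, forall x, 0 < x -> P x} -> {ae mu, forall y, P (expR y)}.
Proof.
move=> [A [mA A0 PA]]; exists (@expR R @^-1` A); split.
- by rewrite -[X in measurable X]setTI; exact: measurable_expR.
- exact: null_preimage_expR.
- by move=> y /= nP; apply: PA => /= h; apply: nP; apply: h; exact: expR_gt0.
Qed.

Lemma ae_ln (P : R -> Prop) :
  {ae mu, forall y, P (expR y)} -> {ae mu, forall x, 0 < x -> P x}.
Proof.
move=> [B [mB B0 PB]]; exists (D `&` @ln R @^-1` B); split.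
- by apply: measurableI => //; rewrite -[X in measurable X]setTI; exact: measurable_ln.
- exact: null_preimage_ln.
- move=> x /= /not_implyP[x0 nP]; split; first by rewrite /= in_itv/= x0.
  by apply: PB; rewrite /= lnK.
Qed.

Lemma weight_gt0 (y : R) : 0 < weight y.
Proof. exact: expR_gt0. Qed.

Lemma ge0_integral_weighted (f : R -> \bar R) : measurable_fun setT f ->
  (forall x, (0 <= f x)%E) ->
  (\int[@weighted_lebesgue R]_x f x = \int[mu]_x (f x * (weight x)%:E))%E.
Proof.
move=> mf f0; apply: (@ge0_integral_density _ _ R mu (@weighted_lebesgue R) weight) => //.
- exact: measurable_weight.
- by move=> x; apply: ltW; exact: weight_gt0.
Qed.

Lemma ae_weighted (P : R -> Prop) :
  {ae @weighted_lebesgue R, forall y, P y} <-> {ae mu, forall y, P y}.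
Proof.
split=> -[A [mA A0 PA]]; exists A; split => //; last first.
  rewrite /weighted_lebesgue null_set_integral//.
  by apply/measurable_EFinP/measurable_funTS; exact: measurable_weight.
(* The indicator divided by the weight: its weighted integral is the Lebesgue measure of [A]. *)
pose f (x : R) := ((\1_A x : R) * (expR (- (- 2 * (expR x - 1)))))%:E.
have mf : measurable_fun setT f.
  apply/measurable_EFinP/measurable_funM; first exact: measurable_indic.
  apply: measurableT_comp => //; apply: measurableT_comp => //.
  by apply: measurable_funM => //; exact: measurable_funB.
have f0 x : (0 <= f x)%E by rewrite lee_fin mulr_ge0// expR_ge0.
rewrite -[X in mu X]setIT -integral_indic//.
transitivity (\int[@weighted_lebesgue R]_x f x)%E.
  rewrite ge0_integral_weighted//; apply: eq_integral => x _.
  by rewrite -EFinM -mulrA -expRD addNr expR0 mulr1.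
rewrite (_ : (\int[@weighted_lebesgue R]_x f x)%E = (\int[@weighted_lebesgue R]_(x in A) f x)%E).
  by rewrite null_set_integral//; exact: measurable_funTS.
rewrite [RHS]integral_mkcond; apply: eq_integral => x _.
by rewrite patchE /f indicE; case: (x \in A) => //; rewrite mul0r.
Qed.

End null_sets.

Section scaling.
Context (R : realType).
Local Notation C := R[i].
Local Notation mu := (@lebesgue_measure R).
Local Notation D := (`]0%R, +oo[%classic : set R).
Local Notation E x := (expR (- x)).

(** In the variable y = ln x a dilation is a translation; the factor e^t appears when e^y is
    rewritten as e^t e^{y-t}. *)
Lemma ge0_integral_scaling (f : R -> \bar R) (t : R) :
  measurable_fun setT f -> (forall x, (0 <= f x)%E) ->
  (\int[mu]_(x in D) f (E t * x)%R = (expR t)%:E * \int[mu]_(x in D) f x)%E.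
Proof.
move=> mf f0; have msc : measurable_fun setT (fun x : R => E t * x) by exact: measurable_funM.
rewrite -ge0_integral_expR//; last exact: measurableT_comp.
pose phi (y : R) := ((expR t)%:E * (f (expR y) * (expR y)%:E))%E.
have mfe : measurable_fun setT (fun y => f (expR y) * (expR y)%:E)%E.
  apply: emeasurable_funM; first exact: measurableT_comp.
  exact/measurable_EFinP.
have fe0 y : (0 <= f (expR y) * (expR y)%:E)%E by rewrite mule_ge0// lee_fin expR_ge0.
have mphi : measurable_fun setT phi by exact: measurable_funeM.
have phi0 y : (0 <= phi y)%E by rewrite mule_ge0// lee_fin expR_ge0.
transitivity (\int[mu]_y phi y)%E.
  rewrite -(ge0_integral_translation t mphi phi0); apply: eq_integral => y _.
  by rewrite /phi muleCA -EFinM -!expRD (addrC t) subrK (addrC (- t)).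
rewrite /phi ge0_integralZl// ?lee_fin ?expR_ge0//.
by rewrite ge0_integral_expR.
Qed.

Lemma Rintegral_scaling (f : R -> R) (t : R) : mu.-integrable D (EFin \o f) ->
  (\int[mu]_(x in D) f (E t * x) = expR t * \int[mu]_(x in D) f x)%R.
Proof.
move=> iF; pose F : R -> \bar R := (EFin \o f) \_ D.
have mF : measurable_fun setT F by apply/(measurable_restrictT _ _).1 => //; exact: (measurable_int mu iF).
have FE x : D x -> F x = (f x)%:E by move=> Dx; rewrite /F patchE mem_set.
have iF' : mu.-integrable D F by apply: eq_integrable iF => // x /[!inE] Dx /=; rewrite FE.
have Dsc x : D x -> D (E t * x) by rewrite /= !in_itv/= !andbT => x0; rewrite mulr_gt0// expR_gt0.
rewrite /Rintegral -[expR t]/(fine (expR t)%:E) -fineM//; last exact: integrable_fin_num.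
congr fine; transitivity (\int[mu]_(x in D) F (E t * x)%R)%E.
  by apply: eq_integral => x /[!inE] Dx; rewrite FE//; exact: Dsc.
transitivity ((expR t)%:E * \int[mu]_(x in D) F x)%E; last first.
  by congr (_ * _)%E; apply: eq_integral => x /[!inE] Dx; rewrite FE.
rewrite integralE [in RHS]integralE muleBr//; last first.
  by apply: fin_num_adde_defr; exact: integrable_pos_fin_num.
congr (_ - _)%E.
- have mp : measurable_fun setT (F^\+)%E by exact: measurable_funepos.
  by rewrite -(@ge0_integral_scaling _ t mp)//; apply: eq_integral => x _; rewrite !funeposE.
- have mn : measurable_fun setT (F^\-)%E by exact: measurable_funeneg.
  by rewrite -(@ge0_integral_scaling _ t mn)//; apply: eq_integral => x _; rewrite !funenegE.
Qed.

Lemma L2_reim (g : R -> C) : L2 mu D g ->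
  [/\ measurable_fun D (fun x => Re (g x)), measurable_fun D (fun x => Im (g x)),
      mu.-integrable D (EFin \o (fun x => Re (g x) ^+ 2)) &
      mu.-integrable D (EFin \o (fun x => Im (g x) ^+ 2))].
Proof.
move=> [mr mi fi].
have i2 : mu.-integrable D (EFin \o (fun x => Re (g x) ^+ 2 + Im (g x) ^+ 2)).
  apply/integrableP; split.
    by apply/measurable_EFinP/measurable_funD; apply: measurable_funX.
  apply: le_lt_trans fi; rewrite le_eqVlt; apply/orP; left; apply/eqP.
  apply: eq_integral => x _ /=; rewrite -rdot_normc /rdot -!expr2 ger0_norm//.
  by rewrite addr_ge0 ?sqr_ge0.
split => //; apply: (@integrable_le _ _ R mu D (measurable_itv _) _ _ _ i2);
  try by apply: measurable_funX.
- by move=> x _; rewrite ger0_norm ?sqr_ge0// lerDl sqr_ge0.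
- by move=> x _; rewrite ger0_norm ?sqr_ge0// lerDr sqr_ge0.
Qed.

Lemma Re_laplace_integrand (g : R -> C) (s : C) (x : R) :
  Re (g x * cexp (- (s * x%:C))) = Re (g x) * ecos s x + Im (g x) * esin s x.
Proof. by rewrite cexp_ecos; case: (g x) => a b /=; rewrite mulrN opprK. Qed.

Lemma Im_laplace_integrand (g : R -> C) (s : C) (x : R) :
  Im (g x * cexp (- (s * x%:C))) = Im (g x) * ecos s x - Re (g x) * esin s x.
Proof. by rewrite cexp_ecos; case: (g x) => a b /=; rewrite mulrN addrC. Qed.

Lemma integrable_laplace (g : R -> C) (s : C) : L2 mu D g -> 0 < Re s ->
  mu.-integrable D (EFin \o (fun x => Re (g x * cexp (- (s * x%:C))))) /\
  mu.-integrable D (EFin \o (fun x => Im (g x * cexp (- (s * x%:C))))).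
Proof.
move=> /L2_reim[mr mi ir ii] s0.
have lc := measurable_ecos s; have ls := measurable_esin s.
have ic := integrable_ecos2 s0; have is_ := integrable_esin2 s0.
have irc := @integrable_sq_mul _ _ R mu D (measurable_itv _) _ _ mr lc ir ic.
have irs := @integrable_sq_mul _ _ R mu D (measurable_itv _) _ _ mr ls ir is_.
have iic := @integrable_sq_mul _ _ R mu D (measurable_itv _) _ _ mi lc ii ic.
have iis := @integrable_sq_mul _ _ R mu D (measurable_itv _) _ _ mi ls ii is_.
split.
  rewrite (funext (Re_laplace_integrand g s)).
  exact: (@integrable_addr _ _ R mu D (measurable_itv _)).
rewrite (funext (Im_laplace_integrand g s)).
have -> : (fun x => Im (g x) * ecos s x - Re (g x) * esin s x) =
  (fun x => Im (g x) * ecos s x + (-1) * (Re (g x) * esin s x)).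
  by apply/funext => x; rewrite mulN1r.
apply: (@integrable_addr _ _ R mu D (measurable_itv _)) => //.
exact: integrableZl_EFin.
Qed.

(** With s' = e^t s + e^t - 1 one has s' e^{-t} x = s x + (1 - e^{-t}) x, so the exponential damping
    and the dilation together replace [s] by its image under the affine map of the right
    half-plane. *)
Lemma laplace_scaling (g : R -> C) (t : R) (c : R) (s : C) : L2 mu D g -> 0 <= t -> 0 < Re s ->
  laplace (fun x => (c * E ((1 - E t) * x))%:C * g (E t * x)) s =
  (c * expR t)%:C * laplace g ((expR t)%:C * s + (expR t)%:C - 1).
Proof.
move=> hg t0 s0; set s' := (expR t)%:C * s + (expR t)%:C - 1.
have t1 : 1 <= expR t by rewrite -expR0 ler_expR.
have s'0 : 0 < Re s'.
  rewrite /s'; case: (s) s0 => a b /= a0; rewrite mul0r subr0 -addrA ltr_wpDr ?subr_ge0//.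
  by rewrite mulr_gt0// expR_gt0.
have [ir ii] := integrable_laplace hg s'0.
have gen (p q r u v : R) (w : C) : p * q = 1 ->
    (c * p)%:C * w * ((r * q * u) -i* (r * q * v)) = c%:C * (w * ((r * u) -i* (r * v))).
  case: w => a b h; apply/eqP; rewrite eq_complex /=; apply/andP; split; apply/eqP.
    transitivity ((p * q) * (c * (a * (r * u) + b * (r * v)))); first by ring.
    by rewrite h; ring.
  transitivity ((p * q) * (c * (b * (r * u) - a * (r * v)))); first by ring.
  by rewrite h; ring.
have EE x : (c * E ((1 - E t) * x))%:C * g (E t * x) * cexp (- (s * x%:C)) =
    c%:C * (g (E t * x) * cexp (- (s' * (E t * x)%:C))).
  rewrite !cexp_ecos /ecos /esin.
  have -> : Im s' * (E t * x) = Im s * x.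
    rewrite /s'; case: (s) => a b /=; rewrite mul0r !addr0 subr0 mulrACA.
    by rewrite -expRD subrr expR0 mul1r.
  have -> : E (Re s * x) = E (Re s' * (E t * x)) * expR ((1 - E t) * x).
    rewrite -expRD; congr expR; rewrite /s'; case: (s) => a b /=; rewrite mul0r subr0.
    have h : expR t * E t = 1 by rewrite -expRD subrr expR0.
    by transitivity (- (expR t * E t * (a + 1) * x) + x); [rewrite h; ring|ring].
  by apply: gen; rewrite -expRD addNr expR0.
pose F x := g x * cexp (- (s' * x%:C)).
rewrite /laplace /cintegral.
have -> : (\int[mu]_(x in D) Re ((c * E ((1 - E t) * x))%:C * g (E t * x) * cexp (- (s * x%:C))))%R =
    (\int[mu]_(x in D) (fun y => c * Re (F y)) (E t * x))%R.
  by apply: eq_Rintegral => x _; rewrite EE -/(F _); case: (F _) => a b /=; rewrite mul0r subr0.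
have -> : (\int[mu]_(x in D) Im ((c * E ((1 - E t) * x))%:C * g (E t * x) * cexp (- (s * x%:C))))%R =
    (\int[mu]_(x in D) (fun y => c * Im (F y)) (E t * x))%R.
  by apply: eq_Rintegral => x _; rewrite EE -/(F _); case: (F _) => a b /=; rewrite mul0r addr0.
rewrite (@Rintegral_scaling (fun y => c * Re (F y)))//; last exact: integrableZl_EFin.
rewrite (@Rintegral_scaling (fun y => c * Im (F y)))//; last exact: integrableZl_EFin.
rewrite !RintegralZl// /F; apply/eqP; rewrite eq_complex /=.
by apply/andP; split; apply/eqP; ring.
Qed.

End scaling.

(** * Dilations and shifts *)

Section transform.
Context (R : realType).
Local Notation C := R[i].
Local Notation mu := (@lebesgue_measure R).
Local Notation D := (`]0%R, +oo[%classic : set R).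
Local Notation E x := (expR (- x)).

Lemma ae_impl2 (P Q S : R -> Prop) : {ae mu, forall x, P x} ->
  {ae mu, forall x, Q x} -> (forall x, P x -> Q x -> S x) -> {ae mu, forall x, S x}.
Proof.
move=> hP hQ PQS; have F := ae_filter_ringOfSetsType mu.
by apply: filterS (filterI hP hQ) => x [Px Qx]; exact: PQS.
Qed.

Let node (k : nat) : C := (k.+1%:R)%:C.

Let node_gt0 k : 0 < Re (node k).
Proof. by rewrite /= ltr0n. Qed.

Let ecos_node k (x : R) : ecos (node k) x = E (k.+1%:R * x).
Proof. by rewrite /ecos /= mul0r cos0 mulr1. Qed.

(** The functions are only square integrable, whereas [lerch] asks for integrability. One factor
    e^{-x} is spent on that, which is why the nodes start at 1. *)
Lemma laplace_nodes_inj (u v : R -> R) :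
  measurable_fun D u -> measurable_fun D v ->
  mu.-integrable D (EFin \o (fun x => u x ^+ 2)) ->
  mu.-integrable D (EFin \o (fun x => v x ^+ 2)) ->
  (forall k, (\int[mu]_(x in D) (u x * ecos (node k) x))%R =
             (\int[mu]_(x in D) (v x * ecos (node k) x))%R) ->
  {ae mu, forall x, 0 < x -> u x = v x}.
Proof.
move=> mu' mv iu iv h.
have iU k := @integrable_sq_mul _ _ R mu D (measurable_itv _) _ _ mu' (measurable_ecos (node k)) iu (integrable_ecos2 (node_gt0 k)).
have iV k := @integrable_sq_mul _ _ R mu D (measurable_itv _) _ _ mv (measurable_ecos (node k)) iv (integrable_ecos2 (node_gt0 k)).
pose w x := u x * ecos (node 0) x - v x * ecos (node 0) x.
have iw : mu.-integrable D (EFin \o w).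
  rewrite (_ : w = fun x => u x * ecos (node 0) x + (-1) * (v x * ecos (node 0) x)); last first.
    by apply/funext => x; rewrite mulN1r.
  apply: (@integrable_addr _ _ R mu D (measurable_itv _)) => //.
  exact: integrableZl_EFin.
have w0 : {ae mu, forall x, 0 < x -> w x = 0}.
  apply: lerch => // k.
  transitivity (\int[mu]_(x in D) (u x * ecos (node k) x - v x * ecos (node k) x))%R.
    apply: eq_Rintegral => x _; rewrite /w !ecos_node.
    have -> : E (k.+1%:R * x) = E (1%:R * x) * E (k%:R * x).
      by rewrite -expRD -natr1; congr expR; ring.
    by ring.
  by rewrite RintegralB// h subrr.
have F := ae_filter_ringOfSetsType mu.
apply: filterS w0 => x /[apply]; rewrite /w -mulrBl => /eqP; rewrite mulf_eq0 ecos_node.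
by rewrite [X in _ || X]gt_eqF ?expR_gt0// orbF subr_eq0 => /eqP.
Qed.

Lemma laplace_inj (g g' : R -> C) : L2 mu D g -> L2 mu D g' ->
  (forall s, 0 < Re s -> laplace g s = laplace g' s) ->
  {ae mu, forall x, 0 < x -> g x = g' x}.
Proof.
move=> /L2_reim[mr mi ir ii] /L2_reim[mr' mi' ir' ii'] h.
have esin0 k x : esin (node k) x = 0 :> R by rewrite /esin /= mul0r sin0 mulr0.
have reE (a : R -> C) k : Re (laplace a (node k)) = (\int[mu]_(x in D) (Re (a x) * ecos (node k) x))%R.
  by apply: eq_Rintegral => x _; rewrite Re_laplace_integrand esin0 mulr0 addr0.
have imE (a : R -> C) k : Im (laplace a (node k)) = (\int[mu]_(x in D) (Im (a x) * ecos (node k) x))%R.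
  by apply: eq_Rintegral => x _; rewrite Im_laplace_integrand esin0 mulr0 subr0.
have hr : {ae mu, forall x, 0 < x -> Re (g x) = Re (g' x)}.
  by apply: laplace_nodes_inj => // k; rewrite -!reE h.
have hi : {ae mu, forall x, 0 < x -> Im (g x) = Im (g' x)}.
  by apply: laplace_nodes_inj => // k; rewrite -!imE h.
apply: ae_impl2 hr hi _ => x hr hi x0.
by apply/eqP; rewrite eq_complex hr// hi// !eqxx.
Qed.

Lemma ae_eq_laplace (g g' : R -> C) (s : C) : L2 mu D g -> L2 mu D g' ->
  {ae mu, forall x, 0 < x -> g x = g' x} -> 0 < Re s -> laplace g s = laplace g' s.
Proof.
move=> hg hg' gg s0; have [ir ii] := integrable_laplace hg s0.
have [ir' ii'] := integrable_laplace hg' s0.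
have F := ae_filter_ringOfSetsType mu.
rewrite /laplace /cintegral; congr (_ +i* _); rewrite /Rintegral; congr fine.
- apply: ae_eq_integral => //; [exact: (measurable_int mu ir)|exact: (measurable_int mu ir')|].
  by apply: filterS gg => x h; rewrite /= in_itv/= andbT => /h ->.
- apply: ae_eq_integral => //; [exact: (measurable_int mu ii)|exact: (measurable_int mu ii')|].
  by apply: filterS gg => x h; rewrite /= in_itv/= andbT => /h ->.
Qed.

(** [laplace_inv] is a choice, so its specification follows from the existence of one inverse. *)
Lemma laplace_invP (f : C -> C) : H2D f ->
  L2 mu D (laplace_inv (U_map f)) /\
  forall s, 0 < Re s -> laplace (laplace_inv (U_map f)) s = U_map f s.
Proof.
move=> /H2D_coef[ha ->]; have [g hg] := laplace_inverse_exists ha.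
pose S := [set g | L2 mu D g /\
  forall s : C, 0 < Re s -> laplace g s = U_map (fn (coef f)) s].
have Sg : S g by [].
exact: (xgetI (fun=> 0) Sg).
Qed.

(** The Cayley map conjugates the affine self-map of the disc to that of the half-plane; the factor
    e^t comes from 1 + (e^t s + e^t - 1) = e^t (1 + s). *)
Lemma U_map_comp_disc (f : C -> C) (t : R) (s : C) : 0 <= t -> 0 < Re s ->
  U_map (comp_disc t f) s =
  (expR t)%:C * U_map f ((expR t)%:C * s + (expR t)%:C - 1).
Proof.
move=> t0 s0; rewrite /U_map /comp_disc cayley_lt1//.
set p := (expR t)%:C.
have p0 : p != 0 by rewrite eq_complex /= eqxx andbT gt_eqF ?expR_gt0.
have -> : (E t)%:C = p^-1 :> C by rewrite expRN fmorphV.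
have s1 : s + 1 != 0.
  by case: s s0 => x y /= x0; rewrite eq_complex /= negb_and gt_eqF// addr_gt0.
have -> : 1 + (p * s + p - 1) = p * (1 + s) by ring.
have -> : p^-1 * ((s - 1) / (s + 1)) + 1 - p^-1 = (p * s + p - 1 - 1) / (p * s + p - 1 + 1).
  have -> : p * s + p - 1 + 1 = p * (s + 1) by ring.
  by field; rewrite s1 p0.
have s1' : 1 + s != 0 by rewrite addrC.
by field; rewrite s1' p0.
Qed.

(** A point [z] of the disc is the Cayley image of s = (1 + z) / (1 - z), whose real part is (1 -
    |z|^2) / |1 - z|^2. *)
Lemma H2D_U_map_inj (f f' : C -> C) :
  (forall s, 0 < Re s -> U_map f s = U_map f' s) ->
  (forall z, ~~ (`|z| < 1) -> f z = f' z) -> f = f'.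
Proof.
move=> h h0; apply/funext => z; have [z1|/h0//] := boolP (`|z| < 1).
have z10 : 1 - z != 0.
  by rewrite subr_eq0; apply: contraTneq z1 => <-; rewrite normr1 ltxx.
pose s := (1 + z) / (1 - z).
have s0 : 0 < Re s.
  have dz : 0 < rdot (1 - z) (1 - z).
    rewrite rdot_normc exprn_gt0// lt_def normc_ge0 andbT.
    by apply: contra z10 => /eqP/ComplexField.Normc.eq0_normc ->.
  rewrite -(pmulr_rgt0 _ dz); move: z1 dz; rewrite lt1_normc.
  rewrite -(@ltr_pXn2r _ 2) ?nnegrE ?normc_ge0// expr1n -rdot_normc => z1 dz.
  have -> : rdot (1 - z) (1 - z) * Re s = 1 - rdot z z.
    have : s * (1 - z) = 1 + z by rewrite /s divfK.
    case: (s) (z) => a b [x y] /eqP; rewrite eq_complex /rdot /= => /andP[/eqP h1 /eqP h2].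
    transitivity ((1 - x) * (a * (1 - x) - b * (0 - y)) - y * (a * (0 - y) + b * (1 - x))); first by ring.
    by rewrite h1 h2; ring.
  by rewrite subr_gt0.
have s1 : s + 1 = 2 / (1 - z) by rewrite /s; field.
have s10 : 1 + s != 0.
  by rewrite addrC s1 mulf_neq0 ?invr_eq0// pnatr_eq0.
have sz : (s - 1) / (s + 1) = z.
  by rewrite s1 /s; field; rewrite z10.
have := h s s0; rewrite /U_map sz => /mulfI; apply.
rewrite mulf_neq0 ?invr_eq0//.
by rewrite eq_complex /= eqxx andbT gt_eqF// sqrtr_gt0.
Qed.

End transform.

Section dilation.
Context (R : realType).
Local Notation C := R[i].
Local Notation mu := (@lebesgue_measure R).
Local Notation D := (`]0%R, +oo[%classic : set R).
Local Notation E x := (expR (- x)).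

Lemma normc_realM (c : R) (z : C) : normc (c%:C * z) ^+ 2 = c ^+ 2 * normc z ^+ 2.
Proof. by rewrite -!rdot_normc; case: z => x y; rewrite /rdot /=; ring. Qed.

Lemma measurable_normc_sq d (T : measurableType d) (A : set T) (g : T -> C) :
  measurable_fun A (fun x => Re (g x)) -> measurable_fun A (fun x => Im (g x)) ->
  measurable_fun A (fun x => (normc (g x) ^+ 2)%:E).
Proof.
move=> mr mi; apply/measurable_EFinP; under eq_fun do rewrite -rdot_normc /rdot.
by apply: measurable_funD; apply: measurable_funM.
Qed.

Lemma Re_realM (c : R) (z : C) : Re (c%:C * z) = c * Re z.
Proof. by case: z => x y /=; rewrite mul0r subr0. Qed.

Lemma Im_realM (c : R) (z : C) : Im (c%:C * z) = c * Im z.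
Proof. by case: z => x y /=; rewrite mul0r addr0. Qed.

(* The semigroup on [L^2(0, +oo)] that becomes [e^{-t/2} C_{phi_t}] under
   [U^-1 L] and the right shift under [W T^-1]. *)
Definition dilation (t : R) (g : R -> C) (x : R) : C :=
  (E (t / 2) * E ((1 - E t) * x))%:C * g (E t * x).

Lemma L2_dilation (t : R) (g : R -> C) : 0 <= t -> L2 mu D g -> L2 mu D (dilation t g).
Proof.
move=> t0 [mr mi fi].
have mc : measurable_fun D (fun x : R => E (t / 2) * E ((1 - E t) * x)).
  apply: measurable_funTS; apply: measurable_funM => //.
  by apply: measurableT_comp => //; apply: measurableT_comp => //; exact: measurable_funM.
have ms : measurable_fun D (fun x : R => E t * x).
  by apply: measurable_funTS; exact: measurable_funM.
have sD : [set E t * x | x in D] `<=` D.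
  by move=> _ [x /= + <-]; rewrite !in_itv/= !andbT => x0; rewrite mulr_gt0// expR_gt0.
have mR : measurable_fun D (fun x => Re (dilation t g x)).
  rewrite (_ : (fun x => _) = fun x => E (t / 2) * E ((1 - E t) * x) * Re (g (E t * x))).
    by apply: measurable_funM => //; exact: (measurable_comp (measurable_itv _) sD mr ms).
  by apply/funext => x; exact: Re_realM.
have mI : measurable_fun D (fun x => Im (dilation t g x)).
  rewrite (_ : (fun x => _) = fun x => E (t / 2) * E ((1 - E t) * x) * Im (g (E t * x))).
    by apply: measurable_funM => //; exact: (measurable_comp (measurable_itv _) sD mi ms).
  by apply/funext => x; exact: Im_realM.
split => //.
pose G : R -> \bar R := (fun x => (normc (g x) ^+ 2)%:E) \_ D.
have mG : measurable_fun setT G.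
  by apply/(measurable_restrictT _ _).1 => //; exact: measurable_normc_sq.
have G0 x : (0 <= G x)%E by rewrite /G patchE; case: ifP => // _; rewrite lee_fin sqr_ge0.
have GE x : D x -> G x = (normc (g x) ^+ 2)%:E by move=> Dx; rewrite /G patchE mem_set.
apply: (@le_lt_trans _ _ (\int[mu]_(x in D) G (E t * x)%R)%E); last first.
  rewrite ge0_integral_scaling// lte_mul_pinfty ?lee_fin ?expR_ge0//.
  by under eq_integral => x /[!inE] Dx do rewrite GE//.
apply: ge0_le_integral => //.
- by move=> x _; rewrite lee_fin sqr_ge0.
- exact: measurable_normc_sq.
- exact: (measurable_comp measurableT _ mG ms).
move=> x Dx; rewrite GE; last by apply: sD; exists x.
rewrite lee_fin /dilation normc_realM ler_piMl ?sqr_ge0// exprn_ile1//.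
have x0 : 0 < x by move: Dx; rewrite /= in_itv/= andbT.
have [_ E1] := andP (expRN01 t0).
rewrite -expRD -[leRHS]expR0 ler_expR -opprD oppr_le0 addr_ge0 ?divr_ge0//.
by rewrite mulr_ge0 ?subr_ge0// ltW.
Qed.

Lemma laplace_dilation (t : R) (f : C -> C) (s : C) : 0 <= t -> H2D f -> 0 < Re s ->
  laplace (dilation t (laplace_inv (U_map f))) s =
  U_map (fun z => (E (t / 2))%:C * comp_disc t f z) s.
Proof.
move=> t0 Hf s0; have [hg hl] := laplace_invP Hf.
have -> : U_map (fun z => (E (t / 2))%:C * comp_disc t f z) s =
    (E (t / 2))%:C * U_map (comp_disc t f) s by rewrite /U_map mulrCA.
rewrite U_map_comp_disc// /dilation laplace_scaling// hl.
  by rewrite rmorphM mulrA.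
have t1 : 1 <= expR t by rewrite -expR0 ler_expR.
case: (s) s0 => a b /= a0; rewrite mul0r subr0 -addrA ltr_wpDr ?subr_ge0//.
by rewrite mulr_gt0// expR_gt0.
Qed.

(** The exponents balance: e^y - 1 + y/2, less t/2 and (1 - e^{-t}) e^y, is e^{y-t} - 1 + (y -
    t)/2. *)
Lemma W_T_dilation (t : R) (g : R -> C) (y : R) :
  W_map (T_inv (dilation t g)) y = W_map (T_inv g) (y - t).
Proof.
have ey : E t * expR y = expR (y - t) by rewrite -expRD addrC.
rewrite /W_map /T_inv /dilation ey !mulrA -!rmorphM -!expRD.
congr ((expR _)%:C * _); rewrite mulrBl mul1r ey.
by field.
Qed.

Lemma W_T_inj (g g' : R -> C) (y : R) :
  W_map (T_inv g) y = W_map (T_inv g') y -> g (expR y) = g' (expR y).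
Proof.
have e0 (x : R) : (expR x)%:C != 0 :> C by rewrite eq_complex /= eqxx andbT gt_eqF ?expR_gt0.
by move=> /(mulfI (e0 _)) /(mulfI (e0 _)).
Qed.

(** The weight cancels the square of the factor of [W_map]; what remains of the square of the factor
    of [T_inv] is e^y, the Jacobian of x = e^y. *)
Lemma L2_W_T (g : R -> C) : L2 mu D g -> L2 (@weighted_lebesgue R) setT (W_map (T_inv g)).
Proof.
move=> [mr mi fi].
have sD : [set expR y | y in [set: R]] `<=` D.
  by move=> _ [y _ <-]; rewrite /= in_itv/= andbT expR_gt0.
have me : measurable_fun setT (@expR R) by exact: measurable_expR.
have WE y : W_map (T_inv g) y = (expR (expR y - 1) * expR (y / 2))%:C * g (expR y).
  by rewrite /W_map /T_inv mulrA -rmorphM.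
have mc : measurable_fun setT (fun y : R => expR (expR y - 1) * expR (y / 2)).
  apply: measurable_funM; apply: measurableT_comp => //; last exact: measurable_funM.
  exact: measurable_funB.
have mR : measurable_fun setT (fun y => Re (W_map (T_inv g) y)).
  rewrite (_ : (fun y => _) = fun y => expR (expR y - 1) * expR (y / 2) * Re (g (expR y))); last first.
    by apply/funext => y; rewrite WE Re_realM.
  by apply: measurable_funM => //; exact: (measurable_comp (measurable_itv _) sD mr me).
have mI : measurable_fun setT (fun y => Im (W_map (T_inv g) y)).
  rewrite (_ : (fun y => _) = fun y => expR (expR y - 1) * expR (y / 2) * Im (g (expR y))); last first.
    by apply/funext => y; rewrite WE Im_realM.
  by apply: measurable_funM => //; exact: (measurable_comp (measurable_itv _) sD mi me).
split => //.
rewrite ge0_integral_weighted//; last 2 first.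
- exact: measurable_normc_sq.
- by move=> x; rewrite lee_fin sqr_ge0.
pose G : R -> \bar R := (fun x => (normc (g x) ^+ 2)%:E) \_ D.
have mG : measurable_fun setT G.
  by apply/(measurable_restrictT _ _).1 => //; exact: measurable_normc_sq.
have G0 x : (0 <= G x)%E by rewrite /G patchE; case: ifP => // _; rewrite lee_fin sqr_ge0.
have GE x : D x -> G x = (normc (g x) ^+ 2)%:E by move=> Dx; rewrite /G patchE mem_set.
rewrite (_ : (\int[mu]_x _)%E = (\int[mu]_y (G (expR y) * (expR y)%:E))%E).
  rewrite ge0_integral_expR//.
  by under eq_integral => x /[!inE] Dx do rewrite GE//.
apply: eq_integral => y _; rewrite GE; last by apply: sD; exists y.
rewrite -!EFinM WE normc_realM; congr EFin; rewrite /weight.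
rewrite -expRD expr2 -expRD mulrAC -expRD mulrC; congr (_ * expR _).
by field.
Qed.

(** The weight is decreasing, so right shifts do not increase the weighted norm. *)
Lemma weight_translation (t y : R) : 0 <= t -> weight y <= weight (y - t).
Proof.
move=> t0; rewrite /weight ler_expR !mulNr lerN2 ler_pM2l// lerB// ler_expR.
by rewrite gerBl.
Qed.

Lemma L2_right_shift (t : R) (h : R -> C) : 0 <= t ->
  L2 (@weighted_lebesgue R) setT h -> L2 (@weighted_lebesgue R) setT (right_shift t h).
Proof.
move=> t0 [mr mi fi].
have mt : measurable_fun setT (fun y : R => y - t) by exact: measurable_funB.
have mR : measurable_fun setT (fun y => Re (right_shift t h y)).
  exact: (measurableT_comp mr mt).
have mI : measurable_fun setT (fun y => Im (right_shift t h y)).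
  exact: (measurableT_comp mi mt).
split => //.
have mW : measurable_fun setT (fun x : R => (weight x)%:E).
  by apply/measurable_EFinP; exact: measurable_weight.
have mh := measurable_normc_sq mr mi.
have mh' := measurable_normc_sq mR mI.
have w0 x : (0 <= (weight x : R)%:E)%E by rewrite lee_fin ltW// weight_gt0.
pose G y : \bar R := ((normc (h y) ^+ 2)%:E * (weight y)%:E)%E.
have mG : measurable_fun setT G by exact: emeasurable_funM.
have G0 y : (0 <= G y)%E by rewrite mule_ge0// lee_fin sqr_ge0.
apply: le_lt_trans fi; rewrite !ge0_integral_weighted//;
  try by move=> x; rewrite lee_fin sqr_ge0.
rewrite -[leRHS](ge0_integral_translation t mG G0).
apply: ge0_le_integral => //.
- by move=> x _; rewrite mule_ge0// lee_fin sqr_ge0.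
- exact: emeasurable_funM.
- exact: (measurableT_comp mG mt).
by move=> y _; rewrite /G lee_wpmul2l ?lee_fin ?sqr_ge0// weight_translation.
Qed.

Lemma orthogonal_complement_realM (M : set (C -> C)) (c : R) (g : C -> C) :
  closed_subspace M -> orthogonal_complement M g ->
  orthogonal_complement M (fun z => c%:C * g z).
Proof.
move=> hM Ng; have [hb gE] := H2D_coef Ng.1.
rewrite [X in _ X](_ : _ = fn (scl c%:C (coef g))); last by rewrite fnZ// -gE.
apply: (orthogonal_complement_fn hM (ell2Z _ hb)).2 => v Vv.
rewrite sdotZr//; last by case: Vv.
have Ng' : orthogonal_complement M (fn (coef g)) by rewrite -gE.
by rewrite ((orthogonal_complement_fn hM hb).1 Ng' v Vv) mulr0.
Qed.

End dilation.

Theorem theorem2p5 (R : realType) (M : set (R[i] -> R[i]))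
    (hM : closed_subspace M) :
  cesaro_op @` M `<=` M <->
  forall t : R, 0 <= t ->
    right_shift t @` F_image (orthogonal_complement M)
      `<=` F_image (orthogonal_complement M).
Proof.
have F := ae_filter_ringOfSetsType (@lebesgue_measure R).
have e0 (x : R) : (expR x)%:C != 0 :> R[i] by rewrite eq_complex /= eqxx andbT gt_eqF ?expR_gt0.
split=> [inv t t0 _ [h [L2h [f Nf hf]] <-]|inv].
  (* The shift corresponds to e^{-t/2} times the composition operator; the scalar is absorbed by the
     subspace. *)
  have Nf' : orthogonal_complement M (fun z => (expR (- (t / 2)))%:C * comp_disc t f z).
    have Nc : orthogonal_complement M (comp_disc t f) by exact: ((cesaro_composition_invariant hM).1 inv).
    exact: (orthogonal_complement_realM (expR (- (t / 2))) hM Nc).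
  split; first exact: L2_right_shift.
  exists (fun z => (expR (- (t / 2)))%:C * comp_disc t f z) => //.
  apply/ae_weighted; have [L2g hg] := laplace_invP Nf.1; have [L2g' hg'] := laplace_invP Nf'.1.
  (* The dilated inverse transform of [f] and the chosen inverse transform of the new function have
     equal Laplace transforms, hence agree almost everywhere. *)
  have := laplace_inj (L2_dilation t0 L2g) L2g' (fun s s0 => etrans (laplace_dilation t0 Nf.1 s0) (esym (hg' s s0))).
  move=> /ae_expR gg; have := ae_translation t ((ae_weighted _).1 hf) => ht.
  apply: ae_impl2 ht gg _ => y; rewrite /right_shift => -> gg.
  by rewrite {1}/F_map -W_T_dilation /F_map /W_map /T_inv gg.
apply: (cesaro_composition_invariant hM).2 => t f t0 Nf.
have [L2g hg] := laplace_invP Nf.1.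
have Ff : F_image (orthogonal_complement M) (F_map f).
  split; first exact: L2_W_T.
  by exists f => //; apply/ae_weighted; apply: aeW.
have [_ [f'' Nf'' hf'']] := inv t t0 (right_shift t (F_map f)) (ex_intro2 _ _ _ Ff erefl).
have [L2g'' hg''] := laplace_invP Nf''.1.
have gg : {ae @lebesgue_measure R, forall x, 0 < x ->
    dilation t (laplace_inv (U_map f)) x = laplace_inv (U_map f'') x}.
  (* [W_map] and [T_inv] multiply by nonvanishing factors, so the equality of images on the line
     descends to the half-line. *)
  apply: ae_ln; move/ae_weighted: hf''; apply: filterS => y hy.
  by apply: W_T_inj; rewrite W_T_dilation; exact: hy.
(* Equality of Laplace transforms gives equality of the images under [U_map], hence on the disc; off
   the disc both sides are 0 by convention. *)
have f''E : f'' = (fun z => (expR (- (t / 2)))%:C * comp_disc t f z).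
  apply: H2D_U_map_inj => [s s0|z z1].
    rewrite -hg''// -laplace_dilation//; last exact: Nf.1.
    by apply/esym/ae_eq_laplace => //; exact: L2_dilation.
  by rewrite /comp_disc (negbTE z1) mulr0; exact: (Nf''.1).2.
(* The scalar e^{-t/2} is undone inside the complex subspace. *)
have -> : comp_disc t f = (fun z => (expR (t / 2))%:C * f'' z).
  by apply/funext => z; rewrite f''E mulrA -rmorphM -expRD subrr expR0 mul1r.
exact: (orthogonal_complement_realM (expR (t / 2)) hM Nf'').
Qed.
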